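(* Consider the growing-sample-size model described in the context, and assume that the limit $\lim_{n\to\infty}\frac{s_{n+1}}{(n+1)k_n}$ exists and equals $\eta$ for some $\eta\in(0,1)$. Assume that $$\sum_{n\ge N}\frac{k_n}{s_{n+1}}\ \text{diverges},\qquad \sum_{n\ge N}\frac{k_n^2}{s_{n+1}^2}\ \text{converges},\qquad \sum_{n\ge N}\frac{k_n}{s_{n+1}}\left|\frac{s_{n+1}}{(n+1)k_n}-\eta\right|\ \text{converges}.$$ Assume, also, that one of the following is satisfied: (A1) $g$ is Lipschitz on $[0,1]$, and each of $\sum_{n\ge N}(n+1)^{-1}k_n^{-1/2}$ and $\sum_{n\ge N}s_{n+1}^{-1}k_n^{1/2}$ converges. (A2) $g\in\mathcal C^{(1)}[0,1]$, and each of $\sum_{n\ge N}(n+1)^{-1}k_n^{-1/2}\omega_{g'}(k_n^{-1/2})$, $\sum_{n\ge N}s_{n+1}^{-1}k_n^{1/2}\omega_{\varphi'}(k_n^{-1/2})$ and $\sum_{n\ge N}s_{n+1}^{-1}k_n^{1/2}\omega_{\psi'}(k_n^{-1/2})$ converges, where $\varphi(x)=xg(x)$ and $\psi(x)=xg(x)+(1-x)\{1-g(x)\}$. (A3) $g\in\mathcal C^{(2)}[0,1]$, and each of $\sum_{n\ge N}(n+1)^{-1}k_n^{-1}$ and $\sum_{n\ge N}s_{n+1}^{-1}$ converges. Then the sequence $\{(n^{-1}A_n,s_n^{-1}B_n,s_n^{-1}C_n)\}_{n\ge N+1}$ converges almost surely to a (possibly path dependent) compact, connected, internally chain transitive invariant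 set, contained in $\hat{\mathcal S}$, corresponding to the autonomous ODE $$(\dot a(t),\dot b(t),\dot c(t))=\big(\eta\hat h_1(a(t),b(t),c(t)),\hat h_2(a(t),b(t),c(t)),\hat h_3(a(t),b(t),c(t))\big),\qquad (a(0),b(0),c(0))=(A_N/N,0,0).$$
   Context: **Model (growing sample size).** Fix an integer $N\ge1$, a sequence $\{k_n:n\ge N\}$ of positive integers growing with $n$, a constant $\alpha>0$, a memory parameter $p\in[0,1]\setminus\{1/2\}$ and a reinforcement function $f:[0,1]\to[0,1]$. Put $g(x)=pf(x)+(1-p)\{1-f(x)\}$ (so $g:[0,1]\to[0,1]$), $s_n=\sum_{i=N+1}^nk_{i-1}$ for $n\ge N+1$, and let $\{\beta_n:n\ge N\}$ be positive reals with $n\beta_n=\alpha s_n$ for all $n\ge N+1$. $G_N$ is the graph with vertices $v_1,\dots,v_N$ and no edges; each $v_i$ ($i\le N$) has an arbitrary state $X_i\in\{+1,-1\}$. For $n\ge N$, given the $\sigma$-field $\mathcal F_n$ of all information up to and including epoch $n$ (the directed multigraph $G_n$ on $v_1,\dots,v_n$, its states and its history), a new vertex $v_{n+1}$ arrives and indices $U_{n,1},\dots,U_{n,k_n}$ are drawn, conditionally i.i.d. given $\mathcal F_n$, with $$\mathbf P[U_{n,1}=m\mid\mathcal F_n]=\frac{\mathrm{indeg}_n(v_m)+\beta_n}{\sum_{j=1}^n\mathrm{indeg}_n(v_j)+n\beta_n},\quad m\in\{1,\dots,n\},$$ where $\mathrm{indeg}_n(v)$ is the in-degree of $v$ in $G_n$,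 counted with multiplicity. Let $P_n=\#\{i\le k_n:X_{U_{n,i}}=+1\}$. Given $\mathcal F_n$ and the sample, $X_{n+1}=+1$ with probability $g(P_n/k_n)$ and $X_{n+1}=-1$ with probability $1-g(P_n/k_n)$. Then for each $i\in\{1,\dots,k_n\}$ with $X_{U_{n,i}}=X_{n+1}$ a directed edge from $v_{n+1}$ to $v_{U_{n,i}}$ is added (repeated edges kept), giving $G_{n+1}$. States never change afterwards. **Statistics.** $A_n=\#\{i\le n:X_i=+1\}$, $B_n=\sum_{i\le n,\,X_i=+1}\mathrm{indeg}_n(v_i)$, $C_n=\sum_{i\le n}\mathrm{indeg}_n(v_i)$. **Drift.** $\hat{\mathcal S}=\{(a,b,c)\in[0,1]^3:c\ge b\}$; $q_\alpha=q_\alpha(a,b,c)=\frac{b+\alpha a}{c+\alpha}\in[0,1]$; on $\hat{\mathcal S}$, $\hat h_1(a,b,c)=g(q_\alpha)-a$, $\hat h_2(a,b,c)=q_\alpha g(q_\alpha)-b$, $\hat h_3(a,b,c)=q_\alpha g(q_\alpha)+(1-q_\alpha)\{1-g(q_\alpha)\}-c$. **Function classes.** $\mathcal C^{(i)}[0,1]$ is the set of functions on $[0,1]$ that extend to a function on an open set containing $[0,1]$ with continuous $i$-th derivative. For continuous $u$ on $[0,1]$ and $\delta>0$, $\omega_u(\delta)=\sup\{|u(x)-u(y)|:x,y\in[0,1],|x-y|<\delta\}$. **Dynamical notions.** For a (well-posed) autonomous ODE, a set $A\subset\hat{\mathcal S}$ is *invariant* if for every $\mathbf u\in A$ the solution $\mathbf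 x_{\mathbf u}$ with $\mathbf x_{\mathbf u}(0)=\mathbf u$ is defined for all $t\in\mathbb R$ and stays in $A$ for all $t\in\mathbb R$. A set $A$ is *internally chain transitive* if it is invariant, compact, and for all $\mathbf u,\mathbf v\in A$, $\epsilon>0$, $T>0$ there are $m\ge1$, points $\mathbf u_0=\mathbf u,\mathbf u_1,\dots,\mathbf u_m=\mathbf v$ in $A$ and times $t_1,\dots,t_m\ge T$ with $\|\mathbf x_{\mathbf u_{i-1}}(t_i)-\mathbf u_i\|<\epsilon$ for all $i\in\{1,\dots,m\}$. A sequence $z_n$ converges to a set $L$ if $\inf_{\mathbf w\in L}\|z_n-\mathbf w\|\to0$. *)

(* Defs.v *)
From HB Require Import structures.
From mathcomp Require Import all_boot all_order all_algebra.
From mathcomp Require Import all_classical all_reals all_analysis.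

Set Implicit Arguments.
Unset Strict Implicit.
Unset Printing Implicit Defensive.

Import Order.TTheory GRing.Theory Num.Theory.
Import numFieldNormedType.Exports.

Local Open Scope classical_set_scope.
Local Open Scope ring_scope.

Section Real_functions.
Variable R : realType.
Implicit Types (u g : R -> R) (a : nat -> R).

Definition C_class01 (i : nat) u : Prop :=
  exists (O : set R) (v : R -> R),
    [/\ open O, `[0, 1]%classic `<=` O,
        (forall x, 0 <= x <= 1 -> v x = u x),
        (forall j x, (j < i)%N -> O x -> derivable (derive1n j v) x 1)
      & (forall x, O x -> {for x, continuous (derive1n i v)})].

(* Only the values of [u] on [0, 1] matter: at the endpoints this is the
   one-sided derivative, so on [0, 1] it is the derivative of any C^1
   extension of [u]. *)
Definition deriv01 u (x : R) : R :=
  lim ((u y - u x) / (y - x) @[y --> within `[0, 1]%classic (x^')]).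

Definition modulus u (delta : R) : R :=
  sup [set e | exists x y, [/\ 0 <= x <= 1, 0 <= y <= 1, `|x - y| < delta
                             & e = `|u x - u y|]].

Definition summable_from (N : nat) a : Prop :=
  cvgn (fun n => \sum_(N <= j < n) a j).

Definition reinforce (p : R) (f : R -> R) (x : R) : R :=
  p * f x + (1 - p) * (1 - f x).

Definition varphi g (x : R) : R := x * g x.
Definition psi g (x : R) : R := x * g x + (1 - x) * (1 - g x).

End Real_functions.

Section Dynamics.
Variable R : realType.

(* (a, b, c) is encoded as ((a, b), c); the norm on this product is the sup
   norm. *)
Definition state : Type := (R * R * R)%type.
Implicit Types (F : state -> state) (D A L : set state) (u v : state)
  (I : set R) (x y : R -> state).

Definition Shat : set state :=
  [set z | [/\ 0 <= z.1.1 <= 1, 0 <= z.1.2 <= 1, 0 <= z.2 <= 1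
             & z.1.2 <= z.2]].

(* Solutions on the interval [I] of z' = F z, where F is only meaningful on
   [D], so that solutions are required to take their values in [D]. *)
Definition solves F D I x : Prop :=
  [/\ {within I, continuous x},
      forall t, I t -> D (x t)
    & forall t, (interior I) t ->
        [/\ is_derive t 1 (fun r => (x r).1.1) (F (x t)).1.1,
            is_derive t 1 (fun r => (x r).1.2) (F (x t)).1.2
          & is_derive t 1 (fun r => (x r).2) (F (x t)).2]].

Definition the_solution F D I u x : Prop :=
  [/\ solves F D I x, x 0 = u
    & forall y, solves F D I y -> y 0 = u -> forall t, I t -> y t = x t].

Definition invariant_set F D A : Prop :=
  A `<=` D /\
  forall u, A u -> exists x, the_solution F D setT u x /\ forall t, A (x t).

Definition internally_chain_transitive F D A : Prop :=
  [/\ invariant_set F D A, compact A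
    & forall u v (eps tmin : R), A u -> A v -> 0 < eps -> 0 < tmin ->
      exists (m : nat) (us : nat -> state) (ts : nat -> R),
      [/\ (1 <= m)%N, us 0%N = u, us m = v,
          forall i, (i <= m)%N -> A (us i)
        & forall i, (1 <= i <= m)%N -> tmin <= ts i /\
            exists x, the_solution F D setT (us i.-1) x /\
                      `|x (ts i) - us i| < eps]].

(* [inf set0] is 0 here, hence the nonemptiness condition. *)
Definition converges_to_set (z : nat -> state) L : Prop :=
  L !=set0 /\
  inf [set r | exists2 w, L w & r = `|z n - w|] @[n --> \oo] --> (0 : R).

Definition q_alpha (alpha : R) (z : state) : R :=
  (z.1.2 + alpha * z.1.1) / (z.2 + alpha).

Definition h1 (alpha : R) (g : R -> R) (z : state) : R :=
  g (q_alpha alpha z) - z.1.1.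
Definition h2 (alpha : R) (g : R -> R) (z : state) : R :=
  q_alpha alpha z * g (q_alpha alpha z) - z.1.2.
Definition h3 (alpha : R) (g : R -> R) (z : state) : R :=
  q_alpha alpha z * g (q_alpha alpha z)
  + (1 - q_alpha alpha z) * (1 - g (q_alpha alpha z)) - z.2.

Definition drift (eta alpha : R) (g : R -> R) (z : state) : state :=
  (eta * h1 alpha g z, h2 alpha g z, h3 alpha g z).

End Dynamics.

Section Conditioning.
Context {d : measure_display} {T : measurableType d} {R : realType}.

(* [q] is a version of P[E | G], for a sub-sigma-algebra [G] *)
Definition cond_prob (P : probability T R) (G : set (set T)) (E : set T)
    (q : T -> R) : Prop :=
  (forall Y : set R, measurable Y -> G (q @^-1` Y)) /\
  (forall A, G A -> P (E `&` A) = (\int[P]_(w in A) (q w)%:E)%E).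

End Conditioning.

Section Model.
Context {d : measure_display} {T : measurableType d} {R : realType}.
Variables (N : nat) (k : nat -> nat).

Definition s_ (n : nat) : nat := (\sum_(N.+1 <= i < n.+1) k i.-1)%N.

(* Vertices are numbered from 1. [X i w] is true iff v_i has state +1;
   [U n i], for 1 <= i <= k n, are the indices drawn when v_(n+1) arrives. *)
Variables (X : nat -> T -> bool) (U : nat -> nat -> T -> nat).

Definition new_edges (n : nat) (w : T) : seq (nat * nat) :=
  [seq (n.+1, U n i w) | i <- index_iota 1 (k n).+1 & X (U n i w) w == X n.+1 w].

(* the multiset of directed edges (source, target) of G_n *)
Definition edges (n : nat) (w : T) : seq (nat * nat) :=
  flatten [seq new_edges j w | j <- index_iota N n].

Definition indeg (n m : nat) (w : T) : nat :=
  count (fun e => e.2 == m) (edges n w).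

Definition A_ (n : nat) (w : T) : nat := (\sum_(1 <= i < n.+1 | X i w) 1)%N.
Definition B_ (n : nat) (w : T) : nat :=
  (\sum_(1 <= i < n.+1 | X i w) indeg n i w)%N.
Definition C_ (n : nat) (w : T) : nat := (\sum_(1 <= i < n.+1) indeg n i w)%N.

Definition history_events (n : nat) : set (set T) :=
  [set E | exists i, (1 <= i <= n)%N /\ E = [set w | X i w]] `|`
  [set E | exists j i m, [/\ (N <= j < n)%N, (1 <= i <= k j)%N
                           & E = [set w | U j i w = m]]].

Definition sample_events (n : nat) : set (set T) :=
  [set E | exists i m, (1 <= i <= k n)%N /\ E = [set w | U n i w = m]].

Definition F_ (n : nat) : set (set T) := <<s history_events n >>.

Definition F_sample (n : nat) : set (set T) :=
  <<s history_events n `|` sample_events n >>.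

Definition attach_prob (beta : nat -> R) (n m : nat) (w : T) : R :=
  ((indeg n m w)%:R + beta n)
  / ((\sum_(1 <= j < n.+1) indeg n j w)%N%:R + n%:R * beta n).

Definition P_ (n : nat) (w : T) : nat :=
  (\sum_(1 <= i < (k n).+1 | X (U n i w) w) 1)%N.

(* The conditions imposed for n >= N: the joint conditional law of
   U_(n,1), ..., U_(n,k_n) given F_n is the product of the attachment laws
   (conditionally i.i.d.), and the conditional law of the new state given F_n
   and the sample is Bernoulli on {+1, -1} with parameter g(P_n / k_n). *)
Definition growing_sample_model (P : probability T R) (beta : nat -> R)
    (g : R -> R) : Prop :=
  [/\ forall i, (1 <= i)%N -> measurable_fun setT (X i),
      forall n i, (N <= n)%N -> (1 <= i <= k n)%N ->
        measurable_fun setT (U n i) /\ forall w, (1 <= U n i w <= n)%N,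
      forall n (m : nat -> nat), (N <= n)%N ->
        (forall i, (1 <= i <= k n)%N -> (1 <= m i <= n)%N) ->
        cond_prob P (F_ n)
          [set w | forall i, (1 <= i <= k n)%N -> U n i w = m i]
          (fun w => \prod_(1 <= i < (k n).+1) attach_prob beta n (m i) w)
    & forall n, (N <= n)%N ->
        cond_prob P (F_sample n) [set w | X n.+1 w]
          (fun w => g ((P_ n w)%:R / (k n)%:R))].

Definition stat (n : nat) (w : T) : state R :=
  ((A_ n w)%:R / n%:R, (B_ n w)%:R / (s_ n)%:R, (C_ n w)%:R / (s_ n)%:R).

End Model.

Section Assumptions.
Variable R : realType.
Variables (N : nat) (k : nat -> nat) (g : R -> R).

Let s (n : nat) : R := (s_ N k n)%:R.
Let rk (n : nat) : R := Num.sqrt (k n)%:R.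

Definition assumption_A1 : Prop :=
  [/\ [lipschitz g x | x in `[0, 1]%classic],
      summable_from N (fun n => n.+1%:R^-1 * (rk n)^-1)
    & summable_from N (fun n => (s n.+1)^-1 * rk n)].

Definition assumption_A2 : Prop :=
  [/\ C_class01 1 g,
      summable_from N
        (fun n => n.+1%:R^-1 * (rk n)^-1 * modulus (deriv01 g) (rk n)^-1),
      summable_from N
        (fun n => (s n.+1)^-1 * rk n * modulus (deriv01 (varphi g)) (rk n)^-1)
    & summable_from N
        (fun n => (s n.+1)^-1 * rk n * modulus (deriv01 (psi g)) (rk n)^-1)].

Definition assumption_A3 : Prop :=
  [/\ C_class01 2 g,
      summable_from N (fun n => n.+1%:R^-1 * (k n)%:R^-1 : R)
    & summable_from N (fun n => (s n.+1)^-1)].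

End Assumptions.

(* Main.v *)
Require Import Defs.
From mathcomp Require Import all_boot all_order all_algebra.
From mathcomp Require Import all_classical all_reals all_analysis.
From mathcomp Require Import measurable_realfun.
From mathcomp Require Import ring lra zify.
Import Order.TTheory GRing.Theory Num.Theory.
Import numFieldNormedType.Exports.
Local Open Scope classical_set_scope.
Local Open Scope ring_scope.

(** Why the theorem holds.

    With z_n the vector of normalised statistics and gamma_n = k_n / s_(n+1),
    one epoch of the model reads
      z_(n+1) = z_n + gamma_n F(z_n) + error_n,
    where F is the drift.  So z_n follows the flow of F, up to the errors, in
    the time scale tau_n = gamma_0 + ... + gamma_(n-1).  The error has three
    parts, and the hypotheses make the series of each of them converge.

    - Noise: the new state and the sampled proportion minus their conditional
      means given the past.  The weights are square summable, so the noise
      series converges almost surely (martingale_series_cauchy, by Kolmogorov's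
      maximal inequality).  The past of an epoch takes finitely many values, so
      conditioning is averaging over the atoms of a finite partition, and
      being centered on each atom replaces the conditional expectation
      (mean_outcome_atom, noise_centered).
    - Bias: given the past, the sampled proportion is the frequency of
      successes in k_n independent trials with success probability q, so the
      conditional means are Bernstein-type averages of g, x g(x) and
      x g(x) + (1 - x)(1 - g(x)), evaluated near q and not at q.  The mean
      absolute deviation of the frequency is at most k_n^(-1/2) and its
      variance at most 1/k_n; with the expansion of the function around q that
      each of (A1), (A2), (A3) provides, this bounds the bias by the terms of
      the series assumed to converge (sample_mean_bias, bias_control).
    - Time scale: the first coordinate moves with step 1/(n+1) instead of
      eta gamma_n; the difference is summable by assumption.

    Since gamma_n^2 is summable too, a discrete Gronwall argument shows that z_n
    is an asymptotic pseudotrajectory of the flow: started from z_n, the flow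
    stays close to z_(n+1), z_(n+2), ... over any bounded stretch of time, with
    an error that vanishes as n grows (asymptotic_pseudotrajectory).  Then L is
    the set of accumulation points of z_n.  It is invariant because translates
    of the trajectory of z_n converge to orbits through L; two of its points are
    joined by chains cut out of z_n itself; and a set joined by chains whose
    pieces are orbits cannot be split into two disjoint compact parts.

    The drift only makes sense on Shat, but it has the form
      (eta, 1, 1) (target(z) - z)   with target(z) in Shat,
    so it extends to a globally Lipschitz field on the whole space, by
    precomposing the target with a Lipschitz retraction onto Shat.  The extended
    field has a flow defined for all times (picard_lindelof), which leaves Shat
    forward invariant (flow_Shat), and on orbits inside Shat it solves the
    original equation. *)

Set Implicit Arguments.
Unset Strict Implicit.
Unset Printing Implicit Defensive.

(** * Derivatives, antiderivatives and Gronwall's inequality *)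

Section Calculus.
Context {R : realType}.
Implicit Types (f g h : R -> R) (a b t : R).

Lemma is_derive_continuous f (df : R) t : is_derive t 1 f df -> {for t, continuous f}.
Proof.
move=> fd; apply: differentiable_continuous.
by apply/derivable1_diffP; apply: ex_derive.
Qed.

Lemma nondecreasing_of_deriv f (df : R -> R) a b : a <= b ->
  (forall t, a < t < b -> is_derive t 1 f (df t)) ->
  {within `[a, b], continuous f} ->
  (forall t, a < t < b -> 0 <= df t) -> f a <= f b.
Proof.
move=> ab fd cf df0; rewrite -subr_ge0.
have [->|ab'] := eqVneq a b; first by rewrite subrr.
have altb : a < b by rewrite lt_neqAle ab' ab.
have fd' x : x \in `]a, b[%R -> is_derive x 1 f (df x) by rewrite in_itv/= => /fd.
have [c cab ->] := MVT altb fd' cf.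
by rewrite mulr_ge0 ?subr_ge0// df0//; move: cab; rewrite in_itv.
Qed.

Lemma le_of_deriv_le f g (df dg : R -> R) a b : a <= b ->
  (forall t, is_derive t 1 f (df t)) -> (forall t, is_derive t 1 g (dg t)) ->
  (forall t, a < t < b -> df t <= dg t) -> f b - f a <= g b - g a.
Proof.
move=> ab fd gd le.
suff : (g - f) a <= (g - f) b by rewrite !fctE; lra.
apply: (@nondecreasing_of_deriv _ (fun t => dg t - df t)) => //.
- apply: continuous_subspaceT => s.
  by apply: (@is_derive_continuous _ (dg s - df s)); apply: is_deriveB.
- by move=> s /le; rewrite subr_ge0.
Qed.

Lemma is_derive_expRM (K t : R) :
  is_derive t 1 (fun s => expR (K * s)) (K * expR (K * t)).
Proof.
have H : is_derive t 1 (fun s : R => K * s) K.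
  have := is_deriveZ (f := id) (x := t) (v := 1) K; move=> /(_ 1 _) H.
  by apply: is_derive_eq; rewrite scaler1.
by rewrite mulrC; exact: (@is_derive1_comp _ expR).
Qed.

Lemma is_derive_reflect f (df : R) t : is_derive (- t) 1 f df ->
  is_derive t 1 (fun s => f (- s)) (- df).
Proof.
move=> fd; rewrite -mulrN1.
by apply: (@is_derive1_comp _ f (fun s => - s)).
Qed.

(** The fundamental theorem of calculus for integrals with a fixed lower
    bound gives an antiderivative to the right of that bound only. *)
Lemma antiderivative_right f : continuous f ->
  exists G : R -> R, G 0 = 0 /\ forall t : R, -1 < t -> is_derive t 1 G (f t).
Proof.
move=> cf.
pose F (x : R) : R := (\int[lebesgue_measure]_(t in `[(-1)%R, x]) f t)%R.
exists (fun x : R => F x - F 0); split; first by rewrite subrr.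
move=> t t1.
have [dF F'] : derivable F t 1 /\ (F^`())%classic t = f t.
  apply: (@continuous_FTC1 _ f (BLeft (-1)) t (t + 1)) => //.
  - by rewrite ltrDl.
  - apply: continuous_compact_integrable; first exact: segment_compact.
    exact: continuous_subspaceT.
  - exact: cf.
have Ft : is_derive t 1 F (f t) by rewrite -F' derive1E; exact: derivableP.
have := @is_deriveB _ _ _ F (cst (F 0)) t 1 _ _ Ft (is_derive_cst _ _ _).
by rewrite subr0.
Qed.

(** Two antiderivatives valid on overlapping half-lines, the second obtained
    by reflection, differ by a constant on the overlap; as both vanish at 0
    they agree there and can be glued. *)
Lemma antiderivative f : continuous f ->
  exists G : R -> R, G 0 = 0 /\ forall t, is_derive t 1 G (f t).
Proof.
move=> cf.
have [G [G0 Gd]] := antiderivative_right cf.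
have [|H [H0 Hd]] := @antiderivative_right (fun t => f (- t)).
  by move=> t; apply: continuous_comp; [exact: opp_continuous|exact: cf].
have Hd' t : t < 1 -> is_derive t 1 (fun s => - H (- s)) (f t).
  move=> t1; rewrite -[f t]opprK; apply: is_deriveN; apply: is_derive_reflect.
  by rewrite -{2}(opprK t); apply: Hd; lra.
have GH t : -1 < t -> t < 1 -> G t = - H (- t).
  move=> t1 t2.
  suff e : forall x y : R, -1 < x -> x <= y -> y < 1 -> G x + H (- x) = G y + H (- y).
    have [t0|t0] := leP 0 t.
      by have := e 0 t; rewrite G0 oppr0 H0; lra.
    by have := e t 0; rewrite G0 oppr0 H0; lra.
  have D (s : R) : -1 < s < 1 -> is_derive s 1 (fun s => G s + H (- s)) 0.
    move=> /andP[s1 s2].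
    have := is_deriveB (Gd s s1) (Hd' s s2); rewrite subrr.
    by congr is_derive; apply/funext => z; rewrite !fctE opprK.
  move=> x y x1 xy y1; apply/eqP; rewrite eq_le; apply/andP; split.
    apply: (@nondecreasing_of_deriv (fun s => G s + H (- s)) (fun=> 0)) => //.
    + by move=> s /andP[? ?]; apply: D; lra.
    + apply: continuous_in_subspaceT => s; rewrite inE/= in_itv/= => /andP[? ?].
      by apply: is_derive_continuous; apply: D; lra.
  rewrite -lerN2.
  have D' (s : R) : -1 < s < 1 -> is_derive s 1 (fun s => - (G s + H (- s))) 0.
    by move=> /D/is_deriveN; rewrite oppr0.
  apply: (@nondecreasing_of_deriv (fun s => - (G s + H (- s))) (fun=> 0)) => //.
  + by move=> s /andP[? ?]; apply: D'; lra.
  + apply: continuous_in_subspaceT => s; rewrite inE/= in_itv/= => /andP[? ?].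
    by apply: is_derive_continuous; apply: D'; lra.
exists (fun t => if 0 <= t then G t else - H (- t)); split; first by rewrite lexx.
move=> t; have [t0|t0] := ltP (-1) t.
  apply: near_eq_is_derive (Gd t t0).
  near=> s; have st : -1 < s by near: s; exact: lt_nbhsr.
  by case: leP => // s0; apply: GH => //; lra.
apply: near_eq_is_derive (Hd' t _); last lra.
near=> s; have st : s < 0 by near: s; apply: lt_nbhsl; lra.
by rewrite leNgt st.
Unshelve. all: by end_near.
Qed.

(** V(t) e^(-K t) has a nonpositive derivative. *)
Lemma gronwall_le (V dV : R -> R) (K a b : R) : a <= b ->
  (forall t, a < t < b -> is_derive t 1 V (dV t)) ->
  {within `[a, b], continuous V} ->
  (forall t, a < t < b -> dV t <= K * V t) -> V b <= V a * expR (K * (b - a)).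
Proof.
move=> ab dVt cV le.
have E t : is_derive t 1 (fun s => expR (- K * s)) (- K * expR (- K * t)).
  exact: is_derive_expRM.
suff H : (- (V * (fun s => expR (- K * s)))) a <= (- (V * (fun s => expR (- K * s)))) b.
  move: H; rewrite !fctE lerN2 => H.
  have /(ler_wpM2r (expR_ge0 (K * b))) := H.
  by rewrite -!mulrA -!expRD !mulNr addNr expR0 mulr1 mulrBr addrC.
apply: (@nondecreasing_of_deriv _ (fun t => - (V t * (- K * expR (- K * t)) + expR (- K
    * t) * dV t))) => //.
- move=> t tab; apply: is_deriveN.
  have := @is_deriveM _ _ V (fun s => expR (- K * s)) t 1 _ _ (dVt t tab) (E t).
  by [].
- move=> t; apply: continuousN; apply: continuousM; first exact: cV.
  by apply: continuous_subspaceT => s; apply: is_derive_continuous (E s).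
- move=> t /le H; rewrite oppr_ge0.
  rewrite (_ : _ + _ = expR (- K * t) * (dV t - K * V t)); last ring.
  by rewrite pmulr_rle0 ?expR_gt0// subr_le0.
Qed.
End Calculus.

(** * The norm of the state space *)

Section StateNorm.
Context {R : realType}.
Implicit Types (z : state R) (e : R).

Lemma state_norm_le z e :
  (`|z| <= e) = [&& `|z.1.1| <= e, `|z.1.2| <= e & `|z.2| <= e].
Proof. by rewrite prod_normE/= prod_normE/= !ge_max andbA. Qed.

Lemma state_norm_lt z e :
  (`|z| < e) = [&& `|z.1.1| < e, `|z.1.2| < e & `|z.2| < e].
Proof. by rewrite prod_normE/= prod_normE/= !gt_max andbA. Qed.

Lemma state_coord_norm z : [/\ `|z.1.1| <= `|z|, `|z.1.2| <= `|z| & `|z.2| <= `|z|].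
Proof. by apply/and3P; rewrite -state_norm_le. Qed.

Lemma state_eqP (u v : state R) : [/\ u.1.1 = v.1.1, u.1.2 = v.1.2 & u.2 = v.2] -> u = v.
Proof. by move: u v => [[a b] c] [[a' b'] c']/= [-> -> ->]. Qed.

End StateNorm.

(** * Existence of integral curves of a Lipschitz field *)

Section Picard.
Context {R : realType}.

Lemma geometric_le0 (a C : R) : (forall n, a <= C * 2^-1 ^+ n) -> a <= 0.
Proof.
move=> H; rewrite leNgt; apply/negP => a0.
have C0 : 0 < C by have := H 0%N; rewrite expr0 mulr1; lra.
have [n Hn] : exists n : nat, C / a < n%:R.
  exists (Num.bound (C / a)); apply: le_lt_trans (archi_boundP _); first exact: lexx.
  by rewrite divr_ge0// ltW.
have H2 : (n%:R : R) < 2 ^+ n.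
  by rewrite -natrX ltr_nat ltn_expl.
have := H n; rewrite exprVn.
rewrite ler_pdivlMr ?exprn_gt0// leNgt => /negP; apply.
move: Hn; rewrite ltr_pdivrMr// => Hn; nra.
Qed.

(** The sequences u_n - 2 C 2^-n and u_n + 2 C 2^-n are monotone and enclose
    the limit, which gives the rate without further summation. *)
Lemma geometric_limit (u : nat -> R) (C : R) :
  (forall n, `|u n.+1 - u n| <= C * 2^-1 ^+ n) ->
  exists l, forall n, `|u n - l| <= 2 * C * 2^-1 ^+ n.
Proof.
move=> H; have C0 : 0 <= C.
  by have := H 0%N; rewrite expr0 mulr1; apply: le_trans.
pose a n := u n - 2 * C * 2^-1 ^+ n; pose b n := u n + 2 * C * 2^-1 ^+ n.
have aS n : a n <= a n.+1.
  by rewrite /a exprS; have := H n; rewrite ler_norml => /andP[]; lra.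
have bS n : b n.+1 <= b n.
  by rewrite /b exprS; have := H n; rewrite ler_norml => /andP[]; lra.
have ai m n : (m <= n)%N -> a m <= a n.
  by move=> /subnK <-; elim: (n - m)%N => // i; rewrite addSn => /le_trans; apply.
have bi m n : (m <= n)%N -> b n <= b m.
  by move=> /subnK <-; elim: (n - m)%N => // i IH; rewrite addSn (le_trans (bS _)).
have ab m n : a m <= b n.
  apply: (le_trans (ai _ (maxn m n) (leq_maxl _ _))).
  apply: (le_trans _ (bi _ (maxn m n) (leq_maxr _ _))).
  rewrite /a /b; have : (0:R) <= 2^-1 ^+ (maxn m n) by rewrite exprn_ge0.
  move: (_ ^+ _) => q q0; nra.
have hs : has_sup (range a).
  split; first by exists (a 0%N), 0%N.
  by exists (b 0%N) => _ [m _ <-].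
exists (sup (range a)) => n.
have l1 : a n <= sup (range a) by apply: ub_le_sup; [case: hs|exists n].
have l2 : sup (range a) <= b n by apply: ge_sup; [case: hs|move=> _ [m _ <-]].
by rewrite ler_norml; move: l1 l2; rewrite /a /b; lra.
Qed.

(** Compare f with C e^(K t), whose derivative dominates that of f, on each
    side of 0. *)
Lemma exp_growth_bound (f df : R -> R) (C K : R) :
  f 0 = 0 -> (forall t : R, is_derive t 1 f (df t)) -> 0 <= C ->
  (forall t, `|df t| <= K * (C * expR (K * `|t|))) ->
  forall t, `|f t| <= C * expR (K * `|t|).
Proof.
move=> f0 fd C0 le.
have pos (h dh : R -> R) : h 0 = 0 -> (forall t : R, is_derive t 1 h (dh t)) ->
    (forall t, `|dh t| <= K * (C * expR (K * `|t|))) ->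
    forall t, 0 <= t -> h t <= C * expR (K * t).
  move=> h0 hd hle t t0.
  have E (s : R) : is_derive s 1 (fun s => C * expR (K * s)) (C * (K * expR (K * s))).
    by have := is_deriveZ C (is_derive_expRM K s).
  have : h t - h 0 <= C * expR (K * t) - C * expR (K * 0).
    apply: (le_of_deriv_le t0 hd E) => s /andP[s0 _].
    have := hle s; rewrite (ger0_norm (ltW s0)) ler_norml => /andP[_].
    by rewrite mulrCA.
  by rewrite h0 mulr0 expR0; lra.
have pos' (h dh : R -> R) : h 0 = 0 -> (forall t : R, is_derive t 1 h (dh t)) ->
    (forall t, `|dh t| <= K * (C * expR (K * `|t|))) ->
    forall t, 0 <= t -> `|h t| <= C * expR (K * t).
  move=> h0 hd hle t t0; rewrite ler_norml; apply/andP; split; last exact: (pos _ dh).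
  rewrite lerNl; apply: (pos (- h) (- dh)) => //.
  - by rewrite !fctE h0 oppr0.
  - by move=> s; rewrite !fctE normrN.
move=> t; have [t0|t0] := leP 0 t; first by rewrite (ger0_norm t0); exact: (pos' f df).
rewrite (ltr0_norm t0) -{1}(opprK t).
apply: (pos' (fun s => f (- s)) (fun s => - df (- s))).
- by rewrite oppr0.
- by move=> s; apply: is_derive_reflect.
- by move=> s; rewrite normrN (le_trans (le _))// normrN.
- by lra.
Qed.

(** A total choice of antiderivative, with a dummy value for discontinuous
    functions, so that it can be iterated on curves before their continuity
    is known. *)
Definition antiderivative_of (f : R -> R) : R -> R :=
  match pselect (continuous f) with
  | left cf => projT1 (cid (antiderivative cf))
  | right _ => cst 0
  end.

Lemma antiderivative_of0 f : antiderivative_of f 0 = 0.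
Proof. by rewrite /antiderivative_of; case: pselect => // cf; case: cid => G []. Qed.

Lemma is_derive_antiderivative_of (f : R -> R) (t : R) : continuous f -> is_derive t 1
    (antiderivative_of f) (f t).
Proof. by move=> cf; rewrite /antiderivative_of; case: pselect => // ?; case: cid => G
    []. Qed.

Definition has_velocity (x : R -> state R) (t : R) (v : state R) : Prop :=
  [/\ is_derive t 1 (fun r => (x r).1.1) v.1.1,
      is_derive t 1 (fun r => (x r).1.2) v.1.2
    & is_derive t 1 (fun r => (x r).2) v.2].

Lemma has_velocity_continuous x t v : has_velocity x t v -> {for t, continuous x}.
Proof.
move=> [/is_derive_continuous d1 /is_derive_continuous d2 /is_derive_continuous d3].
apply/cvgrPdist_lt => e e0.
move/cvgrPdist_lt : d1 => /(_ e e0) d1; move/cvgrPdist_lt : d2 => /(_ e e0) d2.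
move/cvgrPdist_lt : d3 => /(_ e e0) d3.
near=> s; rewrite state_norm_lt/=; apply/and3P; split; near: s => //.
Unshelve. all: by end_near.
Qed.

Variables (F : state R -> state R) (K : R).
Hypothesis K0 : 0 < K.
Hypothesis lipF : forall u v, `|F u - F v| <= K * `|u - v|.

Lemma lipschitz_comp_continuous (G : state R -> R) (x : R -> state R) t :
  (forall u v, `|G u - G v| <= K * `|u - v|) -> {for t, continuous x} ->
  {for t, continuous (fun s => G (x s))}.
Proof.
move=> lipG cx; apply/cvgrPdist_lt => e e0.
move/cvgrPdist_lt : cx => /(_ (e / K) (divr_gt0 e0 K0)).
apply: filterS => s; rewrite ltr_pdivlMr// mulrC => /(le_lt_trans _); apply.
exact: lipG.
Qed.

Lemma lipschitz_coords u v :
  [/\ `|(F u).1.1 - (F v).1.1| <= K * `|u - v|,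
      `|(F u).1.2 - (F v).1.2| <= K * `|u - v|
    & `|(F u).2 - (F v).2| <= K * `|u - v|].
Proof. by case: (state_coord_norm (F u - F v)) => ? ? ?; split; apply: le_trans (lipF _
    _). Qed.

Definition picard_step (u : state R) (x : R -> state R) (t : R) : state R :=
  (u.1.1 + antiderivative_of (fun s => (F (x s)).1.1) t,
   u.1.2 + antiderivative_of (fun s => (F (x s)).1.2) t,
   u.2 + antiderivative_of (fun s => (F (x s)).2) t).

Lemma velocity_picard_step u x t : continuous x ->
  has_velocity (picard_step u x) t (F (x t)).
Proof.
move=> cx.
have H (G : state R -> R) c : (forall u v, `|G u - G v| <= K * `|u - v|) ->
    is_derive t 1 (fun s => c + antiderivative_of (fun s => G (x s)) s) (G (x t)).
  move=> lipG; rewrite -[G (x t)]add0r.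
  have cGx : continuous (fun s => G (x s)).
    by move=> s; apply: lipschitz_comp_continuous => //; exact: cx.
  by have := is_deriveD (is_derive_cst c t 1) (is_derive_antiderivative_of t cGx).
split; [apply: (H (fun z => (F z).1.1))|apply: (H (fun z => (F z).1.2))|apply: (H (fun
    z => (F z).2))];
  by move=> w v; case: (lipschitz_coords w v).
Qed.

Lemma picard_step0 u x : picard_step u x 0 = u.
Proof. by apply: state_eqP; rewrite /= !antiderivative_of0 !addr0. Qed.

(** The mean value inequality in the weighted distance, one coordinate at a
    time. *)
Lemma velocity_diff_bound (x y : R -> state R) (vx vy : R -> state R) (C k : R) :
  x 0 = y 0 -> 0 <= C ->
  (forall t, has_velocity x t (vx t)) -> (forall t, has_velocity y t (vy t)) ->
  (forall t, `|vx t - vy t| <= k * (C * expR (k * `|t|))) ->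
  forall t, `|x t - y t| <= C * expR (k * `|t|).
Proof.
move=> xy0 C0 dx dy le t; rewrite state_norm_le/=.
apply/and3P; split.
- apply: (@exp_growth_bound (fun s => (x s).1.1 - (y s).1.1) (fun s => (vx s).1.1 - (vy
    s).1.1)) => //.
  + by rewrite xy0 subrr.
  + by move=> s; apply: is_deriveB; [case: (dx s)|case: (dy s)].
  + by move=> s; apply: le_trans (le s); case: (state_coord_norm (vx s - vy s)).
- apply: (@exp_growth_bound (fun s => (x s).1.2 - (y s).1.2) (fun s => (vx s).1.2 - (vy
    s).1.2)) => //.
  + by rewrite xy0 subrr.
  + by move=> s; apply: is_deriveB; [case: (dx s)|case: (dy s)].
  + by move=> s; apply: le_trans (le s); case: (state_coord_norm (vx s - vy s)).
- apply: (@exp_growth_bound (fun s => (x s).2 - (y s).2) (fun s => (vx s).2 - (vy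
    s).2)) => //.
  + by rewrite xy0 subrr.
  + by move=> s; apply: is_deriveB; [case: (dx s)|case: (dy s)].
  + by move=> s; apply: le_trans (le s); case: (state_coord_norm (vx s - vy s)).
Qed.

(** The Picard operator halves distances measured with the weight e^(2 K
    |t|). This weight makes the iteration contract on the whole line at
    once, so that no gluing of short-time solutions is needed. *)
Lemma picard_step_close u x y C : continuous x -> continuous y -> 0 <= C ->
  (forall t, `|x t - y t| <= 2 * C * expR (2 * K * `|t|)) ->
  forall t, `|picard_step u x t - picard_step u y t| <= C * expR (2 * K * `|t|).
Proof.
move=> cx cy C0 le.
apply: (@velocity_diff_bound _ _ (F \o x) (F \o y)) => //.
- by rewrite !picard_step0.
- by move=> t; exact: velocity_picard_step.
- by move=> t; exact: velocity_picard_step.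
- move=> t /=; apply: (le_trans (lipF _ _)).
  have := le t; have := ltW K0; move: (expR _) => E; nra.
Qed.

(** Successive Picard iterates are within M 2^-n e^(2 K |t|) of each other,
    hence converge locally uniformly to a fixed point of the Picard
    operator. *)
Theorem picard_lindelof u : exists x : R -> state R,
  x 0 = u /\ forall t, has_velocity x t (F (x t)).
Proof.
pose X := fix X n := if n is n'.+1 then picard_step u (X n') else cst u.
have cX n : continuous (X n).
  elim: n => [|n IH] t /=; first exact: cst_continuous.
  exact: has_velocity_continuous (velocity_picard_step u t IH).
pose M := `|F u| / (2 * K).
have M0 : 0 <= M by rewrite divr_ge0// mulr_ge0// ltW.
have X0 n : X n 0 = u by case: n => //= n; rewrite picard_step0.
have dX n t : `|X n.+1 t - X n t| <= M * 2^-1 ^+ n * expR (2 * K * `|t|).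
  elim: n t => [|n IH] t.
    apply: (@velocity_diff_bound _ _ (cst (F u)) (cst 0)).
    - by rewrite (X0 1%N) (X0 0%N).
    - by rewrite expr0 mulr1.
    - by move=> s; apply: (velocity_picard_step u s (cX 0%N)).
    - by move=> s; split; exact: is_derive_cst.
    - move=> s; rewrite /cst subr0 expr0 mulr1 /M.
      rewrite mulrA mulrCA divff ?mulr1; last by rewrite gt_eqF// mulr_gt0.
      have : 1 <= expR (2 * K * `|s|) by rewrite -expR0 ler_expR !mulr_ge0// ltW.
      have := normr_ge0 (F u); nra.
  apply: (@picard_step_close u (X n.+1) (X n) (M * 2^-1 ^+ n.+1)).
  - exact: (cX n.+1).
  - exact: cX.
  - by rewrite mulr_ge0// exprn_ge0.
  move=> s; apply: (le_trans (IH s)); rewrite exprS.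
  by rewrite le_eqVlt; apply/orP; left; apply/eqP; field.
have lim t : exists l : state R, forall n,
    `|X n t - l| <= 2 * (M * expR (2 * K * `|t|)) * 2^-1 ^+ n.
  have H (p : state R -> R) : (forall w v : state R, `|p w - p v| <= `|w - v|) ->
      exists l, forall n, `|p (X n t) - l| <= 2 * (M * expR (2 * K * `|t|)) * 2^-1 ^+ n.
    move=> pl; apply: geometric_limit => n; apply: (le_trans (pl _ _)).
    by rewrite mulrAC.
  have [|l1 H1] := H (fun z => z.1.1); first by move=> w v; case: (state_coord_norm (w
      - v)).
  have [|l2 H2] := H (fun z => z.1.2); first by move=> w v; case: (state_coord_norm (w
      - v)).
  have [|l3 H3] := H (fun z => z.2); first by move=> w v; case: (state_coord_norm (w -
      v)).
  by exists (l1, l2, l3) => n; rewrite state_norm_le/= H1 H2 H3.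
have [x xlim] : {x : R -> state R & forall t n,
    `|X n t - x t| <= 2 * (M * expR (2 * K * `|t|)) * 2^-1 ^+ n}.
  by exists (fun t => projT1 (cid (lim t))) => t; case: cid.
have cx : continuous x.
  move=> t; apply/cvgrPdist_le => e e0.
  pose C := 2 * (M * expR (2 * K * (`|t| + 1))).
  have C0 : 0 <= C by apply: mulr_ge0 => //; apply: mulr_ge0 => //; exact: expR_ge0.
  have [n Hn] : exists n, C * 2^-1 ^+ n < e / 4.
    apply: contrapT => /forallNP H; have : e / 4 <= 0; last lra.
    by apply: (@geometric_le0 _ C) => n; rewrite leNgt; apply/negP/H.
  have Cn s : `|s - t| < 1 -> `|X n s - x s| < e / 4.
    move=> st; apply: le_lt_trans Hn; apply: (le_trans (xlim s n)).
    rewrite ler_wpM2r ?exprn_ge0// ler_wpM2l// ler_wpM2l// ler_expR ler_wpM2l//.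
      by rewrite mulr_ge0// ltW.
    by rewrite -[s](subrK t) addrC (le_trans (ler_normD _ _))// lerD2l ltW.
  have e4 : 0 < e / 4 by rewrite divr_gt0.
  near=> s.
  have s1 : `|s - t| < 1.
    by near: s; have /cvgrPdist_lt/(_ 1 ltr01) := @cvg_id _ (nbhs t); apply: filterS =>
        s; rewrite distrC.
  have h1 := Cn _ s1; have h2 := Cn t; rewrite subrr normr0 in h2; have {}h2 := h2 ltr01.
  have h3 : `|X n t - X n s| < e / 4 by near: s; have /cvgrPdist_lt/(_ _ e4) := cX n t.
  have d1 := ler_distD (X n t) (x t) (x s).
  have d2 := ler_distD (X n s) (X n t) (x s).
  by move: h2; rewrite distrC; lra.
have fix_x t : x t = picard_step u x t.
  apply/eqP; rewrite -subr_eq0 -normr_le0.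
  apply: (@geometric_le0 _ (2 * (M * expR (2 * K * `|t|)))) => n.
  have h1 := xlim t n.+1.
  have h2 : `|X n.+1 t - picard_step u x t| <= M * 2^-1 ^+ n * expR (2 * K * `|t|).
    apply: picard_step_close => //; first by rewrite mulr_ge0// exprn_ge0.
    by move=> s; apply: (le_trans (xlim s n)); rewrite !mulrA [_ * 2^-1 ^+ n]mulrAC.
  rewrite -(subrK (X n.+1 t) (x t)) -addrA (le_trans (ler_normD _ _))// distrC.
  rewrite exprS in h1; lra.
exists x; split; first by rewrite fix_x picard_step0.
move=> t; have := velocity_picard_step u t cx.
by congr has_velocity; apply/funext => s; rewrite -fix_x.
Unshelve. all: by end_near.
Qed.

End Picard.

(** * Comparison of curves *)

Section Gronwall.
Context {R : realType}.
Implicit Types (u v : state R) (x y vx vy : R -> state R) (K a b t : R).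

(** The Euclidean square distance is differentiable along curves, unlike the
    sup norm of the state space; the two are comparable. *)
Definition sqdist u v : R :=
  (u.1.1 - v.1.1) ^+ 2 + (u.1.2 - v.1.2) ^+ 2 + (u.2 - v.2) ^+ 2.

Lemma norm_le_sqdist u v : `|u - v| ^+ 2 <= sqdist u v.
Proof.
rewrite /sqdist prod_normE/= prod_normE/=.
have h (r s : R) : Num.max r s = r \/ Num.max r s = s.
  by case: (leP r s); [right|left].
have [->|->] := h (Num.max `|u.1.1 - v.1.1| `|u.1.2 - v.1.2|) `|u.2 - v.2|;
 last by rewrite real_normK ?num_real// lerDr addr_ge0 ?sqr_ge0.
have [->|->] := h `|u.1.1 - v.1.1| `|u.1.2 - v.1.2|; rewrite real_normK ?num_real//.
  by rewrite -addrA lerDl addr_ge0 ?sqr_ge0.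
by rewrite addrAC lerDr addr_ge0 ?sqr_ge0.
Qed.

Lemma sqdist_le_norm u v : sqdist u v <= 3 * `|u - v| ^+ 2.
Proof.
have [] := state_coord_norm (u - v); rewrite /sqdist /= => h1 h2 h3.
have h (r s : R) : `|r| <= s -> r ^+ 2 <= s ^+ 2.
  by move=> rs; rewrite -(real_normK (num_real r)) lerXn2r ?nnegrE// (le_trans _ rs).
have := h _ _ h1; have := h _ _ h2; have := h _ _ h3; lra.
Qed.

Lemma within_continuousP (V : normedModType R) (A : set R) (f : R -> V) :
  {within A, continuous f} <-> forall t, A t -> forall e, 0 < e ->
    exists2 d, 0 < d & forall s, A s -> `|t - s| < d -> `|f t - f s| < e.
Proof.
split=> [/subspace_continuousP cf t At e e0|H].
  have /cvgrPdist_lt/(_ e e0) := cf t At.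
  rewrite near_withinE => -[d d0 dP]; exists d => // s As st.
  exact: dP.
apply/subspace_continuousP => t At; apply/cvgrPdist_lt => e e0.
rewrite near_withinE; have [d d0 dP] := H t At e e0.
by exists d => // s st As; exact: dP.
Qed.

Lemma within_continuous_coords x (A : set R) : {within A, continuous x} ->
  [/\ {within A, continuous (fun t => (x t).1.1)},
      {within A, continuous (fun t => (x t).1.2)}
    & {within A, continuous (fun t => (x t).2)}].
Proof.
move=> cx.
have H (p : state R -> R) : (forall w v : state R, `|p w - p v| <= `|w - v|) ->
    {within A, continuous (fun t => p (x t))}.
  move=> lp; apply/within_continuousP => t At e e0.
  have [d d0 dP] := (within_continuousP _ _).1 cx t At e e0.
  by exists d => // s As st; apply: (le_lt_trans (lp _ _)); exact: dP.
by split; [apply: (H (fun z => z.1.1))|apply: (H (fun z => z.1.2))|apply: (H (fun z =>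
    z.2))];
  move=> w v; case: (state_coord_norm (w - v)).
Qed.

Lemma is_derive_sqr_diff (f g : R -> R) (df dg t : R) :
  is_derive t 1 f df -> is_derive t 1 g dg ->
  is_derive t 1 (fun s => (f s - g s) ^+ 2) (2 * (f t - g t) * (df - dg)).
Proof.
move=> fd gd.
have D : is_derive t 1 (f - g) (df - dg) by apply: is_deriveB.
by have := @is_deriveX _ _ (f - g) 2 t 1 _ D; rewrite !fctE /= expr1.
Qed.

(** The derivative of the square distance of the two curves is at most 6 K
    times that square distance: each of the three coordinates contributes at
    most 2 K |x - y|^2. *)
Lemma velocity_gronwall x y vx vy K a b : a <= b -> 0 <= K ->
  (forall t, a < t < b -> has_velocity x t (vx t)) ->
  (forall t, a < t < b -> has_velocity y t (vy t)) ->
  {within `[a, b], continuous x} -> {within `[a, b], continuous y} ->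
  (forall t, a < t < b -> `|vx t - vy t| <= K * `|x t - y t|) ->
  sqdist (x b) (y b) <= sqdist (x a) (y a) * expR (6 * K * (b - a)).
Proof.
move=> ab K0 dx dy cx cy le.
apply: (@gronwall_le _ (fun t => sqdist (x t) (y t)) (fun t =>
  2 * ((x t).1.1 - (y t).1.1) * ((vx t).1.1 - (vy t).1.1) +
  2 * ((x t).1.2 - (y t).1.2) * ((vx t).1.2 - (vy t).1.2) +
  2 * ((x t).2 - (y t).2) * ((vx t).2 - (vy t).2))) => //.
- move=> t tab; have [x1 x2 x3] := dx t tab; have [y1 y2 y3] := dy t tab.
  have := is_deriveD (is_deriveD (is_derive_sqr_diff x1 y1) (is_derive_sqr_diff x2 y2))
   (is_derive_sqr_diff x3 y3).
  by [].
- have [x1 x2 x3] := within_continuous_coords cx.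
  have [y1 y2 y3] := within_continuous_coords cy.
  have H (f g : R -> R) : {within `[a, b], continuous f} -> {within `[a, b], continuous
      g} ->
      {within `[a, b], continuous (fun t => (f t - g t) ^+ 2)}.
    move=> cf cg t.
    have c1 : (f - g) s @[s --> nbhs (t : subspace `[a, b])] --> (f - g) t.
      by apply: cvgB; [exact: cf|exact: cg].
    rewrite (_ : (fun t => (f t - g t) ^+ 2) = (f - g) * (f - g)).
      exact: (cvgM c1 c1).
    by apply/funext => s; rewrite expr2 !fctE.
  move=> t; apply: cvgD; first apply: cvgD; exact: H.
- move=> t tab; have := le t tab.
  have := norm_le_sqdist (x t) (y t).
  have [] := state_coord_norm (vx t - vy t); have [] := state_coord_norm (x t - y t) =>
      /=.
  move: `|x t - y t| `|vx t - vy t| => m n h1 h2 h3 k1 k2 k3 S le'.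
  have m0 : 0 <= m by apply: le_trans h1.
  have H (r s : R) : `|r| <= m -> `|s| <= n -> 2 * r * s <= 2 * K * m ^+ 2.
    move=> rm sn; have : r * s <= m * n.
      by rewrite (le_trans (ler_norm _))// normrM ler_pM.
    have : m * n <= m * (K * m) by rewrite ler_wpM2l.
    by rewrite expr2; lra.
  have := H _ _ h1 k1; have := H _ _ h2 k2; have := H _ _ h3 k3.
  have : K * m ^+ 2 <= K * sqdist (x t) (y t) by rewrite ler_wpM2l.
  lra.
Qed.

Lemma has_velocity_reflect x t v : has_velocity x (- t) v ->
  has_velocity (fun s => x (- s)) t (- v).
Proof. by move=> [? ? ?]; split; apply: is_derive_reflect. Qed.

Lemma has_velocity_shift x (s t : R) v : has_velocity x (s + t) v ->
  has_velocity (fun r => x (s + r)) t v.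
Proof.
move=> [h1 h2 h3].
have H (f : R -> R) (df : R) : is_derive (s + t) 1 f df ->
    is_derive t 1 (fun r => f (s + r)) df.
  move=> fd; have D : is_derive t 1 (fun r : R => s + r) 1.
    have := is_deriveD (is_derive_cst s t (1 : R)) (is_derive_id t (1 : R)).
    by rewrite add0r.
  by have := @is_derive1_comp _ f (fun r => s + r) t _ _ fd D; rewrite mulr1.
by split; [apply: (H (fun r => (x r).1.1))|apply: (H (fun r => (x r).1.2))|apply: (H
    (fun r => (x r).2))].
Qed.

Lemma velocity_lipschitz x (v : R -> state R) (M a b : R) : a <= b ->
  (forall t, has_velocity x t (v t)) -> (forall t, a < t < b -> `|v t| <= M) ->
  `|x b - x a| <= M * (b - a).
Proof.
move=> ab dx le.
have H (f df : R -> R) : (forall t : R, is_derive t 1 f (df t)) ->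
    (forall t, a < t < b -> `|df t| <= M) -> `|f b - f a| <= M * (b - a).
  move=> fd dfM.
  have L t : is_derive t 1 (fun s : R => M * s) M.
    by have := is_deriveZ M (is_derive_id t (1 : R)); rewrite /= [M *: _]mulr1.
  have L' t : is_derive t 1 (fun s : R => - (M * s)) (- M).
    by have := is_deriveN (L t).
  rewrite ler_norml; apply/andP; split.
    have : - (M * b) - - (M * a) <= f b - f a.
      apply: (@le_of_deriv_le _ (fun s : R => - (M * s)) f (fun=> - M) df) => //.
      by move=> t /dfM; rewrite ler_norml => /andP[].
    by lra.
  rewrite mulrBr.
  apply: (@le_of_deriv_le _ f (fun s : R => M * s) df (fun=> M)) => //.
  by move=> t /dfM; rewrite ler_norml => /andP[].
rewrite state_norm_le/=; apply/and3P; split.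
- apply: (H (fun s => (x s).1.1) (fun s => (v s).1.1)); first by move=> t; case: (dx t).
  by move=> t /le; apply: le_trans; case: (state_coord_norm (v t)).
- apply: (H (fun s => (x s).1.2) (fun s => (v s).1.2)); first by move=> t; case: (dx t).
  by move=> t /le; apply: le_trans; case: (state_coord_norm (v t)).
- apply: (H (fun s => (x s).2) (fun s => (v s).2)); first by move=> t; case: (dx t).
  by move=> t /le; apply: le_trans; case: (state_coord_norm (v t)).
Qed.

End Gronwall.

(** * The flow of a Lipschitz field *)

Section Flow.
Context {R : realType}.
Variables (F : state R -> state R) (K : R).
Hypothesis K0 : 0 < K.
Hypothesis lipF : forall u v, `|F u - F v| <= K * `|u - v|.
Implicit Types (u v : state R) (x y : R -> state R) (s t : R).

Definition flow u : R -> state R := projT1 (cid (picard_lindelof K0 lipF u)).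

Lemma flow0 u : flow u 0 = u.
Proof. by rewrite /flow; case: cid => x []. Qed.

Lemma flow_velocity u t : has_velocity (flow u) t (F (flow u t)).
Proof. by rewrite /flow; case: cid => x [/= ? ?]. Qed.

Lemma flow_continuous u : continuous (flow u).
Proof. by move=> t; apply: has_velocity_continuous (flow_velocity u t). Qed.

Lemma within_continuous_reflect x t : {within `[t, 0], continuous x} ->
  {within `[0, - t], continuous (fun s => x (- s))}.
Proof.
move=> /within_continuousP cx; apply/within_continuousP => s.
rewrite /= in_itv/= => st e e0.
have [|d d0 dP] := cx (- s) _ e e0; first by rewrite /= in_itv/=; lra.
exists d => // r; rewrite /= in_itv/= => rt sr; apply: dP.
  by rewrite /= in_itv/=; lra.
by rewrite -opprD normrN.
Qed.

(** For negative times, Gronwall applies to the reversed curves, whose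
    velocities are again K-Lipschitz in the position. *)
Lemma integral_curves_sqdist x y t :
  {within `[Num.min 0 t, Num.max 0 t], continuous x} ->
  {within `[Num.min 0 t, Num.max 0 t], continuous y} ->
  (forall s, Num.min 0 t < s < Num.max 0 t ->
     has_velocity x s (F (x s)) /\ has_velocity y s (F (y s))) ->
  sqdist (x t) (y t) <= sqdist (x 0) (y 0) * expR (6 * K * `|t|).
Proof.
have [t0|t0] := leP 0 t => cx cy d.
  have := @velocity_gronwall _ x y (F \o x) (F \o y) K 0 t t0 (ltW K0) _ _ cx cy.
  rewrite ger0_norm// subr0; apply.
  - by move=> s /d [].
  - by move=> s /d [].
  - by move=> s _; exact: lipF.
have := @velocity_gronwall _ (fun s => x (- s)) (fun s => y (- s))
  (fun s => - F (x (- s))) (fun s => - F (y (- s))) K 0 (- t) _ (ltW K0).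
rewrite subr0 opprK oppr0 ltr0_norm//; apply.
- by lra.
- by move=> s st; apply: has_velocity_reflect; apply: (d _ _).1; lra.
- by move=> s st; apply: has_velocity_reflect; apply: (d _ _).2; lra.
- exact: within_continuous_reflect.
- exact: within_continuous_reflect.
- by move=> s _; rewrite -opprD normrN; exact: lipF.
Qed.

Lemma flow_sqdist u v t :
  sqdist (flow u t) (flow v t) <= sqdist u v * expR (6 * K * `|t|).
Proof.
rewrite -{2}(flow0 u) -{2}(flow0 v); apply: integral_curves_sqdist.
- by apply: continuous_subspaceT; exact: flow_continuous.
- by apply: continuous_subspaceT; exact: flow_continuous.
- by move=> s _; split; exact: flow_velocity.
Qed.

(** Used with both signs of t: orbits that start close together stay close
    over bounded times, and so do orbits that end close together. *)
Lemma flow_equicontinuous (T e : R) : 0 < e -> exists2 d, 0 < d &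
  forall u v t, `|t| <= T -> `|u - v| < d -> `|flow u t - flow v t| < e.
Proof.
move=> e0; pose E := expR (6 * K * T).
have E0 : 0 < E by exact: expR_gt0.
(* At time t the square distance is at most 3 E times its initial value, and a
   distance below 1 exceeds its square. *)
exists (Num.min 1 (e ^+ 2 / (3 * E))).
  by rewrite lt_min ltr01 divr_gt0 ?exprn_gt0// mulr_gt0.
move=> u v t tT; rewrite lt_min => /andP[d1]; rewrite ltr_pdivlMr ?mulr_gt0// => d2.
rewrite -(ltr_pXn2r (_ : (0 < 2)%N)) ?nnegrE ?normr_ge0 ?(ltW e0)//.
apply: le_lt_trans (norm_le_sqdist _ _) _.
apply: le_lt_trans (flow_sqdist _ _ _) _.
apply: (@le_lt_trans _ _ (sqdist u v * E)).
  rewrite ler_wpM2l//; first by rewrite (le_trans _ (norm_le_sqdist _ _))// sqr_ge0.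
  by rewrite ler_expR ler_wpM2l// mulr_ge0// ltW.
apply: le_lt_trans d2.
have := sqdist_le_norm u v.
have := normr_ge0 (u - v); move: (`|u - v|) d1 => n n1 n0 H.
rewrite mulrA [n * 3]mulrC ler_wpM2r ?(ltW E0)//.
apply: (le_trans H); rewrite ler_wpM2l// expr2.
by rewrite -[leRHS]mulr1 ler_wpM2l// ltW.
Qed.

(** Only requires an integral curve between 0 and t, so that it also applies
    to solutions on a half-line. *)
Lemma flow_unique x t :
  {within `[Num.min 0 t, Num.max 0 t], continuous x} ->
  (forall s, Num.min 0 t < s < Num.max 0 t -> has_velocity x s (F (x s))) ->
  x t = flow (x 0) t.
Proof.
move=> cx dx.
have cf : {within `[Num.min 0 t, Num.max 0 t], continuous (flow (x 0))}.
  by apply: continuous_subspaceT; exact: flow_continuous.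
have := @integral_curves_sqdist x (flow (x 0)) t cx cf.
rewrite flow0 {2}/sqdist !subrr !expr0n/= !addr0 mul0r => H.
apply/eqP; rewrite -subr_eq0 -normr_eq0 -sqrf_eq0 eq_le sqr_ge0 andbT.
apply: (le_trans (norm_le_sqdist _ _)); apply: H => s st; split; first exact: dx.
exact: flow_velocity.
Qed.

Lemma flow_add u s t : flow (flow u s) t = flow u (s + t).
Proof.
have := @flow_unique (fun r => flow u (s + r)) t; rewrite addr0 => <- //.
  apply: continuous_subspaceT => r.
  apply: (@has_velocity_continuous _ (fun r => flow u (s + r)) r).
  by apply: has_velocity_shift; exact: flow_velocity.
by move=> r _; apply: has_velocity_shift; exact: flow_velocity.
Qed.

Lemma flowK u t : flow (flow u t) (- t) = u.
Proof. by rewrite flow_add subrr flow0. Qed.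

Section Domain.
Variables (D : set (state R)) (F0 : state R -> state R).
Hypothesis F0E : forall z, D z -> F0 z = F z.

(** Orbits of the flow that stay in D are the solutions of the equation that
    is only given on D: a competing solution has its values in D, where the
    two fields coincide, and is therefore an integral curve of F. *)
Lemma flow_the_solution (I : set R) u : I = setT \/ I = `[0, +oo[%classic ->
  (forall t, I t -> D (flow u t)) -> the_solution F0 D I u (flow u).
Proof.
move=> HI flowD; split.
- split => //; first by apply: continuous_subspaceT; exact: flow_continuous.
  move=> t It; rewrite F0E; last by apply: flowD; exact: interior_subset.
  exact: flow_velocity.
- exact: flow0.
- move=> y [cy yD dy] y0 t It; rewrite -y0; apply: flow_unique.
    apply: continuous_subspaceW cy => s; rewrite /= in_itv/=.
    case: HI It => -> //; rewrite /= !in_itv/= !andbT => t0 /andP[].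
    by rewrite (min_l t0).
  move=> s st; rewrite -F0E; last first.
    apply: yD; case: HI It => -> //; rewrite /= !in_itv/= !andbT => t0.
    by move: st; rewrite (min_l t0) => /andP[/ltW].
  apply: dy; case: HI It => -> //; first by rewrite interiorT.
  rewrite /= in_itv/= andbT => t0.
  rewrite interior_itv/= in_itv/= andbT.
  by move: st; rewrite (min_l t0) => /andP[].
Qed.

End Domain.

End Flow.

(** * Limit sets of stochastic approximations *)

Section LimitSet.
Context {R : realType}.
Variables (F : state R -> state R) (K : R).
Hypothesis K0 : 0 < K.
Hypothesis lipF : forall u v, `|F u - F v| <= K * `|u - v|.
Notation Phi := (flow K0 lipF).
Variables (D : set (state R)) (F0 : state R -> state R).
Hypothesis F0E : forall z, D z -> F0 z = F z.
Hypothesis compactD : compact D.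
Hypothesis flowD : forall u t, D u -> 0 <= t -> D (Phi u t).
Hypothesis F_le1 : forall u, D u -> `|F u| <= 1.

Lemma flow_near_start u t : D u -> 0 <= t -> `|Phi u t - u| <= t.
Proof.
move=> Du t0.
have := @velocity_lipschitz _ (Phi u) (fun s => F (Phi u s)) 1 0 t t0.
rewrite flow0 subr0 mul1r; apply; first exact: flow_velocity.
by move=> s /andP[s0 _]; apply/F_le1/flowD => //; exact: ltW.
Qed.

(** On [0, h] the curve stays within h of u because the field is bounded by
    1 on D, so its velocity varies by at most K h. *)
Lemma flow_euler_error u h : D u -> 0 <= h ->
  `|Phi u h - u - h *: F u| <= K * h ^+ 2.
Proof.
move=> Du h0.
have lin (c t : R) : is_derive t 1 (fun s : R => s * c) c.
  have := is_deriveZ c (is_derive_id t (1 : R)); rewrite /= [c *: _]mulr1.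
  by congr is_derive; apply/funext => s; rewrite /= mulrC.
have := @velocity_lipschitz _ (fun s => Phi u s - s *: F u) (fun s => F (Phi u s) - F
    u) (K * h) 0 h h0.
rewrite flow0 scale0r !subr0 expr2 mulrA addrAC; apply.
  move=> s; have [d1 d2 d3] := flow_velocity K0 lipF u s.
  by split; apply: is_deriveB.
move=> s /andP[s0 sh]; apply: (le_trans (lipF _ _)); rewrite ler_wpM2l ?(ltW K0)//.
by apply: (le_trans (flow_near_start Du (ltW s0))); exact: ltW.
Qed.

Variables (z : nat -> state R) (gamma : nat -> R).
Hypothesis zD : forall n, D (z n).
Hypothesis gamma_ge0 : forall n, 0 <= gamma n.

(** The time scale of the approximation: the n-th iterate is compared with
    the flow at time clock n. *)
Definition clock n : R := \sum_(0 <= j < n) gamma j.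
Definition perturbation n : state R := z n.+1 - z n - gamma n *: F (z n).

Hypothesis gamma_sq : forall e, 0 < e -> exists n0, forall n m, (n0 <= n)%N ->
  \sum_(n <= j < m) gamma j ^+ 2 <= e.
Hypothesis gamma_div : forall C, exists n, C <= clock n.
Hypothesis pert_cauchy : forall e, 0 < e -> exists n0, forall n m, (n0 <= n <= m)%N ->
  `|\sum_(n <= j < m) perturbation j| <= e.

Lemma clockS n : clock n.+1 = clock n + gamma n.
Proof. by rewrite /clock big_nat_recr. Qed.

Lemma clock_le m n : (m <= n)%N -> clock m <= clock n.
Proof.
move=> /subnK <-; elim: (n - m)%N => // i; rewrite addSn clockS => /le_trans; apply.
by rewrite lerDl.
Qed.

Lemma gamma_small e : 0 < e -> exists n0, forall n, (n0 <= n)%N -> gamma n <= e.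
Proof.
move=> e0; have [n0 H] := gamma_sq (exprn_gt0 2 e0).
exists n0 => n n0n; have := H n n.+1 n0n; rewrite big_nat1.
by rewrite ler_pXn2r ?nnegrE ?gamma_ge0 ?(ltW e0).
Qed.

(** The right-hand side of the assumption grows by a factor of at most 1 + K
    gamma_m <= e^(K gamma_m) at each step. *)
Lemma discrete_gronwall (a : nat -> R) A n : 0 <= A ->
  (forall m, (n <= m)%N -> a m <= A + K * \sum_(n <= j < m) gamma j * a j) ->
  forall m, (n <= m)%N -> a m <= A * expR (K * (clock m - clock n)).
Proof.
move=> A0 H m nm; apply: (le_trans (H m nm)).
rewrite -(subnK nm); elim: (m - n)%N => [|i IH].
  by rewrite add0n big_geq// mulr0 addr0 subrr mulr0 expR0 mulr1.
rewrite addSn big_nat_recr ?leq_addl//= clockS.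
set c := clock _ in IH *; set S := \sum_(_ <= _ < _) _ in IH *.
have ai := H (i + n)%N (leq_addl _ _); rewrite -/S in ai.
have K0' := ltW K0; have gi := gamma_ge0 (i + n).
apply: (@le_trans _ _ ((A + K * S) * (1 + K * gamma (i + n)%N))).
  have : K * gamma (i + n)%N * a (i + n)%N <= K * gamma (i + n)%N * (A + K * S).
    by rewrite ler_wpM2l// mulr_ge0.
  by lra.
rewrite (_ : K * (c + _ - _) = K * (c - clock n) + K * gamma (i + n)%N); last ring.
rewrite expRD mulrA.
have e1 := expR_ge1Dx (K * gamma (i + n)%N).
have p1 : 0 <= 1 + K * gamma (i + n)%N by rewrite addr_ge0 ?mulr_ge0.
apply: le_trans (ler_wpM2r p1 IH) _.
by rewrite ler_wpM2l// mulr_ge0// expR_ge0.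
Qed.

Lemma telescope_state (w : nat -> state R) n m : (n <= m)%N ->
  \sum_(n <= j < m) (w j.+1 - w j) = w m - w n.
Proof. exact: telescope_sumr. Qed.

(** The flow started at z_n, observed at the times of the clock, satisfies
    the same recursion as the iterates up to an error of order gamma_j^2 in
    step j. The difference of the two recursions is driven by the tails of
    the perturbation series and of the square series, and discrete Gronwall
    applies. *)
Lemma forward_pseudotrajectory T e : 0 < e -> exists n0, forall n m, (n0 <= n <= m)%N ->
  clock m - clock n <= T -> `|z m - Phi (z n) (clock m - clock n)| <= e.
Proof.
move=> e0; have K0' := ltW K0.
pose a := e / ((1 + K) * expR (K * T)).
have den0 : 0 < (1 + K) * expR (K * T) by rewrite mulr_gt0 ?expR_gt0// addr_gt0.
have a0 : 0 < a by rewrite divr_gt0.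
have [n1 H1] := gamma_sq a0; have [n2 H2] := pert_cauchy a0.
exists (maxn n1 n2) => n m; rewrite geq_max -andbA => /and3P[n1n n2n nm] mT.
pose y j := Phi (z n) (clock j - clock n).
have yD j : (n <= j)%N -> D (y j).
  by move=> nj; apply: flowD => //; rewrite subr_ge0 clock_le.
have yS j : y j.+1 = Phi (y j) (gamma j).
  by rewrite /y flow_add clockS addrAC.
have yn : y n = z n by rewrite /y subrr flow0.
have key m' : (n <= m')%N -> `|z m' - y m'| <= (1 + K) * a + K * \sum_(n <= j < m')
    gamma j * `|z j - y j|.
  move=> nm'.
  (* Both sequences telescope; F (z j) - F (y j) is the part fed back to
     Gronwall. *)
  have -> : z m' - y m' = \sum_(n <= j < m') gamma j *: (F (z j) - F (y j))
      + \sum_(n <= j < m') perturbation j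
      - \sum_(n <= j < m') (y j.+1 - y j - gamma j *: F (y j)).
    rewrite -big_split/= -sumrB.
    rewrite (eq_bigr (fun j => (z j.+1 - y j.+1) - (z j - y j))).
      by rewrite (@telescope_state (fun j => z j - y j))// yn subrr subr0.
    move=> j _; rewrite /perturbation scalerBr.
    move: (z j.+1) (y j.+1) (z j) (y j) (gamma j *: F _) (gamma j *: F _) => *.
    by apply: state_eqP; split => /=; ring.
  apply: (le_trans (ler_normB _ _)); apply: (le_trans (lerD (ler_normD _ _) (lexx _))).
  have b1 : `|\sum_(n <= j < m') gamma j *: (F (z j) - F (y j))| <= K * \sum_(n <= j <
      m') gamma j * `|z j - y j|.
    apply: (le_trans (ler_norm_sum _ _ _)); rewrite mulr_sumr ler_sum// => j _.
    by rewrite normrZ ger0_norm// mulrCA ler_wpM2l.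
  have b2 : `|\sum_(n <= j < m') perturbation j| <= a by apply: H2; rewrite n2n.
  have b3 : `|\sum_(n <= j < m') (y j.+1 - y j - gamma j *: F (y j))| <= K * a.
    apply: (le_trans (ler_norm_sum _ _ _)).
    apply: (@le_trans _ _ (K * \sum_(n <= j < m') gamma j ^+ 2)); last first.
      by rewrite ler_wpM2l// H1.
    rewrite mulr_sumr big_nat_cond [leRHS]big_nat_cond ler_sum// => j /andP[/andP[nj _]
        _].
    by rewrite yS; apply: flow_euler_error; [exact: yD|exact: gamma_ge0].
  lra.
have A0 : 0 <= (1 + K) * a by rewrite mulr_ge0 ?(ltW a0)// addr_ge0.
apply: (le_trans (discrete_gronwall A0 key nm)).
apply: (@le_trans _ _ ((1 + K) * a * expR (K * T))).
  by rewrite ler_wpM2l// ler_expR ler_wpM2l.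
rewrite /a le_eqVlt; apply/orP; left; apply/eqP; field.
by rewrite !gt_eqF ?expR_gt0// addr_gt0.
Qed.

(** When m < n, flow backwards for the time elapsed between the two: the
    forward estimate from z_m to z_n is transported by equicontinuity. *)
Lemma asymptotic_pseudotrajectory T e : 0 < e -> exists n0, forall n m,
  (n0 <= n)%N -> (n0 <= m)%N ->
  `|clock m - clock n| <= T -> `|z m - Phi (z n) (clock m - clock n)| < e.
Proof.
move=> e0; have [d d0 Hd] := flow_equicontinuous K0 lipF T e0.
have d2 : 0 < Num.min (e / 2) (d / 2) by rewrite lt_min !divr_gt0.
have [n0 H] := forward_pseudotrajectory T d2.
exists n0 => n m n0n n0m mT.
have [nm|mn] := leqP n m.
  apply: (@le_lt_trans _ _ (Num.min (e / 2) (d / 2))).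
    by apply: H; [rewrite n0n|rewrite (le_trans (ler_norm _))].
  by rewrite gt_min; apply/orP; left; lra.
rewrite -(flowK K0 lipF (z m) (clock n - clock m)) opprB; apply: Hd => //.
rewrite distrC; apply: (@le_lt_trans _ _ (Num.min (e / 2) (d / 2))).
  by apply: H; [rewrite n0m ltnW|rewrite (le_trans (ler_norm _))// distrC].
by rewrite gt_min; apply/orP; right; lra.
Qed.

(** The clock is unbounded with small steps, so it visits every short
    interval late enough. *)
Lemma clock_hits n0 x d : (forall n, (n0 <= n)%N -> gamma n <= d) -> 0 <= d ->
  clock n0 <= x -> exists2 m, (n0 <= m)%N & x <= clock m <= x + d.
Proof.
move=> Hg d0 n0x.
have ex : exists m, (n0 <= m)%N && (x <= clock m).
  have [n xn] := gamma_div x; exists (maxn n0 n); rewrite leq_maxl.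
  by rewrite (le_trans xn)// clock_le// leq_maxr.
case: (ex_minnP ex) => m /andP[n0m xm] min.
exists m => //; rewrite xm/=.
case: m n0m xm min => [|m] n0m xm min.
  move: n0m n0x; rewrite leqn0 => /eqP ->; lra.
move: n0m; rewrite leq_eqVlt => /orP[/eqP <-|]; first by lra.
rewrite ltnS => n0m; rewrite clockS.
have : clock m < x.
  by rewrite ltNge; apply/negP => xm'; have := min m; rewrite n0m xm' ltnn => /(_ isT).
by have := Hg _ n0m; lra.
Qed.

Definition omega_limit : set (state R) :=
  [set w | forall e n, 0 < e -> exists2 m, (n <= m)%N & `|z m - w| < e].

Lemma omega_limit_closed : closed omega_limit.
Proof.
move=> w wL e n e0.
have [|w' [w'L w'w]] := wL (ball w (e / 2)); first by apply: nbhsx_ballx; rewrite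
    divr_gt0.
have e2 : 0 < e / 2 by rewrite divr_gt0.
have [m nm mw'] := w'L (e / 2) n e2.
exists m => //; rewrite (le_lt_trans (ler_distD w' _ _))//.
by move: w'w; rewrite -ball_normE /= [`|w - _|]distrC; move: mw'; lra.
Qed.

Lemma omega_limit_sub : omega_limit `<=` D.
Proof.
have cD : closed D by apply: compact_closed.
move=> w wL; apply: cD => B /nbhs_ballP[e e0 eB].
have [m _ mw] := wL e 0%N e0; exists (z m); split => //.
by apply: eB; rewrite -ball_normE /= distrC.
Qed.

Lemma omega_limit_compact : compact omega_limit.
Proof. exact: subclosed_compact omega_limit_closed compactD omega_limit_sub. Qed.

(** Otherwise infinitely many iterates stay away from the limit set, and by
    compactness of D they have an accumulation point. *)
Lemma omega_limit_attracts e : 0 < e -> exists n0, forall n, (n0 <= n)%N ->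
  exists2 w, omega_limit w & `|z n - w| < e.
Proof.
move=> e0; apply: contrapT => /forallNP H.
have far n0 : exists n, (n0 <= n)%N /\ forall w, omega_limit w -> e <= `|z n - w|.
  have /existsNP[n /not_implyP[n0n Hn]] := H n0; exists n; split => // w wL.
  by rewrite leNgt; apply/negP => wn; apply: Hn; exists w.
pose f n := projT1 (cid (far n)).
have fP n : (n <= f n)%N /\ forall w, omega_limit w -> e <= `|z (f n) - w|.
  by rewrite /f; case: cid.
have [|w [_ wcl]] := compactD (F := (z \o f) @ \oo) _.
  by exists 0%N => // n _ /=; exact: zD.
have hit e' n : 0 < e' -> exists2 m, (n <= m)%N & `|z (f m) - w| < e'.
  move=> e'0.
  have [||v [[m nm <-] vw]] := wcl [set z (f m) | m in [set m | (n <= m)%N]] (ball w e').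
  - by exists n => // m nm /=; exists m.
  - exact: nbhsx_ballx.
  by exists m => //; move: vw; rewrite -ball_normE /= distrC.
have wL : omega_limit w.
  move=> e' n e'0; have [m nm mw] := hit e' n e'0; exists (f m) => //.
  by apply: leq_trans (fP m).1.
have [m _ mw] := hit e 0%N e0.
by have := (fP m).2 w wL; rewrite leNgt mw.
Qed.

(** If z_j is close to u, the iterate whose clock is nearest to clock j + t
    is close to the point reached from u at time t. The estimate holds for
    both signs of t, which gives invariance and not only forward invariance. *)
Lemma omega_limit_flow u t : omega_limit u -> omega_limit (Phi u t).
Proof.
move=> uL e n e0.
have e3 : 0 < e / 3 by rewrite divr_gt0.
have [d d0 Hd] : exists2 d, 0 < d & forall s, `|t - s| < d -> `|Phi u t - Phi u s| < e
    / 3.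
  have /cvgrPdist_lt/(_ _ e3) := @flow_continuous _ _ _ K0 lipF u t.
  by move=> [d d0 Hd]; exists d.
pose T := `|t| + d.
have [d' d'0 Hd'] := flow_equicontinuous K0 lipF T e3.
have [n1 H1] := asymptotic_pseudotrajectory T e3.
have d2 : 0 < d / 2 by rewrite divr_gt0.
have [n2 H2] := gamma_small d2.
pose n3 := maxn n (maxn n1 n2).
have [n4 H4] := gamma_div (clock n3 + `|t|).
(* n4 is chosen so late that, for negative t, clock j + t still exceeds the
   clock of n3. *)
have [j n4j ju] := uL d' (maxn n3 n4) d'0.
have jt : clock n3 <= clock j + t.
  have : clock n4 <= clock j by apply: clock_le; apply: leq_trans n4j; exact: leq_maxr.
  have := ler_norm (- t); rewrite normrN; lra.
have [m n3m /andP[mt1 mt2]] := @clock_hits n3 _ (d / 2) (fun n h =>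
  H2 n (leq_trans (leq_trans (leq_maxr _ _) (leq_maxr _ _)) h)) (ltW d2) jt.
exists m; first by apply: leq_trans n3m; exact: leq_maxl.
pose s := clock m - clock j.
have st : `|t - s| < d by rewrite /s ltr_norml; lra.
have sT : `|s| <= T.
  rewrite /T -{1}(subrK t s) addrC (le_trans (ler_normD _ _))// lerD2l distrC; exact: ltW.
have n1m : (n1 <= m)%N by apply: leq_trans n3m; rewrite !leq_max leqnn orbT.
have n1j : (n1 <= j)%N by apply: leq_trans n4j; rewrite !leq_max leqnn !orbT.
have h1 := H1 j m n1j n1m sT; rewrite -/s in h1.
have h2 := Hd' (z j) u s sT ju.
have h3 := Hd s st; rewrite distrC in h3.
have := ler_distD (Phi (z j) s) (z m) (Phi u t).
have := ler_distD (Phi u s) (Phi (z j) s) (Phi u t).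
lra.
Qed.

Lemma omega_limit_solution u : omega_limit u -> the_solution F0 D setT u (Phi u).
Proof.
move=> uL; apply: flow_the_solution => //; first by left.
by move=> t _; apply: omega_limit_sub; exact: omega_limit_flow.
Qed.

Lemma omega_limit_invariant : invariant_set F0 D omega_limit.
Proof.
split; first exact: omega_limit_sub.
move=> u uL; exists (Phi u); split; first exact: omega_limit_solution.
by move=> t; exact: omega_limit_flow.
Qed.

Definition chained (e T : R) u v : Prop :=
  exists (m : nat) (us : nat -> state R) (ts : nat -> R),
      [/\ (1 <= m)%N, us 0%N = u, us m = v,
          forall i, (i <= m)%N -> omega_limit (us i)
        & forall i, (1 <= i <= m)%N -> T <= ts i /\
            `|Phi (us i.-1) (ts i) - us i| < e].

Lemma chained_step e T u v t : omega_limit u -> omega_limit v -> T <= t ->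
  `|Phi u t - v| < e -> chained e T u v.
Proof.
move=> uL vL tT uv; exists 1%N, (fun i => if i is 0%N then u else v), (fun=> t).
split => //; first by case => [|[]].
by case => [|[|]].
Qed.

Lemma chained_cons e T u w v t : omega_limit u -> T <= t ->
  `|Phi u t - w| < e -> chained e T w v -> chained e T u v.
Proof.
move=> uL tT uw [m [us [ts [m1 us0 usm usL H]]]].
exists m.+1, (fun i => if i is i'.+1 then us i' else u),
  (fun i => if i is i'.+2 then ts i'.+1 else t).
split => //; first by case => [//|i]; exact: usL.
case => [//|[|i]] /=; first by rewrite us0.
by move=> im; exact: H.
Qed.

(** The iterates between a visit near u and a later visit near v are split
    into stretches of duration between T and 2 T + 1. Each stretch shadows
    the flow, and its endpoints are moved to nearby points of the limit set. *)
Lemma omega_limit_chained e T : 0 < e -> 0 < T ->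
  forall u v, omega_limit u -> omega_limit v -> chained e T u v.
Proof.
move=> e0 T0 u v uL vL.
have e3 : 0 < e / 3 by rewrite divr_gt0.
have [d d0 Hd] := flow_equicontinuous K0 lipF (2 * T + 1) e3.
pose d' := Num.min d (e / 3).
have d'0 : 0 < d' by rewrite lt_min d0.
have [n1 H1] := asymptotic_pseudotrajectory (2 * T + 1) e3.
have [n2 H2] := gamma_small (ltr01 : 0 < 1 :> R).
have [n3 H3] := omega_limit_attracts d'0.
pose n0 := maxn n1 (maxn n2 n3).
have n10 : (n1 <= n0)%N by exact: leq_maxl.
have n20 : (n2 <= n0)%N by rewrite /n0 !leq_max leqnn orbT.
have n30 : (n3 <= n0)%N by rewrite /n0 !leq_max leqnn !orbT.
have step n m x y : (n0 <= n)%N -> (n0 <= m)%N -> T <= clock m - clock n <= 2 * T + 1 ->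
    `|z n - x| < d' -> `|z m - y| < d' ->
    `|Phi x (clock m - clock n) - y| < e.
  move=> n0n n0m /andP[h1 h2] nx my.
  have sT : `|clock m - clock n| <= 2 * T + 1 by rewrite ger0_norm//; lra.
  have a1 := H1 n m (leq_trans n10 n0n) (leq_trans n10 n0m) sT.
  have a2 : `|Phi (z n) (clock m - clock n) - Phi x (clock m - clock n)| < e / 3.
    by apply: Hd => //; move: nx; rewrite lt_min => /andP[].
  have a3 : `|z m - y| < e / 3 by move: my; rewrite lt_min => /andP[].
  rewrite distrC in a1; rewrite distrC in a2.
  have := ler_distD (Phi (z n) (clock m - clock n)) (Phi x (clock m - clock n)) y.
  have := ler_distD (z m) (Phi (z n) (clock m - clock n)) y.
  lra.
have main k : forall n m x y, (m - n <= k)%N -> (n0 <= n)%N -> (n0 <= m)%N ->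
    omega_limit x -> omega_limit y ->
    T <= clock m - clock n -> `|z n - x| < d' -> `|z m - y| < d' -> chained e T x y.
  elim: k => [|k IH] n m x y mnk n0n n0m xL yL Tmn nx my.
    have : clock m <= clock n by apply: clock_le; rewrite -subn_eq0 -leqn0.
    by move=> ?; lra.
  have [short|long] := leP (clock m - clock n) (2 * T + 1).
    apply: (@chained_step _ _ _ _ (clock m - clock n)) => //.
    by apply: step => //; rewrite Tmn.
  have [p np /andP[p1 p2]] := @clock_hits n (clock n + T) 1
    (fun j h => H2 j (leq_trans n20 (leq_trans n0n h))) ler01 ltac:(by rewrite lerDl ltW).
  have n0p : (n0 <= p)%N := leq_trans n0n np.
  have [w wL pw] := H3 p (leq_trans n30 n0p).
  apply: (@chained_cons _ _ _ w _ (clock p - clock n)) => //; first by lra.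
    by apply: step => //; lra.
  apply: (IH p m) => //; last by lra.
  have : (n < p)%N.
    by rewrite ltn_neqAle np andbT; apply/eqP => npE; move: p1; rewrite npE; lra.
  by move: mnk; clear; lia.
have [n n0n nu] := uL d' n0 d'0.
have [m0 Hm0] := gamma_div (clock n + T).
have [m n0m mv] := vL d' (maxn n0 m0) d'0.
apply: (main (m - n)%N n m) => //.
  by apply: leq_trans n0m; exact: leq_maxl.
have : clock m0 <= clock m by apply: clock_le; apply: leq_trans n0m; exact: leq_maxr.
lra.
Qed.

Lemma omega_limit_ict : internally_chain_transitive F0 D omega_limit.
Proof.
split; [exact: omega_limit_invariant|exact: omega_limit_compact|].
move=> u v e T uL vL e0 T0.
have [m [us [ts [m1 us0 usm usL H]]]] := omega_limit_chained e0 T0 uL vL.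
exists m, us, ts; split => // i im; have [Tt dist] := H i im; split => //.
exists (Phi (us i.-1)); split => //; apply: omega_limit_solution.
by apply: usL; case/andP: im => _ im; apply: leq_trans im; exact: leq_pred.
Qed.

(** If the limit set split into two disjoint compact parts, these would be
    at positive distance e. A chain with jumps shorter than e cannot pass
    from one to the other: its orbit pieces are connected, hence stay in one
    part. *)
Lemma omega_limit_connected : connected omega_limit.
Proof.
move=> B [u uB] [V oV BV] [C cC BC].
have BL : B `<=` omega_limit by rewrite BV => w [].
rewrite eqEsubset; split => // v vL; apply: contrapT => vB.
have cB : compact B.
  rewrite BC setIC; apply: subclosed_compact omega_limit_compact _ => //.
  exact: closedI omega_limit_closed.
have [e e0 He] : exists2 e, 0 < e & forall x y, B x -> omega_limit y -> `|x - y| < e ->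
    B y.
  apply: contrapT => /forall2NP H.
  have bad n : exists xy : state R * state R, [/\ B xy.1, omega_limit xy.2, ~ B xy.2
      & `|xy.1 - xy.2| < n.+1%:R^-1].
    have [|] := H n.+1%:R^-1; first by rewrite invr_gt0 ltr0n.
    move=> /existsNP[x /existsNP[y /not_implyP[xB /not_implyP[yL /not_implyP[xy yB]]]]].
    by exists (x, y).
  pose f n := projT1 (cid (bad n)).
  have fP n : [/\ B (f n).1, omega_limit (f n).2, ~ B (f n).2
      & `|(f n).1 - (f n).2| < n.+1%:R^-1] by rewrite /f; case: cid.
  have [|x [xB xcl]] := cB ((fun n => (f n).1) @ \oo) _ _.
    by exists 0%N => // n _ /=; case: (fP n).
  have : V x by move: xB; rewrite BV => -[].
  move=> Vx; have /nbhs_ballP[r r0 rV] : nbhs x V by apply: open_nbhs_nbhs.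
  have r2 : 0 < r / 2 by rewrite divr_gt0.
  pose k := Num.bound (r / 2)^-1.
  have [||w [[n kn <-] xw]] := xcl [set (f m).1 | m in [set m | (k <= m)%N]] (ball x (r
      / 2)).
  - by exists k => // m km /=; exists m.
  - exact: nbhsx_ballx.
  have [fB fL fnB fd] := fP n; apply: fnB; rewrite BV; split => //; apply: rV.
  move: xw; rewrite -!ball_normE /= => xw.
  (* The index n is large enough for the two points to lie in the ball around
     x inside V. *)
  have kr : n.+1%:R^-1 < r / 2.
    rewrite invf_plt ?posrE ?ltr0n//.
    apply: lt_le_trans (archi_boundP _) _; first by rewrite invr_ge0 ltW.
    by rewrite ler_nat ltnW.
  rewrite (le_lt_trans (ler_distD (f n).1 _ _))// [ltRHS]splitr.
  by rewrite ltrD// (lt_trans fd).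
have flowB w t : B w -> B (Phi w t).
  move=> wB; have wL := BL _ wB.
  have cR : connected [set: R] by apply/connected_intervalP.
  have cPhi : continuous (Phi w) by exact: flow_continuous.
  have S : Phi w @^-1` B = [set: R].
    apply: cR.
    - by exists 0; rewrite /= flow0.
    - exists (Phi w @^-1` V); first by move/continuousP: cPhi; exact.
      rewrite setTI BV preimage_setI; apply/seteqP; split => s /=; first by case.
      by move=> ?; split => //; exact: omega_limit_flow.
    - exists (Phi w @^-1` C); first by move/continuous_closedP: cPhi; exact.
      rewrite setTI BC preimage_setI; apply/seteqP; split => s /=; first by case.
      by move=> ?; split => //; exact: omega_limit_flow.
  have : [set: R] t by [].
  by rewrite -S.
have [m [us [ts [m1 us0 usm usL H]]]] := omega_limit_chained e0 (ltr01 : 0 < 1 :> R)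
    (BL _ uB) vL.
have usB i : (i <= m)%N -> B (us i).
  elim: i => [|i IH] im; first by rewrite us0.
  have [_ dist] := H i.+1 im.
  apply: He dist; [exact/flowB/IH/ltnW|exact: usL].
by apply: vB; rewrite -usm; exact: usB.
Qed.

Lemma omega_limit_converges : converges_to_set z omega_limit.
Proof.
split.
  by have [n /(_ _ (leqnn n))[w wL _]] := omega_limit_attracts ltr01; exists w.
apply/cvgrPdist_lt => e e0; have [n0 H] := omega_limit_attracts e0.
exists n0 => // n /= n0n; have [w wL wn] := H n n0n; rewrite sub0r normrN.
set S := [set r | _].
have S0 : lbound S 0 by move=> _ [v _ ->].
have Sw : S `|z n - w| by exists w.
rewrite ger0_norm; last by apply: lb_le_inf => //; exists `|z n - w|.
by apply: le_lt_trans wn; apply: ge_inf => //; exists 0.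
Qed.

Theorem stochastic_approximation : exists L : set (state R),
  [/\ compact L, connected L, L `<=` D, internally_chain_transitive F0 D L
    & converges_to_set z L].
Proof.
exists omega_limit; split; [exact: omega_limit_compact|exact: omega_limit_connected|
 exact: omega_limit_sub|exact: omega_limit_ict|exact: omega_limit_converges].
Qed.

End LimitSet.

(** * Means of bounded random variables *)

Section BoundedRandomVariables.
Context {d : measure_display} {T : measurableType d} {R : realType}.
Implicit Types (f g : T -> R).

Definition bounded_rv f : Prop :=
  measurable_fun setT f /\ exists M, forall w, `|f w| <= M.


Lemma bounded_rv_cst c : bounded_rv (fun=> c).
Proof. by split; [exact: measurable_cst|exists `|c|]. Qed.

Lemma bounded_rvD f g : bounded_rv f -> bounded_rv g -> bounded_rv (fun w => f w + g w).
Proof.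
move=> [mf [M fM]] [mg [M' gM]]; split; first exact: measurable_funD.
by exists (M + M') => w; rewrite (le_trans (ler_normD _ _))// lerD.
Qed.

Lemma bounded_rvM f g : bounded_rv f -> bounded_rv g -> bounded_rv (fun w => f w * g w).
Proof.
move=> [mf [M fM]] [mg [M' gM]]; split; first exact: measurable_funM.
by exists (M * M') => w; rewrite normrM ler_pM.
Qed.

Lemma bounded_rvB f g : bounded_rv f -> bounded_rv g -> bounded_rv (fun w => f w - g w).
Proof.
move=> bf bg; under eq_fun do rewrite -mulN1r.
by apply: bounded_rvD => //; apply: bounded_rvM => //; exact: bounded_rv_cst.
Qed.

Lemma bounded_rv_indic A : measurable A -> bounded_rv (\1_A : T -> R).
Proof.
move=> mA; split; first exact: measurable_indic.
by exists 1 => w; rewrite indicE ger0_norm ?ler0n// lern1; case: (_ \in _).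
Qed.

Lemma bounded_rv_sum (I : Type) (r : seq I) (p : pred I) (f : I -> T -> R) :
  (forall i, bounded_rv (f i)) -> bounded_rv (fun w => \sum_(i <- r | p i) f i w).
Proof.
move=> bf; elim: r => [|i r IH].
  by under eq_fun do rewrite big_nil; exact: bounded_rv_cst.
under eq_fun do rewrite big_cons.
by case: (p i) => //; exact: bounded_rvD.
Qed.

Variable P : probability T R.

(** Bounded random variables suffice here, and on them the mean is linear
    and monotone without integrability conditions. *)
Definition mean f : R := (\int[P]_w f w)%R.

Lemma bounded_rv_integrable f : bounded_rv f -> P.-integrable setT (EFin \o f).
Proof.
move=> [mf [M fM]]; apply: measurable_bounded_integrable => //.
  by rewrite [ltLHS](@probability_setT _ _ _ P) ltry.
exists M; split; first exact: num_real.
by move=> x Mx w _; apply: (le_trans (fM w)); exact: ltW.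
Qed.

Lemma meanD f g : bounded_rv f -> bounded_rv g ->
  mean (fun w => f w + g w) = mean f + mean g.
Proof. by move=> bf bg; rewrite /mean RintegralD//; exact: bounded_rv_integrable. Qed.

Lemma meanB f g : bounded_rv f -> bounded_rv g ->
  mean (fun w => f w - g w) = mean f - mean g.
Proof. by move=> bf bg; rewrite /mean RintegralB//; exact: bounded_rv_integrable. Qed.

Lemma meanZ c f : bounded_rv f -> mean (fun w => c * f w) = c * mean f.
Proof. by move=> bf; rewrite /mean RintegralZl//; exact: bounded_rv_integrable. Qed.

Lemma mean_le f g : bounded_rv f -> bounded_rv g -> (forall w, f w <= g w) ->
  mean f <= mean g.
Proof. by move=> bf bg fg; apply: le_Rintegral => //; exact: bounded_rv_integrable. Qed.

Lemma mean_cst c : mean (fun=> c) = c.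
Proof. by rewrite /mean Rintegral_cst// [X in fine X](@probability_setT _ _ _ P) mulr1.
    Qed.

Lemma mean_sum (I : Type) (r : seq I) (f : I -> T -> R) :
  (forall i, bounded_rv (f i)) ->
  mean (fun w => \sum_(i <- r) f i w) = \sum_(i <- r) mean (f i).
Proof.
move=> bf; elim: r => [|i r IH].
  by rewrite big_nil; under eq_fun do rewrite big_nil; exact: mean_cst.
rewrite big_cons -IH -meanD//; last exact: bounded_rv_sum.
by congr mean; apply/funext => w; rewrite big_cons.
Qed.

Lemma mean_indic A : measurable A -> (mean \1_A)%:E = P A.
Proof.
move=> mA; rewrite /mean /Rintegral integral_indic// setIT fineK//.
exact: fin_num_measure.
Qed.

Lemma chebyshev_bound f e : bounded_rv f -> 0 < e ->
  (P [set w | (e < `|f w|)%R] <= (mean (fun w => f w ^+ 2) / e ^+ 2)%:E)%E.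
Proof.
move=> bf e0; have [mf _] := bf.
have mA : measurable [set w | e < `|f w|].
  rewrite -[X in measurable X]setTI (_ : [set w | _] = (fun w => `|f w|) @^-1` `]e, +oo[).
    apply: (measurableT_comp (@normr_measurable R setT) mf measurableT).
    exact: measurable_itv.
  by apply/seteqP; split => w /=; rewrite in_itv/= andbT.
rewrite -mean_indic// lee_fin ler_pdivlMr ?exprn_gt0// mulrC -meanZ; last exact:
    bounded_rv_indic.
apply: mean_le.
- by apply: bounded_rvM; [exact: bounded_rv_cst|exact: bounded_rv_indic].
- by under eq_fun do rewrite expr2; exact: bounded_rvM.
move=> w; rewrite indicE; case: (boolP (_ \in _)) => [/set_mem/= ew|_].
  by rewrite mulr1 -(real_normK (num_real (f w))) lerXn2r ?nnegrE// ltW.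
by rewrite mulr0 sqr_ge0.
Qed.

End BoundedRandomVariables.

(** * Convergence of martingale series with finite histories *)

Section Martingale.
Context {d : measure_display} {T : measurableType d} {R : realType}.
Variable P : probability T R.
Variables (V : nat -> finType) (H : forall n, T -> V n).
Hypothesis measurable_atom : forall n h, measurable [set w | H n w = h].
Hypothesis H_refines : forall n w w', H n.+1 w = H n.+1 w' -> H n w = H n w'.

(** Measurability with respect to the history at time n, expressed by the
    dependence on its value; this is the same notion because histories take
    finitely many values. *)
Definition history_determined (Q : Type) n (Y : T -> Q) : Prop :=
  forall w w', H n w = H n w' -> Y w = Y w'.

(** A finite combination of indicators of atoms. *)
Lemma history_determinedE n (Y : T -> R) : history_determined n Y ->
  exists y : V n -> R, Y = (fun w => \sum_(h : V n) y h * \1_[set w | H n w = h] w).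
Proof.
move=> YH.
pose y h := match pselect (exists w, H n w = h) with
  | left ex => Y (projT1 (cid ex)) | right _ => 0 end.
exists y; apply/funext => w.
rewrite (bigD1 (H n w))//= big1 ?addr0; last first.
  move=> h hw; rewrite indicE memNset ?mulr0//= => e.
  by rewrite e eqxx in hw.
rewrite indicE mem_set// mulr1 /y; case: pselect => [ex|]; last by case; exists w.
by case: cid => w' /= /esym; exact: YH.
Qed.

Lemma history_determined_bounded n (Y : T -> R) : history_determined n Y -> bounded_rv Y.
Proof.
move=> /history_determinedE[y ->]; apply: bounded_rv_sum => h.
by apply: bounded_rvM; [exact: bounded_rv_cst|exact: bounded_rv_indic].
Qed.

Variable D : nat -> T -> R.
Variable c : nat -> R.
Hypothesis D_determined : forall n, history_determined n.+1 (D n).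
Hypothesis D_le : forall n w, `|D n w| <= c n.
Hypothesis D_centered : forall n h,
  mean P (fun w => D n w * \1_[set w | H n w = h] w) = 0.

Lemma increment_bounded n : bounded_rv (D n).
Proof. exact: history_determined_bounded (@D_determined n). Qed.

(** Being centered on each atom of the history at time n is the martingale
    difference property. *)
Lemma increment_orthogonal n (Y : T -> R) : history_determined n Y ->
  mean P (fun w => D n w * Y w) = 0.
Proof.
move=> /history_determinedE[y ->].
have bi h : bounded_rv (fun w => y h * (D n w * \1_[set w | H n w = h] w)).
  apply: bounded_rvM; first exact: bounded_rv_cst.
  by apply: bounded_rvM; [exact: increment_bounded|exact: bounded_rv_indic].
rewrite (_ : (fun w => _) = (fun w => \sum_(h : V n) y h * (D n w * \1_[set w | H n w =
    h] w))).
  rewrite mean_sum// big1// => h _; rewrite meanZ ?D_centered ?mulr0//.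
  by apply: bounded_rvM; [exact: increment_bounded|exact: bounded_rv_indic].
by apply/funext => w; rewrite mulr_sumr; apply: eq_bigr => h _; rewrite mulrCA.
Qed.

(** The martingale stopped at its first exceedance of e. Stopping turns the
    maximal inequality into a bound on a single second moment. *)
Fixpoint stopped_sum (e : R) n i (w : T) : R :=
  if i is i'.+1 then
    stopped_sum e n i' w +
      (if `|stopped_sum e n i' w| <= e then D (n + i')%N w else 0)
  else 0.

Lemma stopped_sum_determined e n i : history_determined (n + i) (stopped_sum e n i).
Proof.
elim: i => [//|i IH] w w' ww' /=.
have ww0 : H (n + i)%N w = H (n + i)%N w' by apply: H_refines; rewrite -addnS.
by rewrite (IH _ _ ww0) (@D_determined (n + i)%N w w')// -addnS.
Qed.

(** The new increment is orthogonal to the stopped sum and to the event that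
    it still runs, so that second moments add up. *)
Lemma stopped_sum_sqr_mean e n i :
  mean P (fun w => stopped_sum e n i w ^+ 2) <= \sum_(n <= j < n + i) c j ^+ 2.
Proof.
elim: i => [|i IH].
  rewrite addn0 big_geq//= (_ : (fun=> _) = fun=> 0) ?mean_cst//.
  by apply/funext => w; rewrite expr0n.
rewrite addnS big_nat_recr ?leq_addr//=.
set S := stopped_sum e n i in IH *.
have bS : bounded_rv S := history_determined_bounded (@stopped_sum_determined e n i).
pose I w : R := if `|S w| <= e then 1 else 0.
have SI : history_determined (n + i) (fun w => S w * I w).
  by move=> w w' ww'; rewrite /I /S (@stopped_sum_determined e n i w w').
have bI : bounded_rv I.
  apply: (@history_determined_bounded (n + i)) => w w' ww'.
  by rewrite /I /S (@stopped_sum_determined e n i w w').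
have bD := increment_bounded (n + i).
apply: (@le_trans _ _ (mean P (fun w => (S w ^+ 2 + c (n + i)%N ^+ 2) +
   2 * (D (n + i)%N w * (S w * I w))))).
  apply: mean_le.
  - under eq_fun do rewrite expr2; apply: bounded_rvM;
    exact: (history_determined_bounded (@stopped_sum_determined e n i.+1)).
  - apply: bounded_rvD; [apply: bounded_rvD|apply: bounded_rvM].
    + by under eq_fun do rewrite expr2; exact: bounded_rvM.
    + exact: bounded_rv_cst.
    + exact: bounded_rv_cst.
    + by apply: bounded_rvM => //; exact: bounded_rvM.
  move=> w; rewrite /I -/S; have := D_le (n + i) w; move: (D _ w) (S w) => x s xc.
  have xc2 : x ^+ 2 <= c (n + i)%N ^+ 2.
    by rewrite -(real_normK (num_real x)) lerXn2r ?nnegrE// (le_trans _ xc).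
  case: ifP => _; first by rewrite sqrrD mulr1 -mulr_natl; lra.
  by rewrite addr0 !mulr0 addr0 lerDl sqr_ge0.
rewrite meanD; last 2 first.
- apply: bounded_rvD; last exact: bounded_rv_cst.
  by under eq_fun do rewrite expr2; exact: bounded_rvM.
- apply: bounded_rvM; first exact: bounded_rv_cst.
  by apply: bounded_rvM => //; exact: bounded_rvM.
rewrite meanZ; last by apply: bounded_rvM => //; exact: bounded_rvM.
rewrite increment_orthogonal// mulr0 addr0 meanD; last 2 first.
- by under eq_fun do rewrite expr2; exact: bounded_rvM.
- exact: bounded_rv_cst.
by rewrite mean_cst lerD2r.
Qed.

(** The stopped sum keeps the record of any exceedance by an earlier partial
    sum. *)
Lemma stopped_sum_detects e n i m w : (i <= m)%N ->
  e < `|\sum_(n <= j < n + i) D j w| -> e < `|stopped_sum e n m w|.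
Proof.
move=> im ei.
have : (forall i, (i < m)%N -> `|\sum_(n <= j < n + i) D j w| <= e) /\
    stopped_sum e n m w = \sum_(n <= j < n + m) D j w
  \/ e < `|stopped_sum e n m w|.
  elim: {i im ei} m => [|m [[le eq]|gt]] /=.
  - by left; split => //; rewrite addn0 big_geq.
  - have [le'|gt'] := leP `|stopped_sum e n m w| e; last by right; rewrite addr0.
    left; split; last by rewrite addnS big_nat_recr ?leq_addr//= eq.
    move=> i; rewrite ltnS leq_eqVlt => /orP[/eqP ->|]; last exact: le.
    by rewrite -eq.
  - by right; rewrite (leNgt _ e) gt /= addr0.
move=> [[le eq]|//]; move: im; rewrite leq_eqVlt => /orP[/eqP im|/le].
  by rewrite eq -im.
by rewrite leNgt ei.
Qed.

Hypothesis c_sq : forall e, 0 < e -> exists n, forall m, \sum_(n <= j < m) c j ^+ 2 <= e.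

(** Chebyshev's inequality for the stopped sum bounds the probability that
    some partial sum started at n exceeds e by the tail of the square series
    over e^2. It tends to 0 with n, so almost surely, for each e = 1/(k+1),
    some tail never exceeds e. *)
Lemma martingale_series_cauchy : {ae P, forall w, forall e, 0 < e ->
  exists n0, forall n m, (n0 <= n <= m)%N -> `|\sum_(n <= j < m) D j w| <= e}.
Proof.
pose A e n m := [set w | e < `|stopped_sum e n m w|].
have mA e n m : measurable (A e n m).
  rewrite -[X in measurable X]setTI (_ : A e n m = (fun w => `|stopped_sum e n m w|)
      @^-1` `]e, +oo[).
    have [mS _] := history_determined_bounded (@stopped_sum_determined e n m).
    apply: (measurableT_comp (@normr_measurable R setT) mS measurableT).
    exact: measurable_itv.
  by apply/seteqP; split => w /=; rewrite in_itv/= andbT.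
have Amono e n m m' : (m <= m')%N -> A e n m `<=` A e n m'.
  move=> /subnK <-; elim: (m' - m)%N => // i IH w /IH; rewrite /A /= => gt.
  by rewrite (leNgt _ e) gt addr0.
have Ale e n b : 0 < e -> (forall m, \sum_(n <= j < m) c j ^+ 2 <= b) ->
    (P (\bigcup_m A e n m) <= (b / e ^+ 2)%:E)%E.
  move=> e0 cb.
  have cvg := @nondecreasing_cvg_mu _ _ _ P (A e n) (mA e n) (bigcup_measurable (fun m
      _ => mA e n m)).
  have {cvg} : P (A e n m) @[m --> \oo] --> P (\bigcup_m A e n m).
    apply: cvg => m m' mm'; apply/subsetPset; exact: Amono.
  move=> cvgP; rewrite -(cvg_lim _ cvgP)//.
  apply: lime_le; first by apply/cvg_ex; exists (P (\bigcup_m A e n m)).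
  apply: nearW => m; apply: (le_trans (chebyshev_bound _ _ e0)).
    exact: history_determined_bounded (@stopped_sum_determined e n m).
  by rewrite lee_fin ler_wpM2r ?invr_ge0 ?exprn_ge0 ?(ltW e0)// (le_trans
      (stopped_sum_sqr_mean _ _ _)).
have neg e : 0 < e -> P.-negligible (\bigcap_n \bigcup_m A e n m).
  move=> e0.
  have mB : measurable (\bigcap_n \bigcup_m A e n m).
    by apply: bigcap_measurable => // n _; exact: bigcup_measurable.
  apply/negligibleP => //; apply/eqP; rewrite eq_le measure_ge0 andbT.
  apply/lee_addgt0Pr => r r0; rewrite add0e.
  have re : 0 < r * e ^+ 2 by rewrite mulr_gt0// exprn_gt0.
  have [n cn] := c_sq re.
  apply: (@le_trans _ _ (P (\bigcup_m A e n m))).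
    apply: le_measure; rewrite ?inE//; first exact: bigcup_measurable.
    by move=> w; apply.
  by apply: (le_trans (Ale e n _ e0 cn)); rewrite lee_fin mulfK// gt_eqF// exprn_gt0.
have negU : P.-negligible (\bigcup_k \bigcap_n \bigcup_m A (k.+1%:R^-1) n m).
  by apply: negligible_bigcup => k; apply: neg; rewrite invr_gt0.
apply: negligibleS negU => w Hw; apply: contrapT => notU; apply: Hw => /= e e0.
pose k := Num.bound (2 / e).
have k0 : 0 < k.+1%:R^-1 :> R by rewrite invr_gt0.
have ke : 2 * k.+1%:R^-1 <= e.
  rewrite ler_pdivrMr// mulrC -ler_pdivrMr//.
  apply: ltW; apply: lt_le_trans (archi_boundP _) _; first by rewrite divr_ge0// ltW.
  by rewrite ler_nat.
have [n0 Hn0] : exists n0, forall i, `|\sum_(n0 <= j < n0 + i) D j w| <= k.+1%:R^-1.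
  apply: contrapT => /forallNP far; apply: notU; exists k => // n _.
  have /existsNP[i /negP] := far n; rewrite -ltNge => gt.
  by exists i => //; exact: stopped_sum_detects gt.
exists n0 => n m /andP[n0n nm].
rewrite (_ : \sum_(n <= j < m) D j w = \sum_(n0 <= j < m) D j w - \sum_(n0 <= j < n) D
    j w); last first.
  by rewrite [X in X - _](@big_cat_nat _ _ _ n n0 m)//= addrAC subrr add0r.
apply: (le_trans (ler_normB _ _)); apply: le_trans ke.
rewrite mulr_natl mulr2n lerD//.
  by rewrite -(subnKC (leq_trans n0n nm)).
by rewrite -(subnKC n0n).
Qed.

End Martingale.

(** * Averages over independent samples *)

Section IidSample.
Context {R : realType} {V : finType}.
Variables (a : V -> R) (y : V -> bool) (k : nat).
Hypothesis k_gt0 : (0 < k)%N.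
Hypothesis a_ge0 : forall v, 0 <= a v.
Hypothesis a_sum1 : \sum_v a v = 1.

Definition sample_weight (s : {ffun 'I_k -> V}) : R := \prod_i a (s i).
Definition sample_freq (s : {ffun 'I_k -> V}) : R := (\sum_i y (s i))%N%:R / k%:R.
Definition success_prob : R := \sum_(v | y v) a v.
Definition sample_mean (u : R -> R) : R := \sum_s sample_weight s * u (sample_freq s).

Local Notation q := success_prob.
Local Notation dev v := ((y v)%:R - q).

(** Independence: the mean of a product of functions of the single draws
    factors. *)
Lemma sample_weight_prod (c : 'I_k -> V -> R) :
  \sum_s sample_weight s * \prod_i c i (s i) = \prod_i \sum_v a v * c i v.
Proof.
rewrite bigA_distr_bigA/=; apply: eq_bigr => s _.
by rewrite /sample_weight -big_split.
Qed.

Lemma sample_weight_ge0 s : 0 <= sample_weight s.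
Proof. exact: prodr_ge0. Qed.

Lemma sample_weight_sum1 : \sum_s sample_weight s = 1.
Proof.
transitivity (\sum_s sample_weight s * \prod_(i < k) 1).
  by apply: eq_bigr => s _; rewrite big1_eq mulr1.
rewrite (sample_weight_prod (fun _ _ => 1)) big1// => i _.
by transitivity (\sum_v a v) => //; apply: eq_bigr => v _; rewrite mulr1.
Qed.

Lemma success_prob_itv : 0 <= q <= 1.
Proof.
rewrite sumr_ge0//= -a_sum1 [leRHS](bigID y)/= lerDl.
exact: sumr_ge0.
Qed.

Lemma sample_freq_itv s : 0 <= sample_freq s <= 1.
Proof.
rewrite divr_ge0//= ler_pdivrMr ?ltr0n// mul1r ler_nat.
rewrite -[leqRHS]card_ord -sum1_card leq_sum// => i _.
by case: (y _).
Qed.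

Lemma dev_sum0 : \sum_v a v * dev v = 0.
Proof.
under eq_bigr do rewrite mulrBr.
rewrite sumrB -mulr_suml a_sum1 mul1r /success_prob [X in _ - X]big_mkcond/=.
rewrite -sumrB big1// => v _; case: (y v); rewrite ?mulr1 ?mulr0 subrr//.
Qed.

Lemma dev_le1 v : `|dev v| <= 1.
Proof.
by have /andP[q0 q1] := success_prob_itv; rewrite ler_norml; case: (y v); rewrite
    ?mulr1n ?mulr0n; lra.
Qed.

Lemma sample_freq_dev s : sample_freq s - q = k%:R^-1 * \sum_i dev (s i).
Proof.
rewrite sumrB sumr_const card_ord -mulr_natl /sample_freq natr_sum.
have : k%:R != 0 :> R by rewrite pnatr_eq0 -lt0n.
by move=> k0; field.
Qed.

Lemma prod_select (i : 'I_k) (c : 'I_k -> R) :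
  \prod_l (if l == i then c l else 1) = c i.
Proof. by rewrite -big_mkcond big_pred1_eq. Qed.

Lemma sample_mean_dev i : \sum_s sample_weight s * dev (s i) = 0.
Proof.
transitivity (\sum_s sample_weight s * \prod_l (if l == i then dev (s l) else 1)).
  by apply: eq_bigr => s _; rewrite (prod_select i (fun l => dev (s l))).
rewrite (sample_weight_prod (fun l v => if l == i then dev v else 1)).
by rewrite (bigD1 i)//= eqxx dev_sum0 mul0r.
Qed.

(** The deviations of two different draws are uncorrelated. *)
Lemma sample_mean_dev2 i j :
  \sum_s sample_weight s * (dev (s i) * dev (s j)) <= (i == j)%:R.
Proof.
rewrite (eq_bigr (fun s => sample_weight s *
    \prod_l ((if l == i then dev (s l) else 1) * (if l == j then dev (s l) else 1))));
        last first.
  move=> s _; rewrite big_split/= (prod_select i (fun l => dev (s l))).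
  by rewrite (prod_select j (fun l => dev (s l))).
rewrite (sample_weight_prod (fun l v =>
  (if l == i then dev v else 1) * (if l == j then dev v else 1))).
rewrite (bigD1 i)//= eqxx; have [<-|ij] := eqVneq i j.
  rewrite [X in _ * X]big1 ?mulr1; last first.
    move=> l /negPf li; transitivity (\sum_v a v) => //; apply: eq_bigr => v _.
    by rewrite li !mulr1.
  rewrite -[leRHS]a_sum1 ler_sum// => v _; rewrite -[leRHS]mulr1 ler_wpM2l//.
  by have := dev_le1 v; rewrite ler_norml => /andP[? ?]; nra.
rewrite (eq_bigr (fun v => a v * dev v)) ?dev_sum0 ?mul0r//.
by move=> v _; rewrite mulr1.
Qed.

Lemma sample_variance : sample_mean (fun x => (x - q) ^+ 2) <= k%:R^-1.
Proof.
rewrite /sample_mean.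
rewrite (eq_bigr (fun s => k%:R^-1 ^+ 2 *
   \sum_i \sum_j sample_weight s * (dev (s i) * dev (s j)))); last first.
  move=> s _; rewrite sample_freq_dev exprMn mulrCA; congr (_ * _).
  rewrite expr2 mulr_suml mulr_sumr; apply: eq_bigr => i _.
  by rewrite !mulr_sumr.
rewrite -mulr_sumr exchange_big/=.
under eq_bigr do rewrite exchange_big/=.
have k0 : 0 < k%:R :> R by rewrite ltr0n.
rewrite expr2 -mulrA -[leRHS]mulr1 ler_wpM2l ?invr_ge0// mulrC ler_pdivrMr// mul1r.
apply: (@le_trans _ _ (\sum_(i < k) (1 : R))); last first.
  by rewrite sumr_const card_ord.
apply: ler_sum => i _; apply: (@le_trans _ _ (\sum_(j < k) (i == j)%:R)).
  by apply: ler_sum => j _; exact: sample_mean_dev2.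
by rewrite (bigD1 i)//= eqxx big1 ?addr0// => j; rewrite eq_sym => /negPf ->.
Qed.

Lemma sample_mean_id : sample_mean (fun x => x - q) = 0.
Proof.
rewrite /sample_mean; under eq_bigr do rewrite sample_freq_dev mulrCA mulr_sumr.
by rewrite -mulr_sumr exchange_big/= big1 ?mulr0// => i _; exact: sample_mean_dev.
Qed.

Lemma sample_mean_le u v : (forall x, 0 <= x <= 1 -> u x <= v x) ->
  sample_mean u <= sample_mean v.
Proof.
move=> uv; apply: ler_sum => s _; rewrite ler_wpM2l ?sample_weight_ge0//.
exact/uv/sample_freq_itv.
Qed.

Lemma sample_meanD u v : sample_mean (fun x => u x + v x) = sample_mean u + sample_mean v.
Proof. by rewrite -big_split; apply: eq_bigr => s _; rewrite mulrDr. Qed.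

Lemma sample_meanZ c u : sample_mean (fun x => c * u x) = c * sample_mean u.
Proof. by rewrite mulr_sumr; apply: eq_bigr => s _; rewrite mulrCA. Qed.

Lemma sample_mean_cst c : sample_mean (fun=> c) = c.
Proof. by rewrite /sample_mean -mulr_suml sample_weight_sum1 mul1r. Qed.

Lemma sample_mean_norm u : `|sample_mean u| <= sample_mean (fun x => `|u x|).
Proof.
apply: (le_trans (ler_norm_sum _ _ _)); apply: ler_sum => s _.
by rewrite normrM ger0_norm ?sample_weight_ge0.
Qed.

(** From |t| <= r t^2 / 2 + 1 / (2 r) with r the square root of k, the
    choice of r that balances the two terms. *)
Lemma sample_abs_dev : sample_mean (fun x => `|x - q|) <= (Num.sqrt k%:R)^-1.
Proof.
have k0 : 0 < k%:R :> R by rewrite ltr0n.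
set r := Num.sqrt _; have r0 : 0 < r by rewrite sqrtr_gt0.
have r2 : r ^+ 2 = k%:R by rewrite sqr_sqrtr// ltW.
apply: (@le_trans _ _ (sample_mean (fun x => r / 2 * (x - q) ^+ 2 + r^-1 / 2))).
  apply: sample_mean_le => x _.
  rewrite -(real_normK (num_real (x - q))); move: `|_| => t.
  have : 0 <= r / 2 * (t - r^-1) ^+ 2 by rewrite mulr_ge0 ?sqr_ge0// divr_ge0// ltW.
  rewrite sqrrB mulrDr mulrBr.
  rewrite (_ : r / 2 * r^-1 ^+ 2 = r^-1 / 2); last by field; rewrite gt_eqF.
  rewrite (_ : r / 2 * (t * r^-1 *+ 2) = t); last by field; rewrite gt_eqF.
  lra.
rewrite sample_meanD sample_meanZ sample_mean_cst.
have := sample_variance; rewrite -r2 => H.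
have : r / 2 * sample_mean (fun x => (x - q) ^+ 2) <= r / 2 * (r ^+ 2)^-1.
  by rewrite ler_wpM2l// divr_ge0// ltW.
rewrite (_ : r / 2 * (r ^+ 2)^-1 = r^-1 / 2); last by field; rewrite gt_eqF.
lra.
Qed.

(** The linear term of the expansion around the success probability averages
    to zero; what remains is bounded by the first absolute moment and the
    variance. *)
Lemma sample_mean_bias u s b0 b1 : 0 <= b0 -> 0 <= b1 ->
  (forall x, 0 <= x <= 1 ->
    `|u x - u q - s * (x - q)| <= b0 * `|x - q| + b1 * (x - q) ^+ 2) ->
  `|sample_mean u - u q| <= b0 / Num.sqrt k%:R + b1 / k%:R.
Proof.
move=> b00 b10 H.
have -> : sample_mean u - u q = sample_mean (fun x => u x - u q - s * (x - q)).
  rewrite (_ : (fun x => u x - u q - s * (x - q)) =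
    (fun x => (u x + - u q) + (- s) * (x - q))); last by apply/funext => x; rewrite mulNr.
  by rewrite !sample_meanD sample_meanZ sample_mean_id mulr0 addr0 sample_mean_cst.
apply: (le_trans (sample_mean_norm _)); apply: (le_trans (sample_mean_le H)).
rewrite sample_meanD !sample_meanZ lerD// ler_wpM2l//; first exact: sample_abs_dev.
exact: sample_variance.
Qed.

End IidSample.

(** * Expansions of functions on the unit interval *)

Section Regularity.
Context {R : realType}.
Implicit Types (u v g : R -> R) (x y q : R).

(** A first-order expansion of u around every point q, whose slope s is
    allowed to be any function: s = 0 for a Lipschitz function, the
    derivative otherwise. *)
Definition chord_error u (s : R -> R) (b0 b1 : R) : Prop :=
  forall q y, 0 <= q <= 1 -> 0 <= y <= 1 ->
    `|u y - u q - s q * (y - q)| <= b0 * `|y - q| + b1 * (y - q) ^+ 2.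

Definition lipschitz01 u (L : R) : Prop :=
  forall x y, 0 <= x <= 1 -> 0 <= y <= 1 -> `|u x - u y| <= L * `|x - y|.

Lemma lipschitz_lipschitz01 u : [lipschitz u x | x in `[0, 1]%classic] ->
  exists2 L, 0 < L & lipschitz01 u L.
Proof.
move=> H; have [L [L0 HL]] := pinfty_ex_gt0 H.
exists L => // x y x01 y01; apply: (HL (x, y)).
by split; rewrite /= in_itv.
Qed.

Lemma continuous_bounded01 (h : R -> R) : (forall x, 0 <= x <= 1 -> {for x, continuous
    h}) ->
  exists2 M, 0 < M & forall x, 0 <= x <= 1 -> `|h x| <= M.
Proof.
move=> ch.
have cA : compact (h @` `[0, 1]%classic).
  apply: continuous_compact; last exact: segment_compact.
  by apply: continuous_in_subspaceT => x; rewrite inE/= in_itv/= => /ch.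
have [M [_ HM]] := compact_bounded cA.
exists (`|M| + 1); first by rewrite ltr_wpDl.
move=> x x01; apply: (HM (`|M| + 1)); last by exists x => //=; rewrite in_itv.
by rewrite (le_lt_trans (ler_norm _))// ltrDl.
Qed.

(** What the extension required by C_class01 1 provides on [0, 1]; working
    with the derivative v' as a datum keeps the open set of the extension
    out of the estimates. *)
Definition deriv_ext01 u v v' : Prop :=
  [/\ forall x, 0 <= x <= 1 -> v x = u x,
      forall x, 0 <= x <= 1 -> is_derive x 1 v (v' x)
    & forall x, 0 <= x <= 1 -> {for x, continuous v'}].

Lemma C_class01_deriv_ext u : C_class01 1 u -> exists v v', deriv_ext01 u v v'.
Proof.
move=> [Q [v [oQ Q01 vu dv cv]]]; exists v, (derive1n 1 v).
have Ox x : 0 <= x <= 1 -> Q x by move=> x01; apply: Q01; rewrite /= in_itv.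
split => // x x01; last exact/cv/Ox.
by rewrite /= derive1E; apply: derivableP; apply: (dv 0%N) => //; exact: Ox.
Qed.

Lemma C_class01_deriv_ext2 u : C_class01 2 u -> exists v v' v'',
  deriv_ext01 u v v' /\ deriv_ext01 v' v' v''.
Proof.
move=> [Q [v [oQ Q01 vu dv cv]]]; exists v, (derive1n 1 v), (derive1n 2 v).
have Ox x : 0 <= x <= 1 -> Q x by move=> x01; apply: Q01; rewrite /= in_itv.
have d1 x : 0 <= x <= 1 -> is_derive x 1 v (derive1n 1 v x).
  by move=> x01; rewrite /= derive1E; apply: derivableP; apply: (dv 0%N) => //; exact: Ox.
have d2 x : 0 <= x <= 1 -> is_derive x 1 (derive1n 1 v) (derive1n 2 v x).
  move=> x01; rewrite -[derive1n 2 v x]/(derive1 (derive1n 1 v) x) derive1E; apply: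
      derivableP; apply: (dv 1%N) => //; exact: Ox.
split; split => // x x01; first by apply: is_derive_continuous (d2 x x01).
exact/cv/Ox.
Qed.

Lemma deriv_ext_mvt u v v' x y : deriv_ext01 u v v' -> 0 <= x <= 1 -> 0 <= y <= 1 ->
  exists z, [/\ 0 <= z <= 1, `|z - x| <= `|y - x| & u y - u x = v' z * (y - x)].
Proof.
move=> [vu dv cv].
have main a b : 0 <= a <= 1 -> 0 <= b <= 1 -> a <= b ->
    exists z, a <= z <= b /\ u b - u a = v' z * (b - a).
  move=> a01 b01 ab.
  have sub c : a <= c <= b -> 0 <= c <= 1 by lra.
  have [||c] := @MVT_segment _ v v' a b ab.
  - by move=> c; rewrite in_itv/= => /andP[? ?]; apply/dv/sub; lra.
  - apply: continuous_in_subspaceT => c; rewrite inE/= in_itv/= => cab.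
    by apply: is_derive_continuous; apply/dv/sub.
  by rewrite in_itv/= !vu// => cab e; exists c.
move=> x01 y01; have [xy|yx] := leP x y.
  have [z [zxy e]] := main x y x01 y01 xy; exists z; split => //; first lra.
  by rewrite !ger0_norm; lra.
have [z [zxy e]] := main y x y01 x01 (ltW yx); exists z; split => //; first lra.
  by rewrite !ler0_norm; lra.
by rewrite -opprB e -mulrN opprB.
Qed.

Lemma deriv_ext_lipschitz u v v' : deriv_ext01 u v v' -> exists2 L, 0 < L &
  lipschitz01 u L.
Proof.
move=> H; have [vu dv cv] := H; have [M M0 HM] := continuous_bounded01 cv.
exists M => // x y x01 y01; have [z [z01 _ ->]] := deriv_ext_mvt H y01 x01.
by rewrite normrM ler_wpM2r// HM.
Qed.

(** The derivative is itself Lipschitz, so the remainder of the first-order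
    expansion is quadratic. *)
Lemma deriv_ext_quadratic u v v' v'' : deriv_ext01 u v v' -> deriv_ext01 v' v' v'' ->
  exists2 C, 0 < C & chord_error u v' 0 C.
Proof.
move=> H H'; have [C C0 HC] := deriv_ext_lipschitz H'; exists C => // q y q01 y01.
have [z [z01 zq ->]] := deriv_ext_mvt H q01 y01.
rewrite -mulrBl normrM mul0r add0r -(real_normK (num_real (y - q))) expr2 mulrA.
by rewrite ler_wpM2r// (le_trans (HC _ _ z01 q01))// ler_wpM2l// ltW.
Qed.

(** The one-sided limits in the definition agree with the derivative of the
    extension, because the difference quotient is a function continuous at x
    and [0, 1] has no isolated point. *)
Lemma deriv01E u v v' x : deriv_ext01 u v v' -> 0 <= x <= 1 -> deriv01 u x = v' x.
Proof.
move=> [vu dv _] x01; have [h [hE ch hx]] := (is_derive1_caratheodory v x (v' x)).1 (dv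
    x x01).
rewrite -hx /deriv01; apply: cvg_lim => //.
have PF : ProperFilter (within `[0, 1]%classic x^').
  apply: Build_ProperFilter_ex => B; rewrite /= /within /= => -[e /= e0 eB].
  pose r := Num.min e 1 / 2.
  have r0 : 0 < r by rewrite divr_gt0// lt_min e0 ltr01.
  have re : r < e.
    have : Num.min e 1 <= e by rewrite ge_min lexx.
    by rewrite /r; lra.
  have r1 : r <= 1 / 2.
    have : Num.min e 1 <= 1 by rewrite ge_min lexx orbT.
    by rewrite /r; lra.
  have [xl|xr] := leP x (1 / 2).
    exists (x + r); apply: eB.
    - by rewrite /ball_ /= opprD addrA subrr sub0r normrN gtr0_norm.
    - by rewrite addrC -subr_eq0 addrK gt_eqF.
    - by rewrite /= in_itv/=; lra.
  exists (x - r); apply: eB.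
  - by rewrite /ball_ /= opprB addrC subrK gtr0_norm.
  - by rewrite -subr_eq0 addrAC subrr sub0r oppr_eq0 gt_eqF.
  - by rewrite /= in_itv/=; lra.
exact: PF.
have FF : Filter (within `[0, 1]%classic x^') by apply: within_filter.
apply: (@cvg_trans _ (h @ within `[0, 1]%classic x^')).
  apply: near_eq_cvg; rewrite near_withinE /dnbhs near_withinE.
  apply: nearW => y yx; rewrite /= in_itv/= => y01.
  by rewrite -!vu// hE mulfK// subr_eq0.
apply: cvg_within_filter; apply: cvg_within_filter; exact: ch.
Qed.

Lemma modulus_le (u : R -> R) (M : R) e x y : (forall x, 0 <= x <= 1 -> `|u x| <= M) ->
  0 <= x <= 1 -> 0 <= y <= 1 -> `|x - y| < e -> `|u x - u y| <= modulus u e.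
Proof.
move=> uM x01 y01 xy; apply: ub_le_sup; last by exists x, y.
exists (M + M) => _ [a [b [a01 b01 _ ->]]].
by rewrite (le_trans (ler_normB _ _))// lerD// uM.
Qed.

Lemma modulus_ge0 u e : 0 <= modulus u e.
Proof.
rewrite /modulus; set S := [set _ | _].
have [hs|nhs] := pselect (has_sup S); last by rewrite sup_out.
have [r Sr] := hs.1; have [a [b [_ _ _ rE]]] := Sr.
by apply: (@le_trans _ _ r); [rewrite rE|apply: ub_le_sup Sr; case: hs].
Qed.

(** Cut the segment from y to x into pieces shorter than e. *)
Lemma modulus_subadditive u (M : R) e x y : (forall x, 0 <= x <= 1 -> `|u x| <= M) ->
  0 < e -> 0 <= x <= 1 -> 0 <= y <= 1 ->
  `|u x - u y| <= (1 + `|x - y| / e) * modulus u e.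
Proof.
move=> uM e0 x01 y01.
have [n [n1 n2]] : exists n : nat, n%:R <= `|x - y| / e /\ `|x - y| / e < n.+1%:R.
  exists (Num.truncn (`|x - y| / e)).
  have /andP[? ?] : (Num.truncn (`|x - y| / e))%:R <= `|x - y| / e < (Num.truncn (`|x -
      y| / e)).+1%:R.
    by apply: truncn_itv; rewrite divr_ge0// ltW.
  by [].
pose w j : R := y + (j%:R / n.+1%:R) * (x - y).
have n0 : 0 < n.+1%:R :> R by rewrite ltr0n.
have w01 j : (j <= n.+1)%N -> 0 <= w j <= 1.
  move=> jn; have t0 : 0 <= j%:R / n.+1%:R :> R by rewrite divr_ge0.
  have t1 : j%:R / n.+1%:R <= 1 :> R by rewrite ler_pdivrMr// mul1r ler_nat.
  rewrite /w; move: (_ / _) t0 t1 => t t0 t1; nra.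
have step j : (j < n.+1)%N -> `|u (w j.+1) - u (w j)| <= modulus u e.
  move=> jn; apply: (modulus_le uM); [exact: w01|exact/w01/ltnW|].
  rewrite (_ : w j.+1 - w j = (x - y) / n.+1%:R).
    rewrite normrM normfV (ger0_norm (ltW n0)) ltr_pdivrMr//.
    by move: n2; rewrite ltr_pdivrMr// mulrC.
  by rewrite /w -(natr1 j); field; rewrite addrC natr1 gt_eqF.
have tele j : (j <= n.+1)%N -> `|u (w j) - u (w 0%N)| <= j%:R * modulus u e.
  elim: j => [|j IH] jn; first by rewrite subrr normr0 mul0r.
  have := IH (ltnW jn); have := step j jn.
  rewrite -natr1 mulrDl mul1r; have := ler_distD (u (w j)) (u (w j.+1)) (u (w 0%N)).
  lra.
have := tele n.+1 (leqnn _).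
rewrite (_ : w n.+1 = x); last by rewrite /w divff ?gt_eqF// mul1r addrC subrK.
rewrite (_ : w 0%N = y); last by rewrite /w mul0r mul0r addr0.
move=> /le_trans; apply; rewrite ler_wpM2r ?modulus_ge0//.
by rewrite -natr1 addrC lerD2l.
Qed.

(** The mean value theorem, and the modulus of continuity of the derivative
    at scale e extended to larger distances by subadditivity. *)
Lemma deriv_ext_modulus u v v' e : deriv_ext01 u v v' -> 0 < e ->
  chord_error u v' (modulus (deriv01 u) e) (modulus (deriv01 u) e / e).
Proof.
move=> H e0 q y q01 y01; have [vu dv cv] := H.
have [M M0 HM] := continuous_bounded01 cv.
have HM' x : 0 <= x <= 1 -> `|deriv01 u x| <= M by move=> x01; rewrite (deriv01E H)// HM.
have [z [z01 zq ->]] := deriv_ext_mvt H q01 y01.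
rewrite -mulrBl normrM -!(deriv01E H)//.
have := modulus_subadditive HM' e0 z01 q01.
have := modulus_ge0 (deriv01 u) e; move: (modulus _ _) => om om0 le.
rewrite (_ : om * `|y - q| + om / e * (y - q) ^+ 2 = (1 + `|y - q| / e) * om * `|y -
    q|); last first.
  by rewrite -(real_normK (num_real (y - q))); field; rewrite gt_eqF.
rewrite ler_wpM2r// (le_trans le)// ler_wpM2r// lerD2l ler_wpM2r// invr_ge0 ltW//.
Qed.

(** Both x g(x) and x g(x) + (1 - x)(1 - g(x)) have the form (a x + b) g(x)
    + (c x + d), so that this lemma and the two below transfer the
    regularity of g to them. *)
Lemma deriv_ext_affine_mul g v v' (a b c d : R) : deriv_ext01 g v v' ->
  exists w w', deriv_ext01 (fun x => (a * x + b) * g x + (c * x + d)) w w'.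
Proof.
move=> [vg dv cv].
exists (fun x => (a * x + b) * v x + (c * x + d)), (fun x => (a * x + b) * v' x + v x *
    a + c).
have lin (m l x : R) : is_derive x 1 (fun x : R => m * x + l) m.
  have := is_deriveD (is_deriveZ m (is_derive_id x (1 : R))) (is_derive_cst l x (1 : R)).
  by rewrite addr0 /= [m *: _]mulr1.
split => x x01.
- by rewrite vg.
- have := is_deriveD (@is_deriveM _ _ (fun x : R => a * x + b) v x 1 _ _ (lin a b x)
    (dv x x01)) (lin c d x).
  by [].
- have c1 : {for x, continuous (fun x : R => a * x + b)}.
    exact: is_derive_continuous (lin a b x).
  have c2 : {for x, continuous v} := is_derive_continuous (dv x x01).
  apply: cvgD; last exact: cvg_cst.
  apply: cvgD; first by apply: cvgM; [exact: c1|exact: cv].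
  by apply: cvgM; [exact: c2|exact: cvg_cst].
Qed.

Lemma quadratic_affine_mul g s (a b c d C M : R) : 0 < C ->
  (forall x, 0 <= x <= 1 -> `|s x| <= M) -> chord_error g s 0 C ->
  chord_error (fun x => (a * x + b) * g x + (c * x + d))
    (fun q => (a * q + b) * s q + a * g q + c) 0 (`|a| * M + (`|a| + `|b|) * C).
Proof.
move=> C0 sM H q y q01 y01; have := H q y q01 y01; rewrite !mul0r !add0r => r.
set e := g y - _ - _ in r.
rewrite (_ : _ - _ = a * s q * (y - q) ^+ 2 + (a * y + b) * e); last by rewrite /e; ring.
apply: (le_trans (ler_normD _ _)); rewrite [leRHS]mulrDl lerD//.
  rewrite normrM (ger0_norm (sqr_ge0 _)) ler_wpM2r ?sqr_ge0// normrM ler_wpM2l//.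
  exact: sM.
rewrite normrM -mulrA ler_pM//.
rewrite (le_trans (ler_normD _ _))// lerD2r normrM -[leRHS]mulr1 ler_wpM2l//.
by rewrite ger0_norm; lra.
Qed.

Lemma lipschitz_affine_mul g (a b c d L : R) : (forall x, 0 <= x <= 1 -> `|g x| <= 1) ->
  0 < L -> lipschitz01 g L ->
  lipschitz01 (fun x => (a * x + b) * g x + (c * x + d)) ((`|a| + `|b|) * L + `|a| +
      `|c|).
Proof.
move=> g1 L0 H x y x01 y01.
rewrite (_ : _ - _ = (a * x + b) * (g x - g y) + a * g y * (x - y) + c * (x - y)); last
    ring.
rewrite [leRHS]mulrDl; apply: (le_trans (ler_normD _ _)); rewrite lerD ?normrM//.
rewrite [leRHS]mulrDl; apply: (le_trans (ler_normD _ _)); rewrite lerD ?normrM//.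
  rewrite -[leRHS]mulrA ler_pM ?H//.
  rewrite (le_trans (ler_normD _ _))// lerD2r normrM -[leRHS]mulr1 ler_wpM2l//.
  by rewrite ger0_norm; lra.
by rewrite ler_wpM2r// -[leRHS]mulr1 ler_wpM2l// g1.
Qed.

Lemma lipschitz_chord_error u L : lipschitz01 u L -> chord_error u (cst 0) L 0.
Proof. by move=> H q y q01 y01; rewrite !mul0r subr0 addr0; exact: H. Qed.

End Regularity.

(** * Series with small tails *)

Section Tails.
Context {R : realType}.
Implicit Types (a b : nat -> R).

Definition small_tails a : Prop := forall e, 0 < e ->
  exists n0, forall n m, (n0 <= n <= m)%N -> `|\sum_(n <= j < m) a j| <= e.

(** Partial sums of a convergent series form a Cauchy sequence. *)
Lemma summable_small_tails N a : summable_from N a -> small_tails a.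
Proof.
move=> /cvg_ex[l cl] e e0; have e2 : 0 < e / 2 by rewrite divr_gt0.
have /cvgrPdist_le/(_ _ e2)[n0 _ H] := cl.
exists (maxn N n0) => n m /andP[]; rewrite geq_max => /andP[Nn n0n] nm.
rewrite (_ : \sum_(n <= j < m) a j = \sum_(N <= j < m) a j - \sum_(N <= j < n) a j).
  have h1 := H n n0n; have h2 := H m (leq_trans n0n nm); rewrite /= in h1 h2.
  have := ler_distD l (\sum_(N <= j < m) a j) (\sum_(N <= j < n) a j).
  by rewrite [X in _ <= X + _]distrC; lra.
by rewrite [X in X - _](@big_cat_nat _ _ _ n N m)//= addrAC subrr add0r.
Qed.

Lemma small_tails_le N (C : R) a b : (forall n, (N <= n)%N -> `|a n| <= C * b n) ->
  small_tails b -> small_tails a.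
Proof.
move=> le tb e e0.
have C0 : 0 < `|C| + 1 by rewrite ltr_wpDl.
have eC : 0 < e / (`|C| + 1) by rewrite divr_gt0.
have [n0 H] := tb _ eC; exists (maxn N n0) => n m /andP[].
rewrite geq_max => /andP[Nn n0n] nm.
apply: (le_trans (ler_norm_sum _ _ _)).
apply: (@le_trans _ _ (C * \sum_(n <= j < m) b j)).
  rewrite mulr_sumr big_nat_cond [leRHS]big_nat_cond ler_sum// => j /andP[/andP[nj _] _].
  exact/le/(leq_trans Nn).
apply: (le_trans (ler_norm _)); rewrite normrM.
apply: (@le_trans _ _ ((`|C| + 1) * (e / (`|C| + 1)))).
  by rewrite ler_pM// ?lerDl// H// n0n.
by rewrite mulrC divfK// gt_eqF.
Qed.

Lemma small_tailsD a b : small_tails a -> small_tails b -> small_tails (fun n => a n +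
    b n).
Proof.
move=> ta tb e e0; have e2 : 0 < e / 2 by rewrite divr_gt0.
have [n1 H1] := ta _ e2; have [n2 H2] := tb _ e2.
exists (maxn n1 n2) => n m /andP[]; rewrite geq_max => /andP[n1n n2n] nm.
rewrite big_split/= (le_trans (ler_normD _ _))// [leRHS]splitr lerD//.
  by rewrite H1// n1n.
by rewrite H2// n2n.
Qed.

End Tails.

(** * The bias under each of the three assumptions *)

Section BiasControl.
Context {R : realType}.
Variables (N : nat) (k : nat -> nat) (g : R -> R).
Hypothesis k_gt0 : forall n, (N <= n)%N -> (0 < k n)%N.
Hypothesis g01 : forall x, 0 <= x <= 1 -> 0 <= g x <= 1.

(** Along the weights wt, the expansions of u bound the error made when u is
    averaged over samples of size k n, see sample_mean_bias. The
    coefficients may depend on n: under (A2) they come from the modulus of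
    continuity at scale k_n^(-1/2). *)
Definition bias_controlled (wt : nat -> R) (u : R -> R) : Prop :=
  exists (sl : nat -> R -> R) (b0 b1 : nat -> R),
    (forall n, (N <= n)%N -> [/\ 0 <= b0 n, 0 <= b1 n & chord_error u (sl n) (b0 n) (b1
        n)]) /\
    small_tails (fun n => wt n * (b0 n / Num.sqrt (k n)%:R + b1 n / (k n)%:R)).

Let w1 n : R := n.+1%:R^-1.
Let w2 n : R := (k n)%:R / (s_ N k n.+1)%:R.

Lemma varphiE : varphi g = fun x => (1 * x + 0) * g x + (0 * x + 0).
Proof. by apply/funext => x; rewrite /varphi; ring. Qed.

Lemma psiE : psi g = fun x => (2 * x + -1) * g x + (-1 * x + 1).
Proof. by apply/funext => x; rewrite /psi; ring. Qed.

Let sqrt_gt0 n : (N <= n)%N -> 0 < Num.sqrt (k n)%:R :> R.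
Proof. by move=> Nn; rewrite sqrtr_gt0 ltr0n k_gt0. Qed.

Let sqr_sqrt n : Num.sqrt (k n)%:R ^+ 2 = (k n)%:R :> R.
Proof. by rewrite sqr_sqrtr. Qed.

Lemma bias_lipschitz u L (wt c : nat -> R) : 0 <= L -> lipschitz01 u L -> small_tails c ->
  (forall n, (N <= n)%N -> wt n / Num.sqrt (k n)%:R = c n) -> (forall n, 0 <= wt n) ->
  bias_controlled wt u.
Proof.
move=> L0 uL tc cE wt0; exists (fun=> cst 0), (fun=> L), (fun=> 0); split.
  by move=> n _; split => //; exact: lipschitz_chord_error.
apply: (@small_tails_le _ N L _ c) => // n Nn.
rewrite mul0r addr0 ger0_norm; last by rewrite mulr_ge0// divr_ge0// sqrtr_ge0.
by rewrite mulrCA cE.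
Qed.

(** At scale e = k_n^(-1/2) the two terms of the bias bound coincide. *)
Lemma bias_modulus u v v' (wt c : nat -> R) : deriv_ext01 u v v' -> small_tails c ->
  (forall n, (N <= n)%N ->
    wt n / Num.sqrt (k n)%:R * modulus (deriv01 u) (Num.sqrt (k n)%:R)^-1 = c n) ->
  (forall n, 0 <= wt n) -> bias_controlled wt u.
Proof.
move=> H tc cE wt0.
pose om n := modulus (deriv01 u) (Num.sqrt (k n)%:R)^-1.
have om0 n : 0 <= om n by exact: modulus_ge0.
exists (fun=> v'), om, (fun n => om n / (Num.sqrt (k n)%:R)^-1); split.
  move=> n Nn; split => //; first by rewrite divr_ge0// invr_ge0 sqrtr_ge0.
  by apply: deriv_ext_modulus H _; rewrite invr_gt0 sqrt_gt0.
apply: (@small_tails_le _ N 2 _ c) => // n Nn.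
rewrite -cE// -/(om n); move: (sqrt_gt0 Nn) (sqr_sqrt n) (om n) (om0 n).
move: (Num.sqrt _) => r r0 <- o o0.
rewrite (_ : _ + _ = 2 * (o / r)); last by field; rewrite gt_eqF.
rewrite ger0_norm; last by rewrite !mulr_ge0// invr_ge0 ltW.
by rewrite le_eqVlt; apply/orP; left; apply/eqP; ring.
Qed.

Lemma bias_quadratic u s C (wt c : nat -> R) : 0 <= C -> chord_error u s 0 C ->
  small_tails c -> (forall n, (N <= n)%N -> wt n / (k n)%:R = c n) -> (forall n, 0 <=
      wt n) ->
  bias_controlled wt u.
Proof.
move=> C0 uC tc cE wt0; exists (fun=> s), (fun=> 0), (fun=> C); split => //.
apply: (@small_tails_le _ N C _ c) => // n Nn.
rewrite mul0r add0r ger0_norm; last by rewrite mulr_ge0// divr_ge0.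
by rewrite mulrCA cE.
Qed.

Lemma bias_control : [\/ assumption_A1 N k g, assumption_A2 N k g | assumption_A3 N k
    g] ->
  [/\ exists2 L, 0 < L & lipschitz01 g L, bias_controlled w1 g,
      bias_controlled w2 (varphi g) & bias_controlled w2 (psi g)].
Proof.
have w10 n : 0 <= w1 n by rewrite invr_ge0.
have w20 n : 0 <= w2 n by rewrite divr_ge0.
have g1 x : 0 <= x <= 1 -> `|g x| <= 1 by move=> /g01/andP[? ?]; rewrite ger0_norm.
have w2s n : (N <= n)%N ->
    w2 n / Num.sqrt (k n)%:R = (s_ N k n.+1)%:R^-1 * Num.sqrt (k n)%:R.
  move=> /sqrt_gt0; rewrite /w2; move: (sqr_sqrt n) (_^-1); move: (Num.sqrt _) => r <-
      s r0.
  by rewrite expr2 mulrAC mulfK ?gt_eqF// mulrC.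
case.
- move=> [lg /summable_small_tails t1 /summable_small_tails t2].
  have [L L0 gL] := lipschitz_lipschitz01 lg.
  split; first by exists L.
  + by apply: (bias_lipschitz (ltW L0) gL t1 _ w10).
  + rewrite varphiE; apply: (bias_lipschitz _ (lipschitz_affine_mul _ _ _ _ g1 L0 gL)
      t2 w2s w20).
    by rewrite !addr_ge0// mulr_ge0// ?addr_ge0// ltW.
  + rewrite psiE; apply: (bias_lipschitz _ (lipschitz_affine_mul _ _ _ _ g1 L0 gL) t2
      w2s w20).
    by rewrite !addr_ge0// mulr_ge0// ?addr_ge0// ltW.
- move=> [cg /summable_small_tails t1 /summable_small_tails t2 /summable_small_tails t3].
  have [v [v' H]] := C_class01_deriv_ext cg.
  split; first exact: deriv_ext_lipschitz H.
  + by apply: bias_modulus H t1 _ w10.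
  + have [w [w' Hw]] := deriv_ext_affine_mul 1 0 0 0 H.
    rewrite -varphiE in Hw; apply: bias_modulus Hw t2 _ w20 => n Nn.
    by rewrite w2s.
  + have [w [w' Hw]] := deriv_ext_affine_mul 2 (-1) (-1) 1 H.
    rewrite -psiE in Hw; apply: bias_modulus Hw t3 _ w20 => n Nn.
    by rewrite w2s.
- move=> [cg /summable_small_tails t1 /summable_small_tails t2].
  have [v [v' [v'' [H H']]]] := C_class01_deriv_ext2 cg.
  have [C C0 HC] := deriv_ext_quadratic H H'.
  have [_ _ cv'] := H; have [M M0 HM] := continuous_bounded01 cv'.
  have w2k n : (N <= n)%N -> w2 n / (k n)%:R = (s_ N k n.+1)%:R^-1.
    move=> Nn; rewrite /w2 mulrAC divff ?mul1r//.
    by rewrite pnatr_eq0 -lt0n k_gt0.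
  have nn (a b : R) : 0 <= `|a| * M + (`|a| + `|b|) * C.
    by rewrite addr_ge0// mulr_ge0// ?addr_ge0// ltW.
  split; first exact: deriv_ext_lipschitz H.
  + by apply: (bias_quadratic (ltW C0) HC t1 _ w10).
  + rewrite varphiE; exact: (bias_quadratic (nn _ _) (quadratic_affine_mul _ _ _ _ C0
      HM HC) t2 w2k w20).
  + rewrite psiE; exact: (bias_quadratic (nn _ _) (quadratic_affine_mul _ _ _ _ C0 HM
      HC) t2 w2k w20).
Qed.

End BiasControl.

(** * Counting edges, and the history of the graph *)

Section Counting.
Context {d : measure_display} {T : measurableType d} (N : nat) (k : nat -> nat).
Variables (X : nat -> T -> bool) (U : nat -> nat -> T -> nat).
Hypothesis U_range : forall n i w, (N <= n)%N -> (1 <= i <= k n)%N -> (1 <= U n i w <=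
    n)%N.

Local Notation edges := (edges N k X U).
Local Notation new_edges := (new_edges k X U).

Lemma edgesS n w : (N <= n)%N -> edges n.+1 w = edges n w ++ new_edges n w.
Proof.
move=> Nn; rewrite /Defs.edges /index_iota subSn// -addn1 iotaD map_cat flatten_cat.
by rewrite /= cats0 subnKC.
Qed.

Lemma edges_le n w : (n <= N)%N -> edges n w = [::].
Proof. by move=> nN; rewrite /Defs.edges /index_iota (eqP nN). Qed.

Lemma mem_edges n w e : e \in edges n w -> (1 <= e.2 <= n)%N.
Proof.
have [/edges_le ->//|Nn] := leqP n N.
elim: n Nn => // n IH; rewrite ltnS => Nn; rewrite edgesS// mem_cat => /orP[|].
  move: Nn; rewrite leq_eqVlt => /orP[/eqP <-|/IH H /H/andP[-> /leqW]//].
  by rewrite edges_le.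
case/mapP => i; rewrite mem_filter mem_index_iota ltnS => /andP[_ ik] -> /=.
by have /andP[-> /leqW] := U_range w Nn ik.
Qed.

(** Counting edges by their target, vertex by vertex. *)
Lemma sum_indeg (p : pred nat) n (es : seq (nat * nat)) :
  (forall e, e \in es -> (1 <= e.2 <= n)%N) ->
  (\sum_(1 <= i < n.+1 | p i) count (fun e => e.2 == i) es = count (fun e => p e.2) es)%N.
Proof.
elim: es => [|e es IH] H; first by rewrite big1.
rewrite /= big_split/= IH; last by move=> e' e's; apply: H; rewrite inE e's orbT.
congr (_ + _)%N.
have := H e (mem_head _ _); rewrite -ltnS => e2.
transitivity (\sum_(1 <= i < n.+1 | p i && (i == e.2)) 1)%N.
  by rewrite big_mkcondr/=; apply: eq_bigr => i _; rewrite eq_sym; case: (i == _).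
by rewrite big_nat1_cond_eq e2; case: (p _).
Qed.

Lemma B_count n w : B_ N k X U n w = count (fun e => X e.2 w) (edges n w).
Proof. by apply: (@sum_indeg (X^~ w)) => e; exact: mem_edges. Qed.

Lemma C_size n w : C_ N k X U n w = size (edges n w).
Proof. by rewrite -count_predT -(@sum_indeg predT n)// => e; exact: mem_edges. Qed.

Lemma A_S n w : A_ X n.+1 w = (A_ X n w + X n.+1 w)%N.
Proof. by rewrite /A_ big_mkcond big_nat_recr//= -big_mkcond/=; case: (X _ _). Qed.

Lemma A_le n w : (A_ X n w <= n)%N.
Proof.
elim: n => [|n IH]; first by rewrite /A_ big_geq.
by rewrite A_S -addn1 leq_add// leq_b1.
Qed.

Lemma P_count n w : P_ k X U n w = count (fun i => X (U n i w) w) (index_iota 1 (k n).+1).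
Proof. by rewrite /P_ sum1_count. Qed.

Lemma P_le n w : (P_ k X U n w <= k n)%N.
Proof. by rewrite P_count (leq_trans (count_size _ _))// size_iota subn1. Qed.

Lemma B_S n w : (N <= n)%N ->
  B_ N k X U n.+1 w = (B_ N k X U n w + X n.+1 w * P_ k X U n w)%N.
Proof.
move=> Nn; rewrite !B_count edgesS// count_cat P_count; congr (_ + _)%N.
rewrite /Defs.new_edges count_map count_filter.
case: (X n.+1 w); rewrite ?mul1n ?mul0n.
  by apply: eq_count => i /=; case: (X _ _).
by rewrite -[RHS](count_pred0 (index_iota 1 (k n).+1)); apply: eq_count => i /=; case:
    (X _ _).
Qed.

Lemma C_S n w : (N <= n)%N -> C_ N k X U n.+1 w =
  (C_ N k X U n w + if X n.+1 w then P_ k X U n w else k n - P_ k X U n w)%N.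
Proof.
move=> Nn; rewrite !C_size edgesS// size_cat P_count; congr (_ + _)%N.
rewrite /Defs.new_edges size_map size_filter.
case: (X n.+1 w); first by apply: eq_count => i; case: (X _ _).
have sz : size (index_iota 1 (k n).+1) = k n by rewrite size_iota subn1.
have e := count_predC (fun i => X (U n i w) w) (index_iota 1 (k n).+1).
rewrite sz in e; rewrite -[X in (X - _)%N]e addKn.
by apply: eq_count => i /=; case: (X _ _).
Qed.

Lemma s_S n : (N <= n)%N -> s_ N k n.+1 = (s_ N k n + k n)%N.
Proof. by move=> Nn; rewrite /s_ big_nat_recr// ltnS. Qed.

Lemma B_le_C n w : (B_ N k X U n w <= C_ N k X U n w)%N.
Proof. by rewrite B_count C_size count_size. Qed.

Lemma C_le_s n w : (C_ N k X U n w <= s_ N k n)%N.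
Proof.
have [nN|Nn] := leqP n N; first by rewrite C_size edges_le.
elim: n Nn => // n IH; rewrite ltnS => Nn; rewrite C_S// s_S// leq_add//.
  move: Nn; rewrite leq_eqVlt => /orP[/eqP <-|/IH//].
  by rewrite C_size edges_le.
by case: (X _ _); [exact: P_le|exact: leq_subr].
Qed.

(** Any function of the graph at epoch n is constant on the classes of this
    relation, which is proved by rewriting alone; measurability with respect
    to the past follows because there are finitely many classes. *)
Definition agree n (w w' : T) : Prop :=
  (forall i, (1 <= i <= n)%N -> X i w = X i w') /\
  (forall j i, (N <= j < n)%N -> (1 <= i <= k j)%N -> U j i w = U j i w').

Lemma agree_sym n w w' : agree n w w' -> agree n w' w.
Proof. by move=> [h1 h2]; split => *; [rewrite h1|rewrite h2]. Qed.

Lemma agree_le m n w w' : (m <= n)%N -> agree n w w' -> agree m w w'.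
Proof.
move=> mn [h1 h2]; split.
  by move=> i /andP[i1 im]; apply: h1; rewrite i1 (leq_trans im).
by move=> j i /andP[Nj jm] ik; apply: h2; rewrite // Nj (leq_trans jm).
Qed.

Lemma agree_new_edges j n w w' : (N <= j < n)%N -> agree n w w' ->
  new_edges j w = new_edges j w'.
Proof.
move=> /andP[Nj jn] [h1 h2]; rewrite /Defs.new_edges.
have E i : i \in index_iota 1 (k j).+1 -> U j i w = U j i w' /\ X (U j i w) w = X (U j
    i w') w'.
  rewrite mem_index_iota ltnS => ik; have e : U j i w = U j i w' by apply: h2; rewrite
      ?Nj.
  split => //; rewrite -e; apply: h1; have /andP[-> h] := U_range w Nj ik.
  exact: leq_trans h (ltnW jn).
rewrite (h1 j.+1)//.
rewrite (@eq_in_filter _ _ (fun i => X (U j i w') w' == X j.+1 w')).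
  apply/eq_in_map => i; rewrite mem_filter => /andP[_ /E[-> _]] //.
by move=> i /E[_ ->].
Qed.

Lemma agree_edges n w w' : agree n w w' -> edges n w = edges n w'.
Proof.
move=> ag; rewrite /Defs.edges; congr flatten; apply/eq_in_map => j.
by rewrite mem_index_iota => jn; exact: agree_new_edges ag.
Qed.

Lemma agree_indeg n m w w' : agree n w w' -> indeg N k X U n m w = indeg N k X U n m w'.
Proof. by move=> /agree_edges e; rewrite /indeg e. Qed.

Lemma agree_P n w w' : (N <= n)%N -> agree n.+1 w w' -> P_ k X U n w = P_ k X U n w'.
Proof.
move=> Nn [h1 h2]; rewrite !P_count; apply: eq_in_count => i.
rewrite mem_index_iota ltnS => ik; have e : U n i w = U n i w' by apply: h2; rewrite
    ?Nn/=.
rewrite -e; apply: h1; have /andP[-> h] := U_range w Nn ik; exact: leqW.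
Qed.

Definition max_sample n : nat := (\max_(j < n) k j)%N.

Definition history_type n : finType :=
  ({ffun 'I_n.+1 -> bool} * {ffun 'I_n * 'I_(max_sample n).+1 -> 'I_n.+1})%type.

(** A finite encoding of the classes of agree. Entries outside the range of
    the model get a constant default value, so that equal values mean equal
    histories. *)
Definition history n (w : T) : history_type n :=
  ([ffun i : 'I_n.+1 => (0 < i)%N && X i w],
   [ffun ji : 'I_n * 'I_(max_sample n).+1 =>
      if (N <= ji.1)%N && (1 <= ji.2 <= k ji.1)%N then inord (U ji.1 ji.2 w) else ord0]).

(** Each draw U_(j,i) is at most j, so no information is lost when it is
    stored as an element of a bounded ordinal. *)
Lemma history_agree n w w' : history n w = history n w' <-> agree n w w'.
Proof.
split=> [e|[h1 h2]].
  have e1 := congr1 fst e; have e2 := congr1 snd e; rewrite /= in e1 e2; split.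
    move=> i /andP[i0 im]; have im' : (i < n.+1)%N by [].
    have := congr1 (fun f : {ffun 'I_n.+1 -> bool} => f (Ordinal im')) e1.
    by rewrite !ffunE /= i0.
  move=> j i /andP[Nj jn] /[dup] ik /andP[i0 ik'].
  have im : (i < (max_sample n).+1)%N.
    by rewrite ltnS (leq_trans ik')// (@leq_bigmax _ (fun j : 'I_n => k j) (Ordinal jn)).
  have := congr1 (fun f : {ffun 'I_n * 'I_(max_sample n).+1 -> 'I_n.+1} =>
    f (Ordinal jn, Ordinal im)) e2.
  rewrite !ffunE /= Nj ik /= => /(congr1 val) /=.
  have lt w0 : (U j i w0 < n.+1)%N.
    by have /andP[_ h] := U_range w0 Nj ik; rewrite ltnS (leq_trans h)// ltnW.
  by rewrite !inordK.
congr pair; apply/ffunP => x; rewrite !ffunE.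
  by case: x => -[|i]//= im; rewrite h1.
case: ifP => // /andP[Nx ik]; congr inord; apply: h2 => //.
by rewrite Nx ltn_ord.
Qed.

Lemma history_refines n w w' : history n.+1 w = history n.+1 w' -> history n w =
    history n w'.
Proof. by move=> /history_agree ag; apply/history_agree; exact: agree_le ag. Qed.

End Counting.

(** * Conditional laws given the history *)

Section Law.
Context {d : measure_display} {T : measurableType d} {R : realType}.
Variables (P : probability T R) (N : nat) (k : nat -> nat).
Variables (X : nat -> T -> bool) (U : nat -> nat -> T -> nat).
Variables (beta : nat -> R) (g : R -> R).
Hypothesis N_gt0 : (1 <= N)%N.
Hypothesis k_gt0 : forall n, (N <= n)%N -> (0 < k n)%N.
Hypothesis beta_gt0 : forall n, (N <= n)%N -> 0 < beta n.
Hypothesis model : growing_sample_model N k X U P beta g.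

Local Notation agree := (agree N k X U).

Lemma X_measurable i : (1 <= i)%N -> measurable [set w | X i w].
Proof.
case: model => mX _ _ _ /mX mXi.
by have := mXi measurableT [set true] I; rewrite setTI.
Qed.

Lemma U_measurable n i m : (N <= n)%N -> (1 <= i <= k n)%N ->
  measurable [set w | U n i w = m].
Proof.
case: model => _ mU _ _ Nn ik; have [mUi _] := mU n i Nn ik.
by have := mUi measurableT [set m] I; rewrite setTI.
Qed.

Lemma U_in_range n i w : (N <= n)%N -> (1 <= i <= k n)%N -> (1 <= U n i w <= n)%N.
Proof. by case: model => _ mU _ _ Nn ik; have [_] := mU n i Nn ik. Qed.

(** An atom is an intersection of events that generate the sigma-algebra, or
    of their complements. *)
Lemma atom_F n w0 : F_ N k X U n [set w | agree n w0 w].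
Proof.
pose G : measurableType _ := g_sigma_algebraType (history_events N k X U n).
suff : @measurable _ G [set w | agree n w0 w] by [].
have -> : [set w | agree n w0 w] =
    (\bigcap_i [set w | (1 <= i <= n)%N -> X i w0 = X i w]) `&`
    (\bigcap_j \bigcap_i [set w | (N <= j < n)%N -> (1 <= i <= k j)%N -> U j i w0 = U j
        i w]).
  apply/seteqP; split => w /=.
    by move=> [h1 h2]; split => [i _|j _ i _] /=; [exact: h1|exact: h2].
  by move=> [h1 h2]; split => [i|j i]; [exact: h1|exact: (h2 j _ i)].
apply: measurableI.
  apply: bigcapT_measurable => i; have [i1|i1] := boolP (1 <= i <= n)%N; last first.
    by rewrite (_ : [set w | _] = setT)//; apply/seteqP; split.
  have mX : @measurable _ G [set w | X i w].
    by apply: sub_sigma_algebra; left; exists i.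
  have [x0|x0] := boolP (X i w0).
    rewrite (_ : [set w | _] = [set w | X i w])//.
    by apply/seteqP; split => w /=; [move=> <-|move=> ->].
  rewrite (_ : [set w | _] = ~` [set w | X i w]); first exact: measurableC.
  apply/seteqP; split => w /=; first by move=> <-//; exact/negP.
  by move=> /negP/negPf ->.
apply: bigcapT_measurable => j; apply: bigcapT_measurable => i.
have [j1|j1] := boolP (N <= j < n)%N; last first.
  by rewrite (_ : [set w | _] = setT)//; apply/seteqP; split.
have [i1|i1] := boolP (1 <= i <= k j)%N; last first.
  by rewrite (_ : [set w | _] = setT)//; apply/seteqP; split.
rewrite (_ : [set w | _] = [set w | U j i w = U j i w0]).
  by apply: sub_sigma_algebra; right; exists j, i, (U j i w0).
by apply/seteqP; split => w /=; [move=> ->|move=> ->].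
Qed.

Lemma F_measurable n A : F_ N k X U n A -> measurable A.
Proof.
apply: smallest_sub; first exact: sigma_algebra_measurable.
move=> E [[i [/andP[i1 _] ->]]|[j [i [m [/andP[Nj _] ik ->]]]]].
  exact: X_measurable.
exact: U_measurable.
Qed.

Lemma F_sample_of_F n A : F_ N k X U n A -> F_sample N k X U n A.
Proof. by apply: sub_sigma_algebra2 => E; left. Qed.

(** Vertices are numbered from 1 and samples here are functions between
    ordinals, hence the two successors. *)
Definition sample_event n (s : {ffun 'I_(k n) -> 'I_n}) : set T :=
  [set w | forall i : 'I_(k n), U n i.+1 w = (s i).+1].

Lemma sample_event_F n s : F_sample N k X U n (@sample_event n s).
Proof.
pose G : measurableType _ := g_sigma_algebraType (history_events N k X U n `|`
    sample_events k U n).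
suff : @measurable _ G (@sample_event n s) by [].
rewrite (_ : sample_event s = \bigcap_(i in [set: 'I_(k n)]) [set w | U n i.+1 w = (s
    i).+1]); last first.
  by apply/seteqP; split => w /= H i; [move=> _|]; exact: H.
apply: fin_bigcap_measurable; first exact: finite_finset.
move=> i _; apply: sub_sigma_algebra; right; exists i.+1, (s i).+1; split => //.
by rewrite ltnS /= ltn_ord.
Qed.

(** Conditional probabilities are only ever evaluated on sets where the
    version at hand is constant. *)
Lemma cond_prob_cst (G : set (set T)) (E A : set T) (q : T -> R) (c : R) :
  cond_prob P G E q -> G A -> measurable A -> (forall w, A w -> q w = c) ->
  P (E `&` A) = (c%:E * P A)%E.
Proof.
move=> [_ H] GA mA qc; rewrite (H A GA).
rewrite (@eq_integral _ _ _ P A (fun=> c%:E)); first by rewrite integral_cst.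
by move=> w /set_mem Aw; rewrite qc.
Qed.

Local Notation attach n w := (fun v : 'I_n => attach_prob N k X U beta n v.+1 w).
Local Notation plus n w := (fun v : 'I_n => X v.+1 w).

Lemma attach_den_gt0 n w : (N <= n)%N ->
  0 < (\sum_(1 <= j < n.+1) indeg N k X U n j w)%N%:R + n%:R * beta n :> R.
Proof.
move=> Nn; rewrite ltr_wpDl// mulr_gt0 ?beta_gt0// ltr0n.
exact: leq_trans Nn.
Qed.

Lemma attach_ge0 n w v : (N <= n)%N -> 0 <= attach n w v.
Proof.
move=> Nn; rewrite divr_ge0 ?(ltW (attach_den_gt0 _ Nn))//.
by rewrite addr_ge0// ltW// beta_gt0.
Qed.

Lemma sum_shift (F : nat -> R) n (p : pred nat) :
  \sum_(1 <= i < n.+1 | p i) F i = \sum_(v < n | p v.+1) F v.+1.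
Proof. by rewrite big_add1 big_mkord. Qed.

(** The attachment weights of the vertices of state +1 add up to B_n + A_n
    beta_n. *)
Lemma success_prob_attach n w :
  success_prob (attach n w) (plus n w) =
  ((B_ N k X U n w)%:R + (A_ X n w)%:R * beta n) / ((C_ N k X U n w)%:R + n%:R * beta n).
Proof.
rewrite /success_prob /attach_prob -mulr_suml big_split/=; congr (_ / _).
congr (_ + _).
  by rewrite /B_ natr_sum (@sum_shift (fun i => (indeg N k X U n i w)%:R) n (X^~ w)).
rewrite /A_ natr_sum (@sum_shift (fun i => 1) n (X^~ w)) mulr_suml.
by under [RHS]eq_bigr do rewrite mul1r.
Qed.

Lemma attach_sum1 n w : (N <= n)%N -> \sum_v attach n w v = 1.
Proof.
move=> Nn; rewrite /attach_prob -mulr_suml big_split/= sumr_const card_ord.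
rewrite -(@sum_shift (fun i => (indeg N k X U n i w)%:R) n predT) -natr_sum.
rewrite -[beta n *+ n]mulr_natl; apply: divff.
by rewrite gt_eqF// attach_den_gt0.
Qed.

Lemma attach_agree n w w' v : agree n w w' -> attach n w v = attach n w' v.
Proof.
move=> ag; rewrite /attach_prob; congr ((_ + _) / (_ + _)).
  by rewrite (agree_indeg U_in_range _ ag).
by congr (_%:R); apply: eq_bigr => j _; rewrite (agree_indeg U_in_range _ ag).
Qed.

(** The product form of the attachment law: given the past, the sample is
    independent and identically distributed. *)
Lemma sample_law n w0 s : (N <= n)%N ->
  P (sample_event s `&` [set w | agree n w0 w]) =
  ((sample_weight (attach n w0) s)%:E * P [set w | agree n w0 w])%E.
Proof.
move=> Nn; case: model => _ _ law _.
pose m i := if insub i.-1 is Some j then (s j).+1 else 1%N.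
have mE (i : 'I_(k n)) : m i.+1 = (s i).+1 by rewrite /m /= valK.
have mrange i : (1 <= i <= k n)%N -> (1 <= m i <= n)%N.
  by case: i => // i /andP[_ ik]; rewrite (mE (Ordinal ik)) ltnS /= ltn_ord.
have := cond_prob_cst (law n m Nn mrange) (@atom_F n w0) (F_measurable (@atom_F n w0)).
move=> /(_ (sample_weight (attach n w0) s)) <-.
  congr (P (_ `&` _)); apply/seteqP; split => w /= H.
    by case=> // i /andP[_ ik]; rewrite (mE (Ordinal ik)) -H.
  by move=> i; rewrite H ?mE// ltnS /= ltn_ord.
move=> w /agree_sym ag; rewrite big_add1 big_mkord; apply: eq_bigr => i _.
by rewrite mE; exact: attach_agree.
Qed.

Lemma P_on_sample n w0 s w : (N <= n)%N -> sample_event s w -> agree n w0 w ->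
  (P_ k X U n w)%:R / (k n)%:R = sample_freq (plus n w0) s :> R.
Proof.
move=> Nn sw [ag _]; rewrite /sample_freq /P_; congr (_%:R / _).
rewrite big_add1 big_mkord big_mkcond; apply: eq_bigr => i _.
by rewrite sw -ag ?ltn_ord//; case: (X _ _).
Qed.

Lemma new_state_law n w0 s : (N <= n)%N ->
  P ([set w | X n.+1 w] `&` (sample_event s `&` [set w | agree n w0 w])) =
  ((g (sample_freq (plus n w0) s))%:E * P (sample_event s `&` [set w | agree n w0 w]))%E.
Proof.
move=> Nn; case: model => _ _ _ law.
pose G : measurableType _ := g_sigma_algebraType (history_events N k X U n `|`
    sample_events k U n).
have FA : F_sample N k X U n (sample_event s `&` [set w | agree n w0 w]).
  apply: (@measurableI _ G); first exact: sample_event_F.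
  exact: F_sample_of_F (@atom_F n w0).
apply: (cond_prob_cst (law n Nn) FA).
  apply: measurableI; last exact: F_measurable (@atom_F n w0).
  have := @sample_event_F n s; apply: smallest_sub; first exact: sigma_algebra_measurable.
  move=> E [|[i [m [ik ->]]]]; last exact: U_measurable.
  by move=> hE; apply: (@F_measurable n); exact: sub_sigma_algebra.
by move=> w [sw ag]; rewrite (P_on_sample Nn sw ag).
Qed.

Definition outcome (G1 G0 : R -> R) n w : R :=
  if X n.+1 w then G1 ((P_ k X U n w)%:R / (k n)%:R) else G0 ((P_ k X U n w)%:R / (k
      n)%:R).

Definition mixed (G1 G0 : R -> R) (x : R) : R := G1 x * g x + G0 x * (1 - g x).

(** The conditional mean of outcome given the past: average over the sample,
    then over the new state, which is + with probability g of the sampled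
    proportion. *)
Definition expected_outcome (G1 G0 : R -> R) n w : R :=
  sample_mean (attach n w) (plus n w) (k n) (mixed G1 G0).

Lemma expected_outcome_agree G1 G0 n w w' : agree n w w' ->
  expected_outcome G1 G0 n w = expected_outcome G1 G0 n w'.
Proof.
move=> ag; rewrite /expected_outcome (_ : attach n w = attach n w'); last first.
  by apply/funext => v; exact: attach_agree.
rewrite (_ : plus n w = plus n w')//; apply/funext => v; apply: ag.1.
by rewrite ltnS leq0n ltn_ord.
Qed.

Lemma outcome_agree G1 G0 n w w' : (N <= n)%N -> agree n.+1 w w' ->
  outcome G1 G0 n w = outcome G1 G0 n w'.
Proof.
move=> Nn ag; rewrite /outcome (agree_P U_in_range Nn ag).
by rewrite (ag.1 n.+1)// ltnS leqnn.
Qed.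

(** Split the atom according to the sample drawn; on each piece the sampled
    proportion is constant, and the laws of the sample and of the new state
    multiply. *)
Lemma mean_outcome_atom G1 G0 n w0 : (N <= n)%N ->
  mean P (fun w => outcome G1 G0 n w * \1_[set w | agree n w0 w] w) =
  expected_outcome G1 G0 n w0 * mean P \1_[set w | agree n w0 w].
Proof.
move=> Nn; set A := [set w | agree n w0 w].
have mA : measurable A := F_measurable (@atom_F n w0).
have mS s : measurable (@sample_event n s).
  have := @sample_event_F n s; apply: smallest_sub; first exact: sigma_algebra_measurable.
  move=> E [|[i [m [ik ->]]]]; last exact: U_measurable.
  by move=> hE; apply: (@F_measurable n); exact: sub_sigma_algebra.
have mSA s : measurable (@sample_event n s `&` A) by exact: measurableI.
have mX : measurable [set w | X n.+1 w] by exact: X_measurable.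
have mXSA s : measurable ([set w | X n.+1 w] `&` (@sample_event n s `&` A)) by exact:
    measurableI.
pose c (s : {ffun 'I_(k n) -> 'I_n}) : R := sample_freq (plus n w0) s.
have sampled w : exists s, @sample_event n s w.
  have lt (i : 'I_(k n)) : ((U n i.+1 w).-1 < n)%N.
    by have /andP[h1 h2] := @U_in_range n i.+1 w Nn (ltn_ord i); rewrite prednK.
  exists [ffun i => Ordinal (lt i)] => i; rewrite ffunE /= prednK//.
  by have /andP[] := @U_in_range n i.+1 w Nn (ltn_ord i).
have sample_inj s s' w : @sample_event n s w -> @sample_event n s' w -> s = s'.
  by move=> h h'; apply/ffunP => i; apply/val_inj; have := h i; rewrite h' => -[].
(* Only the sample actually drawn at w contributes to the sum. *)
have decomp w : outcome G1 G0 n w * \1_A w = \sum_s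
    ((G1 (c s) - G0 (c s)) * \1_([set w | X n.+1 w] `&` (@sample_event n s `&` A)) w
     + G0 (c s) * \1_(@sample_event n s `&` A) w).
  have [s sw] := sampled w; rewrite (bigD1 s)//= big1 ?addr0; last first.
    move=> s' s's; rewrite !indicE !memNset ?mulr0 ?addr0//=.
      by move=> [s'w _]; rewrite (sample_inj _ _ _ s'w sw) eqxx in s's.
    by move=> [_ [s'w _]]; rewrite (sample_inj _ _ _ s'w sw) eqxx in s's.
  have [Aw|nAw] := pselect (A w); last first.
    by rewrite !indicE !memNset ?mulr0 ?addr0//= => [[_ ?]|[_ [_ ?]]].
  rewrite /outcome (P_on_sample Nn sw Aw) -/(c s) !indicE (mem_set Aw).
  rewrite [w \in _ `&` A]mem_set// !mulr1.
  have [Xw|Xw] := boolP (X n.+1 w).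
    by rewrite mem_set// mulr1 subrK.
  by rewrite memNset ?mulr0 ?add0r//= => -[]; rewrite (negPf Xw).
have PA : P A = (mean P \1_A)%:E by rewrite mean_indic.
have mean_SA s : mean P \1_(@sample_event n s `&` A) = sample_weight (attach n w0) s *
    mean P \1_A.
  by apply: EFin_inj; rewrite EFinM mean_indic// mean_indic// sample_law.
have mean_XSA s : mean P \1_([set w | X n.+1 w] `&` (@sample_event n s `&` A)) =
    g (c s) * (sample_weight (attach n w0) s * mean P \1_A).
  by rewrite -mean_SA; apply: EFin_inj; rewrite EFinM mean_indic// mean_indic//
      new_state_law.
have bi (E : set T) (r : R) : measurable E -> bounded_rv (fun w => r * \1_E w).
  by move=> mE; apply: bounded_rvM; [exact: bounded_rv_cst|exact: bounded_rv_indic].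
rewrite (_ : (fun w => _) = (fun w => \sum_s
    ((G1 (c s) - G0 (c s)) * \1_([set w | X n.+1 w] `&` (@sample_event n s `&` A)) w
     + G0 (c s) * \1_(@sample_event n s `&` A) w))); last exact/funext.
rewrite mean_sum; last by move=> s; apply: bounded_rvD; exact: bi.
rewrite /expected_outcome /sample_mean mulr_suml; apply: eq_bigr => s _.
rewrite meanD; [|exact: bi|exact: bi].
rewrite !meanZ; [|exact: bounded_rv_indic|exact: bounded_rv_indic].
rewrite mean_SA mean_XSA /mixed -/(c s); ring.
Qed.

Lemma agreeP n w w' : history N k X U n w = history N k X U n w' <-> agree n w w'.
Proof. exact: (history_agree X U_in_range). Qed.

Lemma atom_measurable m v : measurable [set w | history N k X U m w = v].
Proof.
have [[w1 w1v]|nv] := pselect (exists w, history N k X U m w = v); last first.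
  rewrite (_ : [set w | _] = set0)//; apply/seteqP; split => w //= wv.
  by apply: nv; exists w.
rewrite (_ : [set w | _] = [set w | agree m w1 w]).
  exact: F_measurable (@atom_F m w1).
apply/seteqP; split => w /=; first by move=> wh; apply/agreeP; rewrite w1v.
by move=> /agreeP <-.
Qed.

Section Noise.
Variables (G1 G0 : R -> R) (wt : nat -> R).
Hypothesis G1_01 : forall x, 0 <= x <= 1 -> 0 <= G1 x <= 1.
Hypothesis G0_01 : forall x, 0 <= x <= 1 -> 0 <= G0 x <= 1.
Hypothesis g_01 : forall x, 0 <= x <= 1 -> 0 <= g x <= 1.
Hypothesis wt_sq : small_tails (fun n => wt n ^+ 2).

(** The weighted deviation of an outcome from its conditional mean. The
    three coordinates of the process use the outcomes 1 or 0, x or 0, and x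
    or 1 - x, where x is the sampled proportion. *)
Definition noise n w : R :=
  if (N <= n)%N then wt n * (outcome G1 G0 n w - expected_outcome G1 G0 n w) else 0.

Lemma noise_determined n : history_determined (history N k X U) n.+1 (noise n).
Proof.
move=> w w' /agreeP ag; rewrite /noise; case: ifP => // Nn.
rewrite (outcome_agree _ _ Nn ag) (@expected_outcome_agree _ _ n w w')//.
exact: agree_le ag.
Qed.

Lemma noise_le n w : `|noise n w| <= `|wt n|.
Proof.
rewrite /noise; case: ifP => Nn; last by rewrite normr0.
rewrite normrM -[leRHS]mulr1 ler_wpM2l//.
have x01 : 0 <= ((P_ k X U n w)%:R / (k n)%:R : R) <= 1.
  by rewrite divr_ge0//= ler_pdivrMr ?ltr0n ?k_gt0// mul1r ler_nat P_le.
have o01 : 0 <= outcome G1 G0 n w <= 1.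
  by rewrite /outcome; case: ifP => _; [exact: G1_01|exact: G0_01].
have m01 x : 0 <= x <= 1 -> 0 <= mixed G1 G0 x <= 1.
  move=> h; have := G1_01 h; have := G0_01 h; have := g_01 h; rewrite /mixed.
  move: (G1 x) (G0 x) (g x) => a b c; nra.
have e01 : 0 <= expected_outcome G1 G0 n w <= 1.
  have a0 v : 0 <= attach n w v by exact: attach_ge0.
  have a1 := attach_sum1 w Nn; rewrite /expected_outcome.
  apply/andP; split.
    rewrite -(@sample_mean_cst _ _ (attach n w) (plus n w) (k n) a1 0).
    by apply: sample_mean_le => //; [exact: k_gt0|move=> x /m01/andP[]].
  rewrite -[leRHS](@sample_mean_cst _ _ (attach n w) (plus n w) (k n) a1 1).
  by apply: sample_mean_le => //; [exact: k_gt0|move=> x /m01/andP[]].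
by rewrite ler_norml; lra.
Qed.

Lemma noise_centered n h :
  mean P (fun w => noise n w * \1_[set w | history N k X U n w = h] w) = 0.
Proof.
have [[w0 w0h]|none] := pselect (exists w, history N k X U n w = h); last first.
  rewrite (_ : (fun w => _) = fun=> 0) ?mean_cst//; apply/funext => w.
  by rewrite indicE memNset ?mulr0//= => wh; apply: none; exists w.
rewrite (_ : [set w | _] = [set w | agree n w0 w]); last first.
  apply/seteqP; split => w /=; first by move=> wh; apply/agreeP; rewrite w0h.
  by move=> /agreeP <-.
rewrite /noise; case: (leqP N n) => Nn; last first.
  by rewrite (_ : (fun w => _) = fun=> 0) ?mean_cst//; apply/funext => w; rewrite mul0r.
set A := [set w | agree n w0 w].
have mA : measurable A := F_measurable (@atom_F n w0).
have bI : bounded_rv (\1_A : T -> R) by exact: bounded_rv_indic.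
have bO : bounded_rv (fun w => outcome G1 G0 n w * \1_A w).
  apply: bounded_rvM => //.
  apply: (@history_determined_bounded _ _ _ (history_type k) (history N k X U) _ n.+1).
    exact: atom_measurable.
  by move=> w w' /agreeP ag; exact: outcome_agree.
rewrite (_ : (fun w => _) = (fun w => wt n * (outcome G1 G0 n w * \1_A w -
    expected_outcome G1 G0 n w0 * \1_A w))); last first.
  apply/funext => w; rewrite -mulrA; congr (_ * _).
  have [Aw|nAw] := pselect (A w); last by rewrite indicE memNset// !mulr0 subrr.
  by rewrite mulrBl (expected_outcome_agree _ _ Aw).
have bE : bounded_rv (fun w => expected_outcome G1 G0 n w0 * \1_A w).
  by apply: bounded_rvM => //; exact: bounded_rv_cst.
by rewrite meanZ ?meanB ?meanZ ?mean_outcome_atom ?subrr ?mulr0//; exact: bounded_rvB.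
Qed.

Lemma noise_small_tails : {ae P, forall w, small_tails (fun n => noise n w)}.
Proof.
apply: (@martingale_series_cauchy _ _ _ P (history_type k) (history N k X U) _ _ noise
    (fun n => `|wt n|)).
- exact: atom_measurable.
- by move=> n w w'; exact: (history_refines U_in_range).
- exact: noise_determined.
- exact: noise_le.
- exact: noise_centered.
move=> e e0; have [n0 H] := wt_sq e0; exists n0 => m.
have [nm|mn] := leqP n0 m; last by rewrite big_geq ?(ltnW mn)// ltW.
have := H n0 m; rewrite leqnn nm => /(_ isT); rewrite ger0_norm; last first.
  by apply: sumr_ge0 => j _; exact: sqr_ge0.
by apply: le_trans; apply: ler_sum => j _; rewrite real_normK ?num_real.
Qed.

End Noise.

End Law.

(** * Retraction onto the domain of the drift *)

Section Retraction.
Context {R : realType}.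
Implicit Types (u v z : state R) (x y a b m : R).

Lemma maxr_lip x y a m : `|x - y| <= m -> `|Num.max x a - Num.max y a| <= m.
Proof.
rewrite !ler_norml => /andP[h1 h2].
by case: (leP x a) => ?; case: (leP y a) => ?; lra.
Qed.

Lemma minr_lip x y a b m : `|x - y| <= m -> `|a - b| <= m ->
  `|Num.min x a - Num.min y b| <= m.
Proof.
rewrite !ler_norml => /andP[h1 h2] /andP[h3 h4].
by case: (leP x a) => ?; case: (leP y b) => ?; lra.
Qed.

Definition clamp x : R := Num.min (Num.max x 0) 1.

(** The second coordinate is cut at the retracted third one, because Shat is
    not a box: it requires b <= c. *)
Definition retract z : state R :=
  (clamp z.1.1, Num.min (Num.max z.1.2 0) (clamp z.2), clamp z.2).

Lemma clamp_lip x y m : `|x - y| <= m -> `|clamp x - clamp y| <= m.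
Proof.
move=> xy; apply: minr_lip; first exact: maxr_lip.
by rewrite subrr normr0 (le_trans _ xy).
Qed.

Lemma retract_lip u v : `|retract u - retract v| <= `|u - v|.
Proof.
have [h1 h2 h3] := state_coord_norm (u - v).
rewrite state_norm_le /=; apply/and3P; split; try exact: clamp_lip.
by apply: minr_lip; [exact: maxr_lip|exact: clamp_lip].
Qed.

Lemma clamp_itv x : 0 <= clamp x <= 1.
Proof. by rewrite /clamp le_min le_max ge_min ler01 !lexx !orbT. Qed.

Lemma clamp_id x : 0 <= x <= 1 -> clamp x = x.
Proof. by move=> /andP[x0 x1]; rewrite /clamp max_l// min_l. Qed.

Lemma retract_Shat z : Shat (retract z).
Proof.
have a01 := clamp_itv z.1.1; have := clamp_itv z.2; rewrite /Shat /=.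
move: (clamp z.2) => c c01.
have bc : 0 <= Num.min (Num.max z.1.2 0) c <= c.
  by rewrite le_min le_max ge_min !lexx !orbT/= andbT; case/andP: c01.
split => //; last by case/andP: bc.
by case/andP: bc => -> /le_trans; apply; case/andP: c01.
Qed.

Lemma retract_id z : Shat z -> retract z = z.
Proof.
move=> [a01 b01 c01 bc]; apply: state_eqP; rewrite /retract /= !clamp_id//.
by split => //; rewrite max_l ?min_l//; case/andP: b01.
Qed.

Lemma Shat_compact : compact (@Shat R).
Proof.
have cI : compact (`[(0 : R), 1]%classic) by exact: segment_compact.
apply: (@subclosed_compact _ _ ((`[(0 : R), 1]%classic `*` `[(0 : R), 1]%classic) `*`
    `[(0 : R), 1]%classic)).
- have cp (p : state R -> R) : (forall w v : state R, `|p w - p v| <= `|w - v|) ->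
    continuous p.
    move=> pl z; apply/cvgrPdist_lt => e e0; near=> t; apply: (le_lt_trans (pl _ _)).
    by near: t; have /cvgrPdist_lt/(_ e e0) := @cvg_id _ (nbhs z).
  have c1 : continuous (fun z : state R => z.1.1).
    by apply: cp => w v; case: (state_coord_norm (w - v)).
  have c2 : continuous (fun z : state R => z.1.2).
    by apply: cp => w v; case: (state_coord_norm (w - v)).
  have c3 : continuous (fun z : state R => z.2).
    by apply: cp => w v; case: (state_coord_norm (w - v)).
  have cl (p : state R -> R) : continuous p -> closed (p @^-1` [set y | 0 <= y]).
    by move=> cp'; apply: closed_comp => [z _|]; [exact: cp'|exact: closed_ge].
  rewrite (_ : @Shat R = (fun z : state R => z.1.1) @^-1` [set y | 0 <= y] `&`
     (fun z : state R => 1 - z.1.1) @^-1` [set y | 0 <= y] `&`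
     (fun z : state R => z.1.2) @^-1` [set y | 0 <= y] `&`
     (fun z : state R => z.2 - z.1.2) @^-1` [set y | 0 <= y] `&`
     (fun z : state R => 1 - z.2) @^-1` [set y | 0 <= y]).
    repeat apply: closedI; apply: cl => // z.
    + by apply: cvgB; [exact: cvg_cst|exact: c1].
    + by apply: cvgB; [exact: c3|exact: c2].
    + by apply: cvgB; [exact: cvg_cst|exact: c3].
  apply/seteqP; split => -[[a b] c]; rewrite /Shat /=.
    by move=> [? ? ? ?]; repeat split; lra.
  by move=> [[[[? ?] ?] ?] ?]; split; lra.
- by apply: compact_setX => //; exact: compact_setX.
- by move=> z [a01 b01 c01 _]; split; [split|]; rewrite /= in_itv.
Unshelve. all: by end_near.
Qed.

End Retraction.

(** * The drift as a globally Lipschitz field *)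

Section DriftField.
Context {R : realType}.
Variables (eta alpha : R) (g : R -> R) (L : R).
Hypothesis eta01 : 0 < eta < 1.
Hypothesis alpha_gt0 : 0 < alpha.
Hypothesis g01 : forall x, 0 <= x <= 1 -> 0 <= g x <= 1.
Hypothesis L_gt0 : 0 < L.
Hypothesis g_lip : lipschitz01 g L.
Implicit Types (u v z : state R).

Local Notation q := (q_alpha alpha).

Lemma q_den_gt0 z : Shat z -> 0 < z.2 + alpha.
Proof.
case: z => [[a b] c]; rewrite /Shat /= => -[_ _ /andP[c0 _] _].
by rewrite ltr_wpDl.
Qed.

Lemma q_itv z : Shat z -> 0 <= q z <= 1.
Proof.
move=> zS; have d0 := q_den_gt0 zS; move: z zS d0 => [[a b] c] [/= a01 b01 c01 bc] d0.
have aa : 0 <= alpha * a <= alpha.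
  by move: alpha_gt0 => al0; nra.
by rewrite /q_alpha /= divr_ge0 ?ler_pdivrMr//=; lra.
Qed.

Definition q_lip_cst : R := (2 + alpha) / alpha.

(** The denominator is at least alpha, and the quotient itself is at most 1,
    which gives the constant (2 + alpha) / alpha. *)
Lemma q_lip u v : Shat u -> Shat v -> `|q u - q v| <= q_lip_cst * `|u - v|.
Proof.
move=> uS vS; have du := q_den_gt0 uS; have dv := q_den_gt0 vS.
have qv := q_itv vS; have [h1 h2 h3] := state_coord_norm (u - v); rewrite /= in h1 h2 h3.
have m0 := normr_ge0 (u - v); set m := `|u - v| in h1 h2 h3 m0 *.
have -> : q u - q v = ((u.1.2 - v.1.2) + alpha * (u.1.1 - v.1.1) + q v * (v.2 - u.2)) /
    (u.2 + alpha).
  rewrite /q_alpha; field; by rewrite !gt_eqF.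
rewrite normrM normfV (gtr0_norm du) ler_pdivrMr//.
apply: (@le_trans _ _ ((2 + alpha) * m)).
  apply: (le_trans (ler_normD _ _)); apply: (le_trans (lerD (ler_normD _ _) (lexx _))).
  move: (q v) qv => r r01.
  rewrite !normrM (gtr0_norm alpha_gt0) [`|v.2 - _|]distrC.
  have -> : `|r| = r by rewrite ger0_norm//; case/andP: r01.
  have : r * `|u.2 - v.2| <= 1 * m by case/andP: r01 => ? ?; rewrite ler_pM.
  have : alpha * `|u.1.1 - v.1.1| <= alpha * m by rewrite ler_wpM2l// ltW.
  lra.
have -> : (2 + alpha) * m = q_lip_cst * m * alpha.
  by rewrite /q_lip_cst; field; rewrite gt_eqF.
have ql0 : 0 <= q_lip_cst by rewrite divr_ge0 ?addr_ge0 ?(ltW alpha_gt0).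
apply: ler_wpM2l; first exact: mulr_ge0.
rewrite lerDr.
by move: uS; rewrite /Shat /= => -[_ _ /andP[]].
Qed.

(** The target point is computed from the retracted state, but the linear
    attraction towards it acts on the state itself; this keeps the field
    pointing towards Shat. *)
Definition drift_ext z : state R := (eta * (g (q (retract z)) - z.1.1),
  varphi g (q (retract z)) - z.1.2, psi g (q (retract z)) - z.2).

Lemma drift_extE z : Shat z -> drift eta alpha g z = drift_ext z.
Proof. by move=> zS; rewrite /drift_ext retract_id. Qed.

Lemma g_norm_le1 x : 0 <= x <= 1 -> `|g x| <= 1.
Proof. by move=> /g01/andP[? ?]; rewrite ger0_norm. Qed.

Lemma varphi_itv x : 0 <= x <= 1 -> 0 <= varphi g x <= 1.
Proof. by move=> x01; have := g01 x01; rewrite /varphi; nra. Qed.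

Lemma psi_itv x : 0 <= x <= 1 -> varphi g x <= psi g x <= 1.
Proof. by move=> x01; have := g01 x01; rewrite /varphi /psi; nra. Qed.

Lemma drift_ext_lipschitz : exists2 K, 0 < K & forall u v,
  `|drift_ext u - drift_ext v| <= K * `|u - v|.
Proof.
have Lphi : lipschitz01 (varphi g) ((`|1 : R| + `|0 : R|) * L + `|1 : R| + `|0 : R|).
  by rewrite varphiE; apply: lipschitz_affine_mul => //; exact: g_norm_le1.
have Lpsi : lipschitz01 (psi g) ((`|2 : R| + `|-1 : R|) * L + `|2 : R| + `|-1 : R|).
  by rewrite psiE; apply: lipschitz_affine_mul => //; exact: g_norm_le1.
rewrite normr1 normr0 !addr0 mul1r in Lphi.
rewrite normrN normr1 normr_nat in Lpsi.
pose M := (3 * L + 3); have M0 : 0 < M by rewrite /M; have := L_gt0; lra.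
have ql0 : 0 < q_lip_cst by rewrite divr_gt0// addr_gt0.
exists (M * q_lip_cst + 1); first by rewrite addr_gt0// mulr_gt0.
move=> u v; have [h1 h2 h3] := state_coord_norm (u - v); rewrite /= in h1 h2 h3.
have qq : `|q (retract u) - q (retract v)| <= q_lip_cst * `|u - v|.
  apply: (le_trans (q_lip (retract_Shat u) (retract_Shat v))).
  by rewrite ler_wpM2l ?(ltW ql0)// retract_lip.
have comp (f : R -> R) Lf (x y : R) : lipschitz01 f Lf -> Lf <= M -> `|x - y| <= `|u -
    v| ->
    `|(f (q (retract u)) - x) - (f (q (retract v)) - y)| <= (M * q_lip_cst + 1) * `|u -
        v|.
  move=> fL LM xy.
  rewrite (_ : _ - _ = (f (q (retract u)) - f (q (retract v))) - (x - y)); last by ring.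
  rewrite (le_trans (ler_normB _ _))// mulrDl mul1r lerD//.
  apply: (le_trans (fL _ _ (q_itv (retract_Shat u)) (q_itv (retract_Shat v)))).
  rewrite -mulrA ler_pM// ?(le_trans _ LM)//.
  have := fL 0 1; rewrite lexx ler01 sub0r normrN normr1 mulr1 => /(_ isT) H.
  by apply: le_trans (H _); rewrite ?lexx ?ler01.
rewrite state_norm_le /=; apply/and3P; split.
- rewrite -mulrBr normrM -[leRHS]mul1r ler_pM//; first by case/andP: eta01 => ? ?;
    rewrite gtr0_norm// ltW.
  by apply: comp g_lip _ h1; rewrite /M; have := L_gt0; lra.
- by apply: comp Lphi _ h2; rewrite /M; have := L_gt0; lra.
- by apply: comp Lpsi _ h3; rewrite /M; have := L_gt0; lra.
Qed.

Lemma drift_ext_le1 u : Shat u -> `|drift_ext u| <= 1.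
Proof.
move=> uS; have q01 := q_itv uS; rewrite -drift_extE//.
have := g01 q01; have := varphi_itv q01; have := psi_itv q01.
rewrite /drift /h1 /h2 /h3 -/(varphi g _) -/(psi g _); move: uS => [a01 b01 c01 bc].
move: (g _) (varphi g _) (psi g _) => G F S S1 F1 G1.
rewrite state_norm_le /=; apply/and3P; split; rewrite ler_norml; [|lra|lra].
by have := eta01; nra.
Qed.

(** y(t) e^(lam t) is nondecreasing. *)
Lemma relaxation_ge0 (y dy : R -> R) (lam t : R) : (forall s : R, is_derive s 1 y (dy
    s)) ->
  (forall s, 0 <= dy s + lam * y s) -> 0 <= y 0 -> 0 <= t -> 0 <= y t.
Proof.
move=> yd H y0 t0.
have E (s : R) : is_derive s 1 (fun r => expR (lam * r)) (lam * expR (lam * s)).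
  exact: is_derive_expRM.
have D (s : R) : is_derive s 1 (y * (fun r => expR (lam * r))) (y s * (lam * expR (lam
    * s)) + expR (lam * s) * dy s).
  exact: (@is_deriveM _ _ y (fun r => expR (lam * r)) s 1 _ _ (yd s) (E s)).
have : (y * (fun r => expR (lam * r))) 0 <= (y * (fun r => expR (lam * r))) t.
  apply: nondecreasing_of_deriv t0 (fun s _ => D s) _ _.
    by apply: continuous_subspaceT => s; exact: is_derive_continuous (D s).
  move=> s _; rewrite (_ : _ + _ = expR (lam * s) * (dy s + lam * y s)); last ring.
  by rewrite mulr_ge0// expR_ge0.
rewrite !fctE mulr0 expR0 mulr1 => le.
by have := le_trans y0 le; rewrite pmulr_lge0// expR_gt0.
Qed.

Variable K : R.
Hypothesis K_gt0 : 0 < K.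
Hypothesis lipK : forall u v, `|drift_ext u - drift_ext v| <= K * `|u - v|.

(** Shat is the set where a, 1 - a, b, c - b and 1 - c are nonnegative. Each
    of these quantities relaxes towards the nonnegative value that it takes
    at the target. *)
Lemma flow_Shat u t : Shat u -> 0 <= t -> Shat (flow K_gt0 lipK u t).
Proof.
move=> [a01 b01 c01 bc] t0; set x := flow K_gt0 lipK u.
have x0 : x 0 = u by exact: flow0.
have D s : has_velocity x s (drift_ext (x s)) by exact: flow_velocity.
have Q s : 0 <= q (retract (x s)) <= 1 by apply: q_itv; exact: retract_Shat.
have eta0 : 0 < eta by case/andP: eta01.
have hB (f h : R -> R) (df dh s : R) : is_derive s 1 f df -> is_derive s 1 h dh ->
    is_derive s 1 (fun r => f r - h r) (df - dh).
  by move=> fd hd; apply: is_deriveB.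
have cst1 (s : R) : is_derive s 1 (fun _ : R => 1 : R) 0 by exact: is_derive_cst.
have p1 : 0 <= (x t).1.1.
  apply: (@relaxation_ge0 (fun s => (x s).1.1) (fun s => (drift_ext (x s)).1.1) eta) =>
      [s|s||//]; first by case: (D s) => + _ _; exact.
    by rewrite /=; have := g01 (Q s); move: (g _) => G; nra.
  by rewrite x0; lra.
have p2 : 0 <= 1 - (x t).1.1.
  apply: (@relaxation_ge0 (fun s => 1 - (x s).1.1) (fun s => 0 - (drift_ext (x s)).1.1)
      eta) => [s|s||//].
  - by case: (D s) => ds _ _; exact: hB (cst1 s) ds.
  - by rewrite /=; have := g01 (Q s); move: (g _) => G; nra.
  - by rewrite x0; lra.
have p3 : 0 <= (x t).1.2.
  apply: (@relaxation_ge0 (fun s => (x s).1.2) (fun s => (drift_ext (x s)).1.2) 1) =>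
      [s|s||//]; first by case: (D s) => _ + _; exact.
    by rewrite /=; have := varphi_itv (Q s); lra.
  by rewrite x0; lra.
have p4 : 0 <= (x t).2 - (x t).1.2.
  apply: (@relaxation_ge0 (fun s => (x s).2 - (x s).1.2) (fun s => (drift_ext (x s)).2
      - (drift_ext (x s)).1.2) 1) => [s|s||//].
  - by case: (D s) => _ d2 d3; exact: hB d3 d2.
  - by rewrite /=; have := psi_itv (Q s); lra.
  - by rewrite x0; lra.
have p5 : 0 <= 1 - (x t).2.
  apply: (@relaxation_ge0 (fun s => 1 - (x s).2) (fun s => 0 - (drift_ext (x s)).2) 1)
      => [s|s||//].
  - by case: (D s) => _ _ ds; exact: hB (cst1 s) ds.
  - by rewrite /=; have := psi_itv (Q s); lra.
  - by rewrite x0; lra.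
by split; lra.
Qed.

End DriftField.

(** * The normalised statistics as a stochastic approximation *)

Section Assembly.
Context {R : realType} {d : measure_display} {T : measurableType d}.
Variables (P : probability T R) (N : nat) (k : nat -> nat) (alpha eta : R).
Variables (g : R -> R) (beta : nat -> R) (X : nat -> T -> bool) (U : nat -> nat -> T ->
    nat).
Hypothesis N_gt0 : (1 <= N)%N.
Hypothesis k_gt0 : forall n, (N <= n)%N -> (0 < k n)%N.
Hypothesis alpha_gt0 : 0 < alpha.
Hypothesis g01 : forall x, 0 <= x <= 1 -> 0 <= g x <= 1.
Hypothesis beta_gt0 : forall n, (N <= n)%N -> 0 < beta n.
Hypothesis betaE : forall n, (N < n)%N -> n%:R * beta n = alpha * (s_ N k n)%:R.
Hypothesis model : growing_sample_model N k X U P beta g.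
Hypothesis eta01 : 0 < eta < 1.

Definition step n : R := (k n)%:R / (s_ N k n.+1)%:R.
Definition ratio n : R := (s_ N k n.+1)%:R / (n.+1%:R * (k n)%:R).

Hypothesis ratio_cvg : ratio n @[n --> \oo] --> eta.
Hypothesis step_div : ~ summable_from N step.
Hypothesis step_sq : summable_from N (fun n => (k n)%:R ^+ 2 / (s_ N k n.+1)%:R ^+ 2 : R).
Hypothesis ratio_dev : summable_from N (fun n => step n * `|ratio n - eta|).

Local Notation z w := (fun n => stat N k X U n w : state R).
Local Notation q n w := (q_alpha alpha (stat N k X U n w : state R)).
Local Notation inv n := (n.+1%:R^-1 : R).

Lemma s_gt0 n : (N < n)%N -> (0 < s_ N k n)%N.
Proof.
case: n => // n; rewrite ltnS => Nn; rewrite s_S// addn_gt0 k_gt0// orbT//.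
Qed.

Lemma step_ge0 n : 0 <= step n.
Proof. by rewrite /step divr_ge0. Qed.

Lemma step_ratio n : (N <= n)%N -> step n * ratio n = inv n.
Proof.
move=> Nn; rewrite /step /ratio; field.
by rewrite nat1r !pnatr_eq0 -!lt0n k_gt0// s_gt0// ltnS.
Qed.

Lemma small_tails_eqfrom N0 (a b : nat -> R) : (forall n, (N0 <= n)%N -> a n = b n) ->
  small_tails b -> small_tails a.
Proof.
move=> e tb r r0; have [n0 H] := tb r r0; exists (maxn N0 n0) => n m /andP[].
rewrite geq_max => /andP[N0n n0n] nm.
rewrite (eq_big_nat _ _ (F2 := b)); first by apply: H; rewrite n0n.
by move=> j /andP[nj _]; apply: e; exact: leq_trans nj.
Qed.

Lemma step_sq_tails : small_tails (fun n => step n ^+ 2).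
Proof.
apply: (@small_tails_eqfrom 0) (summable_small_tails step_sq) => n _.
by rewrite /step expr_div_n.
Qed.

Lemma step_sq_bound e : 0 < e -> exists n0, forall n m, (n0 <= n)%N ->
  \sum_(n <= j < m) step j ^+ 2 <= e.
Proof.
move=> e0; have [n0 H] := step_sq_tails e0; exists n0 => n m n0n.
have [nm|mn] := leqP n m; last by rewrite big_geq ?(ltnW mn)// ltW.
by apply: (le_trans (ler_norm _)); apply: H; rewrite n0n.
Qed.

Lemma step_diverges C : exists n, C <= clock step n.
Proof.
apply: contrapT => /forallNP H; apply: step_div.
have mono : nondecreasing_seq (fun n => \sum_(N <= j < n) step j).
  apply/nondecreasing_seqP => n; have [Nn|nN] := leqP N n.
    by rewrite big_nat_recr//= lerDl step_ge0.
  by rewrite big_geq ?(ltnW nN)//; apply: sumr_ge0 => j _; exact: step_ge0.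
apply: nondecreasing_is_cvgn => //; exists C => _ [n _ <-].
apply: le_trans (_ : clock step n <= C); last first.
  by rewrite leNgt; apply/negP => Cn; apply: (H n); exact: ltW.
rewrite /clock; have [Nn|nN] := leqP N n.
  by rewrite [leRHS](@big_cat_nat _ _ _ N)//= lerDr; apply: sumr_ge0 => j _; exact:
      step_ge0.
by rewrite big_geq ?(ltnW nN)//; apply: sumr_ge0 => j _; exact: step_ge0.
Qed.

(** Eventually ratio n < 1 because eta < 1, hence 1/(n+1) <= step n. *)
Lemma inv_sq_tails : small_tails (fun n => inv n ^+ 2).
Proof.
have /cvgrPdist_lt/(_ (1 - eta)) := ratio_cvg; case/andP: eta01 => eta0 eta1.
rewrite subr_gt0 => /(_ eta1)[n0 _ H].
apply: (@small_tails_le _ (maxn N n0) 1 _ (fun n => step n ^+ 2)); last exact: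
    step_sq_tails.
move=> n; rewrite geq_max => /andP[Nn n0n]; rewrite mul1r ger0_norm ?sqr_ge0//.
rewrite lerXn2r ?nnegrE ?invr_ge0 ?step_ge0// -step_ratio// -[leRHS]mulr1.
rewrite ler_wpM2l ?step_ge0//; have := H n n0n; rewrite /= ltr_norml; lra.
Qed.

Lemma stat_Shat n w : Shat (stat N k X U n w : state R).
Proof.
have [mX mU _ _] := model; have Ur := U_in_range model.
have div01 (a b : nat) : (a <= b)%N -> 0 <= (a%:R / b%:R : R) <= 1.
  move=> ab; rewrite divr_ge0//=; have [->|b0] := posnP b; first by rewrite invr0 mulr0.
  by rewrite ler_pdivrMr ?ltr0n// mul1r ler_nat.
split => /=.
- exact/div01/A_le.
- by apply: div01; exact: leq_trans (B_le_C X Ur n w) (C_le_s X Ur n w).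
- by apply: div01; exact: (C_le_s X Ur).
- by rewrite ler_wpM2r ?invr_ge0// ler_nat B_le_C.
Qed.

(** The relation n beta_n = alpha s_n makes the success probability of a
    draw a function of the normalised statistics alone. *)
Lemma success_prob_q n w : (N < n)%N ->
  success_prob (fun v : 'I_n => attach_prob N k X U beta n v.+1 w)
    (fun v : 'I_n => X v.+1 w) = q n w.
Proof.
move=> Nn; rewrite success_prob_attach /q_alpha /=.
have n0 : n%:R != 0 :> R by rewrite pnatr_eq0 -lt0n (leq_ltn_trans _ Nn).
have s0 : 0 < (s_ N k n)%:R :> R by rewrite ltr0n s_gt0.
have -> : beta n = alpha * (s_ N k n)%:R / n%:R by rewrite -betaE// mulrAC mulfV// mul1r.
have dn : (C_ N k X U n w)%:R + alpha * (s_ N k n)%:R != 0.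
  by rewrite gt_eqF// ltr_wpDl// mulr_gt0.
by field; rewrite n0 dn gt_eqF.
Qed.

Local Notation noise_ G1 G0 wt := (noise N k X U beta g G1 G0 wt).
Local Notation out G1 G0 := (outcome k X U G1 G0).
Local Notation expect G1 G0 := (expected_outcome N k X U beta g G1 G0).

Lemma bias_tails (wt : nat -> R) G1 G0 w : (forall n, 0 <= wt n) ->
  bias_controlled N k wt (mixed g G1 G0) ->
  small_tails (fun n => if (N < n)%N then wt n * (expect G1 G0 n w - mixed g G1 G0 (q n
      w)) else 0).
Proof.
move=> wt0 [sl [b0 [b1 [H tails]]]].
apply: (small_tails_le (N := N) (C := 1)) tails => n Nn; rewrite mul1r.
have [b00 b10 chord] := H n Nn.
case: ifP => [Nn'|_]; last first.
  by rewrite normr0 mulr_ge0// addr_ge0// divr_ge0// sqrtr_ge0.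
rewrite normrM ger0_norm// ler_wpM2l// -(success_prob_q w Nn').
set a := (fun v : 'I_n => attach_prob N k X U beta n v.+1 w).
have a0 v : 0 <= a v by exact: attach_ge0.
have a1 : \sum_v a v = 1 by exact: attach_sum1.
apply: (@sample_mean_bias _ _ a _ _ (k_gt0 Nn) a0 a1 _ (sl n (success_prob a (fun v :
    'I_n => X v.+1 w))) _ _ b00 b10).
by move=> x x01; apply: chord => //; rewrite success_prob_q//; apply: q_itv => //;
    exact: stat_Shat.
Qed.

(** Insert the conditional mean. *)
Lemma noise_bias_split (wt : nat -> R) G1 G0 n w : (N < n)%N ->
  wt n * (out G1 G0 n w - mixed g G1 G0 (q n w)) = noise_ G1 G0 wt n w +
    (if (N < n)%N then wt n * (expect G1 G0 n w - mixed g G1 G0 (q n w)) else 0).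
Proof. by move=> Nn; rewrite /noise Nn (ltnW Nn) -mulrDr addrA subrK. Qed.

Lemma A_step n w : (N < n)%N ->
  (stat N k X U n.+1 w).1.1 - (stat N k X U n w).1.1 =
  inv n * (out (cst 1) (cst 0) n w - (stat N k X U n w).1.1) :> R.
Proof.
move=> Nn; rewrite /= A_S natrD /outcome.
have n0 : n%:R != 0 :> R by rewrite pnatr_eq0 -lt0n (leq_ltn_trans _ Nn).
have n1 : n%:R + 1 != 0 :> R by rewrite natr1 pnatr_eq0.
by rewrite -natr1; case: (X _ _) => /=; field; rewrite n0 n1.
Qed.

Lemma B_step n w : (N < n)%N ->
  (stat N k X U n.+1 w).1.2 - (stat N k X U n w).1.2 =
  step n * (out id (cst 0) n w - (stat N k X U n w).1.2) :> R.
Proof.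
move=> Nn; rewrite /= (B_S X (U_in_range model))// ?(ltnW Nn)//.
have s0 : (s_ N k n)%:R != 0 :> R by rewrite pnatr_eq0 -lt0n s_gt0.
have k0 : (k n)%:R != 0 :> R by rewrite pnatr_eq0 -lt0n k_gt0// ltnW.
have s1 : (s_ N k n)%:R + (k n)%:R != 0 :> R by rewrite -natrD -s_S ?(ltnW Nn)//
    pnatr_eq0 -lt0n s_gt0// ltnW.
rewrite /outcome /step s_S ?(ltnW Nn)// !natrD natrM.
by case: (X _ _) => /=; field; rewrite ?s0 ?k0 ?s1.
Qed.

Lemma C_step n w : (N < n)%N ->
  (stat N k X U n.+1 w).2 - (stat N k X U n w).2 =
  step n * (out id (fun x => 1 - x) n w - (stat N k X U n w).2) :> R.
Proof.
move=> Nn; rewrite /= (C_S X (U_in_range model))// ?(ltnW Nn)//.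
have s0 : (s_ N k n)%:R != 0 :> R by rewrite pnatr_eq0 -lt0n s_gt0.
have k0 : (k n)%:R != 0 :> R by rewrite pnatr_eq0 -lt0n k_gt0// ltnW.
have s1 : (s_ N k n)%:R + (k n)%:R != 0 :> R by rewrite -natrD -s_S ?(ltnW Nn)//
    pnatr_eq0 -lt0n s_gt0// ltnW.
rewrite /outcome /step s_S ?(ltnW Nn)// !natrD.
case: (X _ _) => /=; first by field; rewrite ?s0 ?k0 ?s1.
by rewrite natrB ?P_le//; field; rewrite ?s0 ?k0 ?s1.
Qed.

Lemma mixed_g : mixed g (cst 1) (cst 0) = g.
Proof. by apply/funext => x; rewrite /mixed /cst mul1r mul0r addr0. Qed.

Lemma mixed_varphi : mixed g id (cst 0) = varphi g.
Proof. by apply/funext => x; rewrite /mixed /cst mul0r addr0. Qed.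

Lemma mixed_psi : mixed g id (fun x => 1 - x) = psi g.
Proof. by apply/funext => x; rewrite /mixed mulrC [X in _ + X]mulrC /psi mulrC [X in _
    = _ + X]mulrC. Qed.

Lemma sum_coords (F : nat -> state R) n m :
  [/\ (\sum_(n <= j < m) F j).1.1 = \sum_(n <= j < m) (F j).1.1,
      (\sum_(n <= j < m) F j).1.2 = \sum_(n <= j < m) (F j).1.2
    & (\sum_(n <= j < m) F j).2 = \sum_(n <= j < m) (F j).2].
Proof.
by split; elim: (index_iota n m) => [|j r IH]; rewrite ?big_nil// !big_cons/= IH.
Qed.

Hypothesis bias1 : bias_controlled N k (fun n => inv n) g.
Hypothesis bias2 : bias_controlled N k step (varphi g).
Hypothesis bias3 : bias_controlled N k step (psi g).

(** The error of the first coordinate is noise, plus bias, plus the mismatch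
    between 1/(n+1) and eta times the step; the other two coordinates have
    no mismatch. *)
Lemma perturbation_tails w :
  small_tails (fun n => noise_ (cst 1) (cst 0) (fun n => inv n) n w) ->
  small_tails (fun n => noise_ id (cst 0) step n w) ->
  small_tails (fun n => noise_ id (fun x => 1 - x) step n w) ->
  forall e, 0 < e -> exists n0, forall n m, (n0 <= n <= m)%N ->
    `|\sum_(n <= j < m) perturbation (drift_ext eta alpha g) (z w) step j| <= e.
Proof.
move=> t1 t2 t3.
have p1 : small_tails (fun n => (perturbation (drift_ext eta alpha g) (z w) step n).1.1).
  have b1 := bias1; rewrite -mixed_g in b1.
  have inv0 n : 0 <= inv n by rewrite invr_ge0.
  have tb := bias_tails w inv0 b1.
  have tr : small_tails (fun n => (inv n - step n * eta) * (g (q n w) - (stat N k X U n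
      w).1.1)).
    apply: (small_tails_le (N := N) (C := 1)) (summable_small_tails ratio_dev) => n Nn.
    have gq := g01 (q_itv alpha_gt0 (stat_Shat n w)).
    have [a01 _ _ _] := stat_Shat n w.
    rewrite mul1r -step_ratio// -mulrBr normrM normrM (ger0_norm (step_ge0 n)).
    rewrite -[leRHS]mulr1 ler_wpM2l ?mulr_ge0 ?step_ge0// ler_norml; lra.
  apply: (@small_tails_eqfrom N.+1) (small_tailsD (small_tailsD t1 tb) tr).
  move=> n Nn; rewrite -noise_bias_split//.
  rewrite /perturbation /=.
  have := A_step w Nn; rewrite /= => ->.
  rewrite retract_id ?mixed_g; last exact: stat_Shat.
  by rewrite -[step n *: _]/(step n * _); ring.
have p2 : small_tails (fun n => (perturbation (drift_ext eta alpha g) (z w) step n).1.2).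
  have b2 := bias2; rewrite -mixed_varphi in b2.
  apply: (@small_tails_eqfrom N.+1) (small_tailsD t2 (bias_tails w step_ge0 b2)).
  move=> n Nn; rewrite -noise_bias_split//.
  rewrite /perturbation /=.
  have := B_step w Nn; rewrite /= => ->.
  rewrite retract_id ?mixed_varphi; last exact: stat_Shat.
  by rewrite -[step n *: _]/(step n * _); ring.
have p3 : small_tails (fun n => (perturbation (drift_ext eta alpha g) (z w) step n).2).
  have b3 := bias3; rewrite -mixed_psi in b3.
  apply: (@small_tails_eqfrom N.+1) (small_tailsD t3 (bias_tails w step_ge0 b3)).
  move=> n Nn; rewrite -noise_bias_split//.
  rewrite /perturbation /=.
  have := C_step w Nn; rewrite /= => ->.
  rewrite retract_id ?mixed_psi; last exact: stat_Shat.
  by rewrite -[step n *: _]/(step n * _); ring.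
move=> e e0; have [n1 H1] := p1 _ e0; have [n2 H2] := p2 _ e0; have [n3 H3] := p3 _ e0.
exists (maxn n1 (maxn n2 n3)) => n m /andP[].
rewrite !geq_max => /and3P[n1n n2n n3n] nm; rewrite state_norm_le.
have [-> -> ->] := sum_coords (perturbation (drift_ext eta alpha g) (z w) step) n m.
by rewrite H1 ?H2 ?H3// ?n1n ?n2n ?n3n.
Qed.

Lemma almost_sure_limit_set L : 0 < L -> lipschitz01 g L ->
  {ae P, forall w,
    (exists x, the_solution (drift eta alpha g) (@Shat R)
       `[0, +oo[%classic ((A_ X N w)%:R / N%:R, 0, 0) x) /\
    exists Lim : set (state R),
      [/\ compact Lim, connected Lim, Lim `<=` @Shat R,
          internally_chain_transitive (drift eta alpha g) (@Shat R) Lim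
        & converges_to_set (fun n => stat N k X U n w) Lim]}.
Proof.
move=> L0 gL.
have [K K0 lipK] := drift_ext_lipschitz eta01 alpha_gt0 g01 L0 gL.
have flowD := flow_Shat eta01 alpha_gt0 g01 K0 lipK.
have one01 (x : R) : 0 <= x <= 1 -> 0 <= cst (1 : R) x <= 1 by rewrite /cst ler01 lexx.
have zero01 (x : R) : 0 <= x <= 1 -> 0 <= cst (0 : R) x <= 1 by rewrite /cst ler01 lexx.
have id01 (x : R) : 0 <= x <= 1 -> 0 <= id x <= 1 by [].
have sub01 (x : R) : 0 <= x <= 1 -> 0 <= 1 - x <= 1 by lra.
have a1 := noise_small_tails N_gt0 k_gt0 beta_gt0 model one01 zero01 g01 inv_sq_tails.
have a2 := noise_small_tails N_gt0 k_gt0 beta_gt0 model id01 zero01 g01 step_sq_tails.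
have a3 := noise_small_tails N_gt0 k_gt0 beta_gt0 model id01 sub01 g01 step_sq_tails.
apply: filterS3 a1 a2 a3 => w t1 t2 t3; split.
  have u0S : Shat ((A_ X N w)%:R / N%:R : R, 0 : R, 0 : R).
    rewrite /Shat /= lexx ler01; split => //.
    by rewrite divr_ge0//= ler_pdivrMr ?ltr0n// mul1r ler_nat A_le.
  exists (flow K0 lipK ((A_ X N w)%:R / N%:R, 0, 0)).
  apply: flow_the_solution; [exact: drift_extE|by right|].
  by move=> t; rewrite /= in_itv/= andbT => t0; exact: flowD.
apply: (@stochastic_approximation _ (drift_ext eta alpha g) K K0 lipK (@Shat R) _ _ _
    flowD _ (z w) step).
- exact: drift_extE.
- exact: Shat_compact.
- exact: drift_ext_le1.
- by move=> n; exact: stat_Shat.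
- exact: step_ge0.
- exact: step_sq_bound.
- exact: step_diverges.
- exact: perturbation_tails.
Qed.

End Assembly.

Unset Implicit Arguments.

Theorem theorem4p7 (R : realType) (d : measure_display) (T : measurableType d)
  (P : probability T R)
  (N : nat) (k : nat -> nat) (alpha p eta : R) (f : R -> R) (beta : nat -> R)
  (X : nat -> T -> bool) (U : nat -> nat -> T -> nat) :
  (1 <= N)%N ->
  (forall n, (N <= n)%N -> (0 < k n)%N) ->
  k @ \oo --> \oo ->
  0 < alpha ->
  0 <= p <= 1 -> p <> 2^-1 ->
  (forall x, 0 <= x <= 1 -> 0 <= f x <= 1) ->
  (forall n, (N <= n)%N -> 0 < beta n) ->
  (forall n, (N < n)%N -> n%:R * beta n = alpha * (s_ N k n)%:R) ->
  growing_sample_model N k X U P beta (reinforce p f) ->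
  0 < eta < 1 ->
  (s_ N k n.+1)%:R / (n.+1%:R * (k n)%:R) @[n --> \oo] --> eta ->
  ~ summable_from N (fun n => (k n)%:R / (s_ N k n.+1)%:R : R) ->
  summable_from N (fun n => (k n)%:R ^+ 2 / (s_ N k n.+1)%:R ^+ 2 : R) ->
  summable_from N (fun n => (k n)%:R / (s_ N k n.+1)%:R
     * `|(s_ N k n.+1)%:R / (n.+1%:R * (k n)%:R) - eta|) ->
  [\/ assumption_A1 N k (reinforce p f),
      assumption_A2 N k (reinforce p f)
    | assumption_A3 N k (reinforce p f)] ->
  {ae P, forall w,
    (exists x, the_solution (drift eta alpha (reinforce p f)) (@Shat R)
       `[0, +oo[%classic ((A_ X N w)%:R / N%:R, 0, 0) x) /\
    exists L : set (state R),
      [/\ compact L, connected L, L `<=` @Shat R,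
          internally_chain_transitive (drift eta alpha (reinforce p f))
            (@Shat R) L
        & converges_to_set (fun n => stat N k X U n w) L]}.
Proof.
move=> N0 k0 _ alpha0 p01 _ f01 beta0 betaE model eta01 ratio_cvg div sq dev A.
have g01 x : 0 <= x <= 1 -> 0 <= reinforce p f x <= 1.
  move=> /f01; rewrite /reinforce; move: (f x) => y y01.
  have : 0 <= p * y by apply: mulr_ge0; lra.
  have : 0 <= p * (1 - y) by apply: mulr_ge0; lra.
  have : 0 <= (1 - p) * y by apply: mulr_ge0; lra.
  have : 0 <= (1 - p) * (1 - y) by apply: mulr_ge0; lra.
  lra.
have [[L L0 gL] b1 b2 b3] := bias_control k0 g01 A.
exact: (almost_sure_limit_set N0 k0 alpha0 g01 beta0 betaE model eta01 ratio_cvg div sq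
    dev b1 b2 b3 L0 gL).
Qed.
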